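(* Let $n\ge1$, $m>1$, let $\mathcal{Z}=\{z_i\}_{i=1}^m$ be distinct points of $\mathbb{B}^n$ and $\mathcal{W}=\{w_i\}_{i=1}^m\subset\mathbb{D}$, with the $w_i$ not all equal. Suppose there exists $\varphi\in\mathcal{S}(\mathbb{B}^n)$ with $\varphi(z_i)=w_i$ for all $i$. Let $\psi_{\mathcal{Z},\mathcal{W}}=\sum_{j=1}^mc_jK_n(\cdot,z_j)$ with $(c_1,\dots,c_m)^{T}=[K_n(z_i,z_j)]_{m\times m}^{-1}(w_1,\dots,w_m)^{T}$, and let $\Pi_{\mathcal{Z},\mathcal{W}}:(\mathcal{M}_{\mathcal{Q}_{\mathcal{Z}}},\|\cdot\|_1)\to\mathbb{C}$ be the functional $\Pi_{\mathcal{Z},\mathcal{W}}f=\int_{\mathbb{S}^n}\psi_{\mathcal{Z},\mathcal{W}}f\,d\sigma$. Then, setting $$\widehat w_j=\frac{1}{\|\Pi_{\mathcal{Z},\mathcal{W}}\|}\,w_j\qquad(j=1,\dots,m),$$ one has $\widehat{\mathcal{W}}=\{\widehat w_1,\dots,\widehat w_m\}\subset\mathbb{D}$, and $\mathcal{Z}$ and $\widehat{\mathcal{W}}$ solve the extremal problem.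
   Context: $\mathbb{B}^n$ is the open unit ball of $\mathbb{C}^n$, $\mathbb{D}=\mathbb{B}^1$, $\mathbb{S}^n=\partial\mathbb{B}^n$, $\sigma$ the normalized surface measure on $\mathbb{S}^n$. $H^\infty(\mathbb{B}^n)$: bounded analytic functions on $\mathbb{B}^n$ with sup norm; $\mathcal{S}(\mathbb{B}^n)$: its closed unit ball. Data $\mathcal{Z}=\{z_i\}_{i=1}^m$, $\mathcal{W}=\{w_i\}_{i=1}^m$ solve the extremal problem if there exists $\varphi\in\mathcal{S}(\mathbb{B}^n)$ with $\varphi(z_i)=w_i$ for all $i$, and every such $\varphi\in\mathcal{S}(\mathbb{B}^n)$ satisfies $\|\varphi\|_\infty=1$. $H^2(\mathbb{S}^n)=\overline{\mathbb{C}[z_1,\dots,z_n]}^{L^2(\mathbb{S}^n)}$, identified via boundary values with the Hardy space $H^2(\mathbb{B}^n)$. $K_n(z,w)=(1-\langle z,w\rangle)^{-n}$ for $z,w\in\mathbb{B}^n$, with $\langle z,w\rangle=\sum_i z_i\overline{w_i}$; for distinct points the matrix $[K_n(z_i,z_j)]$ is invertible. $\mathcal{Q}_{\mathcal{Z}}=\operatorname{span}\{K_n(\cdot,z_j):j=1,\dots,m\}$. For $S\subseteq L^2(\mathbb{S}^n)$, $S^{conj}=\{\overline f:f\in S\}$. $\mathcal{M}(\mathbb{S}^n)=L^2(\mathbb{S}^n)\ominus[H^2(\mathbb{S}^n)+H^2(\mathbb{S}^n)^{conj}]$; $H^2_0(\mathbb{S}^n)=H^2(\mathbb{S}^n)\ominus\{1\}$.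 $\mathcal{M}_{\mathcal{Q}_{\mathcal{Z}}}=\mathcal{Q}_{\mathcal{Z}}^{conj}\dot+[\mathcal{M}(\mathbb{S}^n)\dot+H^2_0(\mathbb{S}^n)]$ ($\dot+$ = algebraic direct sum), viewed as a subspace of $L^1(\mathbb{S}^n)$ with its norm $\|\cdot\|_1$; $\|\Pi_{\mathcal{Z},\mathcal{W}}\|$ is the norm as a linear functional on $(\mathcal{M}_{\mathcal{Q}_{\mathcal{Z}}},\|\cdot\|_1)$. *)

(* Defs.v *)
From HB Require Import structures.
From mathcomp Require Import all_boot all_order all_algebra.
From mathcomp Require Import all_classical all_reals all_analysis measurable_realfun.
From mathcomp Require Import complex.
From mathcomp Require mpoly.

Set Implicit Arguments.
Unset Strict Implicit.
Unset Printing Implicit Defensive.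

Import Order.TTheory GRing.Theory Num.Theory.
Import numFieldNormedType.Exports.
Import Normc.

Local Open Scope classical_set_scope.
Local Open Scope ring_scope.
Local Open Scope complex_scope.

(* R[i] carries the sigma-algebra of R * R transported by (Re, Im), i.e. its
   Borel sets; n.-tuple R[i] then gets the product sigma-algebra from the
   library. *)
Section complex_measurable.
Variable R : realType.

Definition ReIm (z : R[i]) : measurableTypeR R * measurableTypeR R :=
  (complex.Re z, complex.Im z).

Let H := @sigma_algebra_preimage _ _ _ setT ReIm
           (@sigma_algebra_measurable _ _).

Let cmeasurable0 : preimage_set_system setT ReIm measurable set0.
Proof. by case: H. Qed.

Let cmeasurableC A : preimage_set_system setT ReIm measurable A ->
  preimage_set_system setT ReIm measurable (~` A).
Proof. by case: H => _ HC _ /HC; rewrite setTD. Qed.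

Let cmeasurable_bigcup (F : (set R[i])^nat) :
  (forall k, preimage_set_system setT ReIm measurable (F k)) ->
  preimage_set_system setT ReIm measurable (\bigcup_k F k).
Proof. by case: H => _ _; apply. Qed.

HB.instance Definition _ := isPointed.Build R[i] 0.
HB.instance Definition _ := @isMeasurable.Build (preimage_display ReIm)
  R[i] (preimage_set_system setT ReIm measurable)
  cmeasurable0 cmeasurableC cmeasurable_bigcup.

Lemma measurable_ReIm : measurable_fun [set: R[i]] ReIm.
Proof. by move=> _ B mB; exists B. Qed.

Lemma measurable_Re :
  measurable_fun [set: R[i]] (@complex.Re R : R[i] -> measurableTypeR R).
Proof. exact: (measurableT_comp measurable_fst measurable_ReIm). Qed.

Lemma measurable_Im :
  measurable_fun [set: R[i]] (@complex.Im R : R[i] -> measurableTypeR R).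
Proof. exact: (measurableT_comp measurable_snd measurable_ReIm). Qed.

Lemma measurable_fun_complexP d (T : measurableType d) (f : T -> R[i]) :
  measurable_fun [set: T] f <->
  measurable_fun [set: T] (fun x => complex.Re (f x) : measurableTypeR R) /\
  measurable_fun [set: T] (fun x => complex.Im (f x) : measurableTypeR R).
Proof.
split=> [mf|[mr mi]].
  by split; [exact: (measurableT_comp measurable_Re)
            |exact: (measurableT_comp measurable_Im)].
move=> _ A [B mB <-]; rewrite !setTI.
have := measurable_fun_pair mr mi => /(_ measurableT _ mB); rewrite setTI.
exact.
Qed.

Definition mkC (p : measurableTypeR R * measurableTypeR R) : R[i] :=
  p.1 +i* p.2.

Lemma measurable_mkC : measurable_fun setT mkC.
Proof.
apply/measurable_fun_complexP.
by split; [exact: measurable_fst|exact: measurable_snd].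
Qed.

Lemma measurable_normc :
  measurable_fun [set: R[i]] (@normc R : R[i] -> measurableTypeR R).
Proof.
rewrite (_ : @normc R =
  (fun x => ((complex.Re x) ^+ 2 + (complex.Im x) ^+ 2) `^ 2^-1)); last first.
  by apply/funext => -[a b] /=; rewrite powR12_sqrt// addr_ge0 ?sqr_ge0.
apply: (@measurableT_comp _ _ _ _ _ _ (@powR R ^~ 2^-1)) => //.
by apply: measurable_funD; apply: measurable_funX;
  [exact: measurable_Re|exact: measurable_Im].
Qed.

End complex_measurable.

(* The image of a product of sigma-finite measures by a measurable embedding f;
   the measurable retraction g is only used for sigma-finiteness. *)
Definition product_image d1 d2 d3 (T1 : measurableType d1)
    (T2 : measurableType d2) (T3 : measurableType d3) (R : realType)
    (m1 : {sigma_finite_measure set T1 -> \bar R})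
    (m2 : {sigma_finite_measure set T2 -> \bar R})
    (f : T1 * T2 -> T3) (g : T3 -> T1 * T2)
    (mf : measurable_fun setT f) (mg : measurable_fun setT g)
    (fK : cancel f g) : set T3 -> \bar R :=
  pushforward (m1 \x m2)%E f.

Section product_image.
Context d1 d2 d3 (T1 : measurableType d1) (T2 : measurableType d2)
  (T3 : measurableType d3) (R : realType).
Variables (m1 : {sigma_finite_measure set T1 -> \bar R})
  (m2 : {sigma_finite_measure set T2 -> \bar R}).
Variables (f : T1 * T2 -> T3) (g : T3 -> T1 * T2).
Hypotheses (mf : measurable_fun setT f) (mg : measurable_fun setT g).
Hypothesis fK : cancel f g.

Local Notation mu := (product_image m1 m2 mf mg fK).

Let image0 : mu set0 = 0.
Proof. by rewrite /product_image /pushforward preimage_set0 measure0. Qed.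

Let image_ge0 A : (0 <= mu A)%E.
Proof. by rewrite /product_image /pushforward. Qed.

Let image_sigma_additive : semi_sigma_additive mu.
Proof.
exact: (@measure_semi_sigma_additive _ _ _
  (measure_function_pushforward__canonical__measure_function_Measure
     (m1 \x m2)%E mf)).
Qed.

HB.instance Definition _ := isMeasure.Build _ _ _ mu
  image0 image_ge0 image_sigma_additive.

Let image_sigma_finite : sigma_finite setT mu.
Proof.
have /sigma_finiteP[F [TF ndF Foo]] := sigma_finiteT m1.
have /sigma_finiteP[G [TG ndG Goo]] := sigma_finiteT m2.
exists (fun k => g @^-1` (F k `*` G k)).
  rewrite predeqE => t; split=> // _.
  have [i _ Fi] : (\bigcup_i F i) (g t).1 by rewrite -TF.
  have [j _ Gj] : (\bigcup_i G i) (g t).2 by rewrite -TG.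
  exists (maxn i j) => //; split.
    by move: Fi; exact/subsetPset/ndF/leq_maxl.
  by move: Gj; exact/subsetPset/ndG/leq_maxr.
move=> k; have [mF Fk] := Foo k; have [mG Gk] := Goo k; split.
  by rewrite -[X in measurable X]setTI; apply: mg => //; exact: measurableX.
rewrite /product_image /pushforward -comp_preimage.
rewrite (_ : g \o f = id); last exact/funext.
by rewrite preimage_id product_measure1E// lte_mul_pinfty// ge0_fin_numE.
Qed.

HB.instance Definition _ := Measure_isSigmaFinite.Build _ _ _ mu
  image_sigma_finite.

End product_image.

Section tuple_measure.
Context d (T : measurableType d) (R : realType).
Variable mu : {sigma_finite_measure set T -> \bar R}.

Definition tcons n (p : T * n.-tuple T) : n.+1.-tuple T :=
  [tuple of p.1 :: p.2].

Definition tuncons n (t : n.+1.-tuple T) : T * n.-tuple T :=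
  (thead t, [tuple of behead t]).

Lemma measurable_tcons n : measurable_fun setT (@tcons n).
Proof. exact: measurable_cons. Qed.

Lemma measurable_tuncons n : measurable_fun setT (@tuncons n).
Proof.
apply: measurable_fun_pair; last exact: measurable_behead.
exact: measurable_tnth.
Qed.

Lemma tconsK n : cancel (@tcons n) (@tuncons n).
Proof. by move=> [x t]; congr pair; apply/val_inj. Qed.

Fixpoint tuple_measure n : {sigma_finite_measure set (n.-tuple T) -> \bar R} :=
  match n with
  | 0 => \d_[tuple]
  | n'.+1 => product_image mu (tuple_measure n')
      (@measurable_tcons n') (@measurable_tuncons n') (@tconsK n')
  end.

End tuple_measure.

Section sphere.
Variable R : realType.
Local Notation C := R[i].

Lemma mkCK : cancel (@mkC R) (@ReIm R).
Proof. by case. Qed.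

Definition lebesgueC : {sigma_finite_measure set C -> \bar R} :=
  product_image (@lebesgue_measure R) (@lebesgue_measure R)
    (@measurable_mkC R) (@measurable_ReIm R) mkCK.

Variable n : nat.
Local Notation Cn := (n.-tuple C).

Definition lebesgueCn : {sigma_finite_measure set Cn -> \bar R} :=
  tuple_measure lebesgueC n.

Definition inner (z w : Cn) : C := \sum_(i < n) tnth z i * (tnth w i)^*.

Definition enorm (z : Cn) : R := Num.sqrt (\sum_(i < n) normc (tnth z i) ^+ 2).

Definition unit_ball : set Cn := [set z | enorm z < 1].

Definition radial (z : Cn) : Cn := [tuple (enorm z)^-1%:C * tnth z i | i < n].

Lemma measurable_enorm :
  measurable_fun setT (enorm : Cn -> measurableTypeR R).
Proof.
rewrite (_ : enorm = (fun z => (\sum_(i < n) normc (tnth z i) ^+ 2) `^ 2^-1)).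
  apply: (@measurableT_comp _ _ _ _ _ _ (@powR R ^~ 2^-1)) => //.
  apply: measurable_sum => i; apply: measurable_funX.
  by apply: (measurableT_comp (@measurable_normc R)); exact: measurable_tnth.
apply/funext => z; rewrite powR12_sqrt// sumr_ge0// => i _; exact: sqr_ge0.
Qed.

Lemma measurable_unit_ball : measurable unit_ball.
Proof.
rewrite -[unit_ball]setTI; exact: (measurable_enorm measurableT
  (measurable_itv `]-oo, 1[)).
Qed.

Lemma measurable_radial : measurable_fun setT radial.
Proof.
apply/measurable_fun_tnthP => i.
have mV : measurable_fun setT (fun z : Cn => (enorm z)^-1 : measurableTypeR R).
  rewrite (_ : (fun z => _) = (fun z : Cn => (enorm z) `^ (-1))).
    apply: (@measurableT_comp _ _ _ _ _ _ (@powR R ^~ (-1))) => //.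
    exact: measurable_enorm.
  by apply/funext => z; rewrite powR_inv1// sqrtr_ge0.
have mi := @measurable_tnth _ C n i.
have [mre mim] := (measurable_fun_complexP _).1 mi.
apply/measurable_fun_complexP; split.
  rewrite (_ : (fun z => _) =
      (fun z : Cn => (enorm z)^-1 * complex.Re (tnth z i))).
    exact: measurable_funM.
  apply/funext => z /=; rewrite tnth_mktuple.
  by case: (tnth z i) => a b /=; rewrite mul0r subr0.
rewrite (_ : (fun z => _) =
    (fun z : Cn => (enorm z)^-1 * complex.Im (tnth z i))).
  exact: measurable_funM.
apply/funext => z /=; rewrite tnth_mktuple.
  by case: (tnth z i) => a b /=; rewrite mul0r addr0.
Qed.

(* The normalized surface measure of the unit sphere, as the cone measure
   sigma(A) = |{z in B : z / |z| in A}| / |B|, seen as a measure on Cn that is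
   concentrated on the sphere: a function on the sphere is represented by any of
   its measurable extensions to Cn. *)
Definition sphere_measure (A : set Cn) : \bar R :=
  ((fine (lebesgueCn unit_ball))^-1%:E *
   lebesgueCn (radial @^-1` A `&` unit_ball))%E.

Let cone : {measure set Cn -> \bar R} :=
  mrestr lebesgueCn measurable_unit_ball.

Let sigma0 : sphere_measure set0 = 0.
Proof. by rewrite /sphere_measure preimage_set0 set0I measure0 mule0. Qed.

Let sigma_ge0 A : (0 <= sphere_measure A)%E.
Proof. by rewrite mule_ge0// lee_fin invr_ge0 fine_ge0. Qed.

Let sigma_sigma_additive : semi_sigma_additive sphere_measure.
Proof.
have c0 : 0 <= (fine (lebesgueCn unit_ball))^-1 by rewrite invr_ge0 fine_ge0.
exact: (@measure_semi_sigma_additive _ _ _ (mscale (NngNum c0)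
  (measure_function_pushforward__canonical__measure_function_Measure
     cone measurable_radial))).
Qed.

HB.instance Definition _ := isMeasure.Build _ _ _ sphere_measure
  sigma0 sigma_ge0 sigma_sigma_additive.

End sphere.

(* Elements of L^p are represented by functions rather than by their classes
   modulo mu-a.e. equality. *)
Section complex_Lebesgue_spaces.
Context d (T : measurableType d) (R : realType).
Variable mu : {measure set T -> \bar R}.
Implicit Types (f g : T -> R[i]) (A B : set (T -> R[i])).

Definition cintegral f : R[i] :=
  Rintegral mu setT (fun x => complex.Re (f x)) +i*
  Rintegral mu setT (fun x => complex.Im (f x)).

Definition cLnorm (p : \bar R) f : \bar R :=
  Lnorm mu p (fun x => (normc (f x))%:E).

Definition L2 : set (T -> R[i]) :=
  [set f | measurable_fun setT f /\ (cLnorm 2%:E f < +oo)%E].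

Definition L2inner f g : R[i] := cintegral (fun x => f x * (g x)^*).

Definition ominus A B : set (T -> R[i]) :=
  [set f | A f /\ forall g, B g -> L2inner f g = 0].

Definition fun_sum A B : set (T -> R[i]) :=
  [set (fun x => f x + g x) | f in A & g in B].

Definition fun_conj A : set (T -> R[i]) := [set (fun x => (f x)^*) | f in A].

End complex_Lebesgue_spaces.

Section ball_functions.
Variables (R : realType) (n : nat).
Local Notation C := R[i].
Local Notation Cn := (n.-tuple C).
Local Notation sigma := (@sphere_measure R n).

Definition monomial (alpha : {ffun 'I_n -> nat}) (z : Cn) : C :=
  \prod_(i < n) tnth z i ^+ alpha i.

(* f is the sum of an absolutely convergent power series near a; the sum is
   taken along the cubes {alpha | alpha_i < N for all i}. *)
Definition analytic_at (f : Cn -> C) (a : Cn) : Prop :=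
  exists (r : R) (c : {ffun 'I_n -> nat} -> C), 0 < r /\
    forall h : Cn, enorm h < r ->
      (\esum_(alpha in setT) (normc (c alpha * monomial alpha h))%:E < +oo)%E /\
      normc (\sum_(beta : {ffun 'I_n -> 'I_N})
               (let alpha := [ffun i => beta i : nat] in
                c alpha * monomial alpha h)
             - f [tuple tnth a i + tnth h i | i < n]) @[N --> \oo] --> (0 : R).

Definition sup_norm (f : Cn -> C) : \bar R :=
  ereal_sup [set (normc (f z))%:E | z in @unit_ball R n].

Definition Hinfty : set (Cn -> C) :=
  [set f | (forall z, unit_ball z -> analytic_at f z) /\ (sup_norm f < +oo)%E].

Definition schur_class : set (Cn -> C) :=
  [set f | Hinfty f /\ (sup_norm f <= 1)%E].

Definition solves_extremal m (z : 'I_m -> Cn) (w : 'I_m -> C) : Prop :=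
  (exists phi, schur_class phi /\ forall i, phi (z i) = w i) /\
  (forall phi, schur_class phi -> (forall i, phi (z i) = w i) ->
     sup_norm phi = 1%E).

Definition polynomial_fun (p : mpoly.mpoly n C) (z : Cn) : C :=
  mpoly.meval (tnth z) p.

Definition H2 : set (Cn -> C) :=
  [set f | L2 sigma f /\ forall e : R, 0 < e ->
     exists p : mpoly.mpoly n C,
       (cLnorm sigma 2%:E (fun z => f z - polynomial_fun p z)%R < e%:E)%E].

Definition H20 : set (Cn -> C) := ominus sigma H2 [set cst 1].

Definition Mspace : set (Cn -> C) :=
  ominus sigma (L2 sigma) (fun_sum H2 (fun_conj H2)).

(* For w in the ball the denominator does not vanish on the closed ball. *)
Definition kernel (z w : Cn) : C := ((1 - inner z w) ^+ n)^-1.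

Section interpolation_data.
Variables (m : nat) (z : 'I_m -> Cn) (w : 'I_m -> C).

Definition Qspace : set (Cn -> C) :=
  [set (fun x => \sum_(j < m) a j * kernel x (z j)) | a in [set: 'I_m -> C]].

(* The three summands are pairwise orthogonal up to null functions (conj Q is
   contained in conj H2), so this sum of subspaces is the direct one. *)
Definition MQ : set (Cn -> C) := fun_sum (fun_conj Qspace) (fun_sum Mspace H20).

Definition coeffs : 'cV[C]_m :=
  invmx (\matrix_(i < m, j < m) kernel (z i) (z j)) *m \col_(i < m) w i.

Definition psi (x : Cn) : C := \sum_(j < m) coeffs j ord0 * kernel x (z j).

Definition Pi (f : Cn -> C) : C := cintegral sigma (fun x => psi x * f x).

(* operator norm of Pi on MQ with the norm of L^1(sigma) *)
Definition Pi_norm : \bar R :=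
  ereal_sup [set (normc (Pi f))%:E | f in
               [set f | MQ f /\ (cLnorm sigma 1%:E f <= 1)%E]].

End interpolation_data.

End ball_functions.

(* Main.v *)
(* Let N be the norm of Pi and K_y = K_n(., y).

   If phi is analytic, bounded by M, and interpolates W, it is close at the z_i
   to polynomials p with |p| <= M + e on the sphere.  Since p - psi lies in H^2,
   it annihilates M(S^n) and H^2_0, and it acts on conj Q through its values at
   the z_i; so the functional given by p is close to Pi on the unit ball of M_Q,
   and N <= M.

   Conversely, let A be the set of interpolating functions of H^2 and B the set
   of functions with |G| <= N.  The least element u of the closure of A - B is
   orthogonal to the functions of H^2 vanishing at the z_i, so conj u lies in
   M_Q, and duality gives u = 0.  Near-minimizers of the norm in B near A then
   converge to some f in A in the closure of B.  The function y |-> <f, K_y> is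
   analytic and interpolates W, and it is bounded by N because
   <f, K_y> K_n(y, y) is the integral of f |K_y|^2.  If |<f, K_y>| = N at some y,
   then f is constant, which is excluded; hence |w_j| < N.

   The reproducing property of K_y rests on the orthogonality of the monomials
   (by rotation invariance) and on their norms, obtained by computing Gaussian
   integrals over C^n in two ways. *)

From mathcomp Require Import all_boot all_order all_algebra.
From mathcomp Require Import all_classical all_reals all_analysis measurable_realfun.
From mathcomp Require Import complex ring lra.
From mathcomp Require separable cyclotomic cyclic.
From mathcomp Require Import(canonicals, coercions) mpoly.
Require Import Defs.

Set Implicit Arguments.
Unset Strict Implicit.
Unset Printing Implicit Defensive.

Import Order.TTheory GRing.Theory Num.Theory Normc.
Import numFieldNormedType.Exports.
Local Open Scope classical_set_scope.
Local Open Scope complex_scope.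
Local Open Scope ring_scope.

Local Arguments normc : simpl never.

(** * Complex numbers and power series in one variable *)

(** Two obstacles shape the argument. Bounded analytic functions live on the ball and the functional
    on the sphere, but no boundary values are ever taken: one passes to the sphere through Taylor
    polynomials of dilates y |-> phi(r y), with r < 1, whose remainders are controlled on complex
    lines through the origin. This reduces the function theory to one variable, where the maximum
    principle, averaged over roots of unity, supplies Cauchy's estimates in place of contour
    integrals. The second obstacle is that a bound in the L^1 norm has to yield a bounded
    interpolant. Instead of extending the functional and representing it by a bounded function,
    everything stays in L^2: the least-norm point of a convex set does the work of separation, and
    nested convex sets do that of weak compactness. The space M_Q is the right domain because it
    consists of the conjugates of the functions orthogonal to those of H^2 that vanish at the z_i.
    The given interpolant makes N finite. That the data are not all equal serves twice: some w_k is
    nonzero, so N > 0 and the rescaling makes sense, and the case of equality is excluded. *)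

Section complex_norm.
Variable R : rcfType.
Implicit Types x y z : R[i].

Lemma conjE x : x^* = conjc x.
Proof. by []. Qed.

Lemma normc_ge0 x : 0 <= normc x.
Proof. by case: x => a b; exact: sqrtr_ge0. Qed.

Lemma normcX x n : normc (x ^+ n) = normc x ^+ n.
Proof. by elim: n => [|n IH]; rewrite ?expr0 ?normc1// !exprS normcM IH. Qed.

Lemma normc_sum I (r : seq I) (P : pred I) (F : I -> R[i]) :
  normc (\sum_(i <- r | P i) F i) <= \sum_(i <- r | P i) normc (F i).
Proof.
elim/big_ind2 : _ => [|x1 x2 y1 y2 h1 h2|//]; first by rewrite normc0.
exact: le_trans (le_normcD _ _) (lerD h1 h2).
Qed.

Lemma normc_prod I (r : seq I) (P : pred I) (F : I -> R[i]) :
  normc (\prod_(i <- r | P i) F i) = \prod_(i <- r | P i) normc (F i).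
Proof. by apply: (big_morph _ (@normcM R)); rewrite normc1. Qed.

Lemma normcB x y : normc (x - y) <= normc x + normc y.
Proof. by rewrite -(normcN y); exact: le_normcD. Qed.

Lemma normc_distC x y : normc (x - y) = normc (y - x).
Proof. by rewrite -normcN opprB. Qed.

Lemma ler_normcB x y : normc x - normc y <= normc (x - y).
Proof. by rewrite lerBlDr -{1}(subrK y x) le_normcD. Qed.

Lemma normc_conj x : normc x^* = normc x.
Proof. by rewrite conjE; case: x => a b; rewrite /normc /= sqrrN. Qed.

Lemma normc_real (a : R) : normc a%:C = `|a|.
Proof. by rewrite /normc /= expr0n addr0 sqrtr_sqr. Qed.

Lemma sqr_normcE x : normc x ^+ 2 = complex.Re x ^+ 2 + complex.Im x ^+ 2.
Proof. by case: x => a b; rewrite /normc /= sqr_sqrtr// addr_ge0 ?sqr_ge0. Qed.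

Lemma mulr_conj x : x * x^* = (normc x ^+ 2)%:C.
Proof. by rewrite conjE sqr_normcE; case: x => a b; apply/eqP; rewrite eq_complex /=; apply/andP;
  split; apply/eqP; ring. Qed.

Lemma normc_eq0 x : (normc x == 0) = (x == 0).
Proof. by apply/eqP/eqP => [/eq0_normc//|->]; rewrite normc0. Qed.

Lemma normc_gt0 x : (0 < normc x) = (x != 0).
Proof. by rewrite lt_def normc_ge0 normc_eq0 andbT. Qed.

Lemma normr_Re_le x : `|complex.Re x| <= normc x.
Proof.
rewrite -(@ler_pXn2r _ 2) ?nnegrE ?normc_ge0//.
by rewrite sqr_normcE real_normK ?num_real// lerDl sqr_ge0.
Qed.

Lemma normr_Im_le x : `|complex.Im x| <= normc x.
Proof.
rewrite -(@ler_pXn2r _ 2) ?nnegrE ?normc_ge0//.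
by rewrite sqr_normcE real_normK ?num_real// lerDr sqr_ge0.
Qed.

Lemma normc_le_ReIm x : normc x <= `|complex.Re x| + `|complex.Im x|.
Proof.
rewrite -(@ler_pXn2r _ 2) ?nnegrE ?normc_ge0 ?addr_ge0//.
rewrite sqr_normcE sqrrD !real_normK ?num_real//.
by rewrite lerD2r lerDl mulrn_wge0// mulr_ge0.
Qed.

Lemma normc_le0_eq0 x : normc x <= 0 -> x = 0.
Proof. by move=> h; apply/eqP; rewrite -normc_eq0 eq_le h normc_ge0. Qed.

Lemma ReD x y : complex.Re (x + y) = complex.Re x + complex.Re y.
Proof. by case: x y => [a b] [c d]. Qed.

Lemma ImD x y : complex.Im (x + y) = complex.Im x + complex.Im y.
Proof. by case: x y => [a b] [c d]. Qed.

Lemma ReN x : complex.Re (- x) = - complex.Re x.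
Proof. by case: x. Qed.

Lemma ReM x y : complex.Re (x * y) =
  complex.Re x * complex.Re y - complex.Im x * complex.Im y.
Proof. by case: x y => [a b] [c d]. Qed.

Lemma ImM x y : complex.Im (x * y) =
  complex.Re x * complex.Im y + complex.Im x * complex.Re y.
Proof. by case: x y => [a b] [c d]. Qed.

Lemma sqr_normcD x y : normc (x + y) ^+ 2 =
  normc x ^+ 2 + normc y ^+ 2 + 2 * complex.Re (x * y^*).
Proof. by rewrite conjE !sqr_normcE; case: x y => [a b] [c d] /=; ring. Qed.

Lemma conj_real (a : R) : (a%:C)^* = a%:C.
Proof. by rewrite conjE conjc_real. Qed.

Lemma Re_conj x : complex.Re x^* = complex.Re x.
Proof. by rewrite conjE; case: x. Qed.

Lemma Im_conj x : complex.Im x^* = - complex.Im x.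
Proof. by rewrite conjE; case: x. Qed.

End complex_norm.

(* The geometric form of the remainder is preserved by sums, rotations, and
   multiplication or division by the variable, so that no further theory of
   power series is needed. *)
Definition has_pser (R : realType) (g : R[i] -> R[i]) (a : R[i])
    (c : nat -> R[i]) : Prop :=
  exists r K : R, 0 < r /\ forall N u, normc u < r ->
    normc (g (a + u) - \sum_(k < N) c k * u ^+ k) <= K * (normc u / r) ^+ N.

Section one_variable.
Variable R : realType.
Local Notation C := R[i].
Implicit Types (g q : C -> C) (a u : C) (c : nat -> C).

(** A smaller radius enlarges [normc u / r'], so the bound only weakens; this gives two series a
    common radius. *)
Lemma has_pserW g a c r K r' K' : 0 < r -> 0 < r' -> r' <= r -> K <= K' ->
  (forall N u, normc u < r ->
     normc (g (a + u) - \sum_(k < N) c k * u ^+ k) <= K * (normc u / r) ^+ N) ->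
  forall N u, normc u < r' ->
     normc (g (a + u) - \sum_(k < N) c k * u ^+ k) <= K' * (normc u / r') ^+ N.
Proof.
move=> r0 r'0 rr' KK' H N u ur.
have nu := normc_ge0 u.
apply: le_trans (H N u (lt_le_trans ur rr')) _.
(* The bound for N = 0 at u = 0 reads |g a| <= K. *)
have K0 : 0 <= K.
  have := H 0%N 0; rewrite normc0 => /(_ r0).
  by rewrite big_ord0 expr0 mulr1; apply: le_trans; exact: normc_ge0.
apply: ler_pM => //; first by rewrite exprn_ge0// divr_ge0// ltW.
rewrite lerXn2r ?nnegrE ?divr_ge0 ?(ltW r0) ?(ltW r'0)//.
by rewrite ler_wpM2l// lef_pV2 ?posrE.
Qed.

(** [c k * u ^+ k] is the difference of two consecutive remainders; at |u| = r/2 each is at most K,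
    whence the radius r/2 and the constant 2K. *)
Lemma has_pser_coef g a c : has_pser g a c ->
  exists r K : R, [/\ 0 < r, 0 <= K & forall k, normc (c k) <= K * r^-1 ^+ k].
Proof.
move=> [r [K [r0 H]]].
have K0 : 0 <= K.
  have := H 0%N 0; rewrite normc0 => /(_ r0).
  by rewrite big_ord0 expr0 mulr1; apply: le_trans; exact: normc_ge0.
exists (r / 2), (2 * K); split; rewrite ?divr_gt0 ?mulr_ge0// => k.
have ur : normc (r / 2)%:C = r / 2 by rewrite normc_real gtr0_norm ?divr_gt0.
have lr : normc (r / 2)%:C < r by rewrite ur; lra.
have := H k.+1 _ lr; have := H k _ lr.
rewrite big_ord_recr/= ur.
set S := \sum_(i < k) _; set G := g _ => h1 h2.
have e : c k * (r/2)%:C ^+ k = (G - S) - (G - (S + c k * (r/2)%:C ^+ k)) by ring.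
have q : r / 2 / r = 2^-1 by field; rewrite gt_eqF.
have : normc (c k * (r/2)%:C ^+ k) <= 2 * K.
  rewrite e; apply: le_trans (normcB _ _) _.
  apply: le_trans (lerD h1 h2) _; rewrite q.
  have l1 m : (2^-1 : R) ^+ m <= 1 by rewrite exprn_ile1// ?invf_le1 ?ler1n.
  have := ler_wpM2l K0 (l1 k); have := ler_wpM2l K0 (l1 k.+1); lra.
rewrite normcM normcX ur -ler_pdivlMr ?exprn_gt0 ?divr_gt0//.
by rewrite -exprVn.
Qed.

Lemma has_pser0 g a c : has_pser g a c -> g a = c 0%N.
Proof.
move=> [r [K [r0 H]]].
have := H 1%N 0; rewrite normc0 => /(_ r0); rewrite mul0r expr1 mulr0 addr0.
rewrite big_ord_recl big_ord0 /= expr0 mulr1 addr0 => /normc_le0_eq0/eqP.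
by rewrite subr_eq0 => /eqP.
Qed.

Lemma has_pser_cst (k : C) a : has_pser (fun=> k) a (fun j => if j == 0%N then k else 0).
Proof.
exists 1, (normc k); split=> // -[|N] u u1.
  by rewrite big_ord0 subr0 expr0 mulr1.
rewrite big_ord_recl/= expr0 mulr1 big1 ?addr0 ?subrr ?normc0; last first.
  by move=> i _; rewrite mul0r.
by rewrite mulr_ge0 ?normc_ge0// exprn_ge0// divr1 normc_ge0.
Qed.

Lemma has_pserD g1 g2 a c1 c2 : has_pser g1 a c1 -> has_pser g2 a c2 ->
  has_pser (fun x => g1 x + g2 x) a (fun j => c1 j + c2 j).
Proof.
move=> [r1 [K1 [r10 H1]]] [r2 [K2 [r20 H2]]].
set r := Num.min r1 r2.
have r0 : 0 < r by rewrite lt_min r10.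
have m1 : r <= r1 by rewrite ge_min lexx.
have m2 : r <= r2 by rewrite ge_min lexx orbT.
exists r, (K1 + K2); split=> // N u ur.
have h1 := @has_pserW _ _ _ _ _ _ _ r10 r0 m1 (lexx _) H1 N u ur.
have h2 := @has_pserW _ _ _ _ _ _ _ r20 r0 m2 (lexx _) H2 N u ur.
under eq_bigr do rewrite mulrDl.
rewrite big_split/= mulrDl.
apply: le_trans _ (lerD h1 h2).
rewrite (_ : _ - _ = (g1 (a + u) - \sum_(k < N) c1 k * u ^+ k) +
   (g2 (a + u) - \sum_(k < N) c2 k * u ^+ k)); last by ring.
exact: le_normcD.
Qed.

Lemma has_pserZ g a c (k : C) : has_pser g a c ->
  has_pser (fun x => k * g x) a (fun j => k * c j).
Proof.
move=> [r [K [r0 H]]]; exists r, (normc k * K); split=> // N u ur.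
under eq_bigr do rewrite -mulrA.
by rewrite -mulr_sumr -mulrBr normcM -mulrA ler_wpM2l ?normc_ge0 ?H.
Qed.

Lemma has_pser_rot g a c (w : C) : normc w = 1 -> has_pser g (w * a) c ->
  has_pser (fun x => g (w * x)) a (fun j => c j * w ^+ j).
Proof.
move=> w1 [r [K [r0 H]]]; exists r, K; split=> // N u ur.
have nu : normc (w * u) = normc u by rewrite normcM w1 mul1r.
have := H N (w * u); rewrite nu -mulrDr => /(_ ur).
by under eq_bigr do rewrite exprMn mulrA.
Qed.

Lemma has_pser_mulX g a c : has_pser g a c ->
  has_pser (fun x => x * g x) a
   (fun j => a * c j + (if j is j'.+1 then c j' else 0)).
Proof.
move=> hg; have [r1 [K1 [r10 K10 Hc]]] := has_pser_coef hg.
case: hg => [r2 [K2 [r20 H]]].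
set r := Num.min r1 r2.
have r0 : 0 < r by rewrite lt_min r10.
have m1 : r <= r1 by rewrite ge_min lexx.
have m2 : r <= r2 by rewrite ge_min lexx orbT.
have K20 : 0 <= K2.
  have := H 0%N 0; rewrite normc0 => /(_ r20).
  by rewrite big_ord0 expr0 mulr1; apply: le_trans; exact: normc_ge0.
exists r, ((normc a + r) * K2 + r * K1); split=> // N u ur.
(* The partial sum times a + u has one monomial of degree N too many; the coefficient bound puts it
   in the remainder. *)
have e : \sum_(k < N) (a * c k + (if k : nat is j'.+1 then c j' else 0)) * u ^+ k
  = (a + u) * (\sum_(k < N) c k * u ^+ k) -
    (if N is N'.+1 then c N' * u ^+ N else 0).
  elim: N => [|N IH]; first by rewrite !big_ord0 mulr0 subr0.
  rewrite !big_ord_recr/= IH; case: N {IH} => [|N]; first by rewrite !big_ord0 /= !expr0 !expr1;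
    ring.
  rewrite /= [u ^+ N.+2]exprS; ring.
rewrite e opprB addrCA -mulrBr addrC.
apply: le_trans (le_normcD _ _) _.
have nu0 := normc_ge0 u.
have q0 : 0 <= (normc u / r) ^+ N by rewrite exprn_ge0// divr_ge0 ?normc_ge0// ltW.
rewrite [X in _ <= X]mulrDl; apply: lerD.
  rewrite normcM -mulrA; apply: ler_pM; rewrite ?normc_ge0//.
    by apply: le_trans (le_normcD _ _) _; rewrite lerD2l ltW.
  exact: (has_pserW r20 r0 m2 (lexx K2) H).
case: N {e} q0 => [|N] q0.
  by rewrite normc0 mulr_ge0// mulr_ge0// ltW.
rewrite normcM normcX.
rewrite (_ : r * K1 * _ = K1 * r^-1 ^+ N * normc u ^+ N.+1); last first.
  rewrite expr_div_n exprVn (exprS r); field.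
  by rewrite expf_neq0 gt_eqF.
rewrite ler_wpM2r ?exprn_ge0//.
apply: le_trans (Hc N) _; rewrite ler_wpM2l// lerXn2r ?nnegrE ?invr_ge0 ?(ltW r0) ?(ltW r10)//.
by rewrite lef_pV2 ?posrE.
Qed.

End one_variable.

(** * Maximum principle and Cauchy estimates *)

Section max_modulus.
Variable R : realType.
Local Notation C := R[i].
Implicit Types (g q : C -> C) (a u : C) (c : nat -> C).

(** Stated on pairs of reals, whose closed boxes are compact, so that the extreme value theorem
    applies to |g|. *)
Lemma normc_lipschitz_continuous g (p : R * R) (K d : R) : 0 < d ->
  (forall u, normc u < d -> normc (g (mkC p + u) - g (mkC p)) <= K * normc u) ->
  {for p, continuous (fun p' : R * R => normc (g (mkC p')))}.
Proof.
move=> d0 H; apply/cvgrPdist_lt => e e0.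
have K1 : 0 < `|K| + 1 by rewrite ltr_wpDl.
(* Each coordinate is within eta and [normc] is at most the sum of the two, hence the half. *)
pose eta := Num.min d (e / (`|K| + 1)) / 2.
have eta0 : 0 < eta by rewrite divr_gt0// lt_min d0 divr_gt0.
near=> p'.
have pp' : `|p - p'| < eta by near: p'; exact: (@cvgr_dist_lt _ _ _ _ _ id p).
pose u := mkC p' - mkC p : C.
have up : mkC p' = mkC p + u by rewrite /u addrC subrK.
have nu : normc u < Num.min d (e / (`|K| + 1)).
  apply: le_lt_trans (normc_le_ReIm _) _.
  have -> : Num.min d (e / (`|K| + 1)) = eta + eta by rewrite /eta; field.
  have pE : `|p - p'| = Num.max `|p.1 - p'.1| `|p.2 - p'.2| by [].
  rewrite pE gt_max in pp'; case/andP: pp' => p1 p2.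
  by rewrite /u /=; apply: ltrD; rewrite distrC.
move: nu; rewrite lt_min => /andP[nud nue].
have := H u nud; rewrite -up => h.
rewrite ltr_norml.
have l1 := ler_normcB (g (mkC p)) (g (mkC p')).
have l2 := ler_normcB (g (mkC p')) (g (mkC p)).
have l3 : normc (g (mkC p') - g (mkC p)) < e.
  apply: le_lt_trans h _.
  apply: (@le_lt_trans _ _ ((`|K| + 1) * normc u)).
    rewrite ler_wpM2r ?normc_ge0//; apply: le_trans (ler_norm K) _.
    by rewrite lerDl.
  by rewrite mulrC -ltr_pdivlMr.
rewrite normc_distC in l1; lra.
Unshelve. all: by end_near.
Qed.

Lemma has_pser_lipschitz g a c : has_pser g a c ->
  exists K d : R, 0 < d /\
    forall u, normc u < d -> normc (g (a + u) - g a) <= K * normc u.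
Proof.
move=> h; have g0 := has_pser0 h; case: h => r [K [r0 H]].
exists (K / r), r; split=> // u ur.
have := H 1%N u ur.
rewrite big_ord_recl big_ord0 /= expr0 mulr1 addr0 -g0 expr1 => h.
by apply: le_trans h _; rewrite mulrA mulrAC.
Qed.

Lemma closed_disc_compact (s : R) :
  compact [set p : R * R | normc (mkC p) <= s].
Proof.
have cn : continuous (fun p : R * R => normc (mkC p)).
  move=> p; apply: (@normc_lipschitz_continuous id p 1 1) => // u _.
  by rewrite mul1r addrAC subrr add0r.
apply: (@subclosed_compact _ _ (`[- s, s] `*` `[- s, s])).
- rewrite (_ : [set _ | _] = (fun p : R * R => normc (mkC p)) @^-1` [set x | x <= s])//.
  by apply: preimage_closed => [x _|]; [exact: cn|exact: closed_le].
- by apply: compact_setX; exact: segment_compact.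
- move=> [x y] /= h; split; rewrite /= in_itv/= -ler_norml.
    exact: le_trans (normr_Re_le (x +i* y)) h.
  exact: le_trans (normr_Im_le (x +i* y)) h.
Qed.

(** Adding e |x|^2 makes |g|^2 strictly subharmonic, which rules out an interior maximum; on the
    circle, a small e keeps the sum below its value at a0. *)
Lemma max_modulus g (s B : R) : 0 < s -> 0 <= B ->
  (forall a, normc a <= s -> exists c, has_pser g a c) ->
  (forall a, normc a = s -> normc (g a) <= B) ->
  forall a, normc a <= s -> normc (g a) <= B.
Proof.
move=> s0 B0 hg hB a0 a0s; rewrite leNgt; apply/negP => Ba.
(* e s^2 is half of |g a0|^2 - B^2, so on the circle the perturbed function stays below |g a0|^2. *)
pose e := (normc (g a0) ^+ 2 - B ^+ 2) / (2 * s ^+ 2).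
have s20 : 0 < s ^+ 2 by rewrite exprn_gt0.
have dB : 0 < normc (g a0) ^+ 2 - B ^+ 2 by rewrite subr_gt0 ltrXn2r// ?nnegrE ?normc_ge0.
have e0 : 0 < e by rewrite divr_gt0// mulr_gt0.
pose F (p : R * R) := normc (g (mkC p)) ^+ 2 + e * normc (mkC p) ^+ 2.
pose A := [set p : R * R | normc (mkC p) <= s].
have [||pm] := @compact_EVT_max _ _ F A _ (@closed_disc_compact s).
- by exists (ReIm a0); rewrite /A /=; case: (a0) a0s.
- apply: continuous_in_subspaceT => p; rewrite inE => /hg[c /has_pser_lipschitz[K [d [d0 H]]]].
  have c1 : {for p, continuous (fun p : R * R => normc (g (mkC p)))}.
    exact: normc_lipschitz_continuous d0 H.
  have c2 : {for p, continuous (fun p : R * R => normc (mkC p))}.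
    apply: (@normc_lipschitz_continuous id p 1 1) => // u _.
    by rewrite mul1r addrAC subrr add0r.
  apply: (@continuousD _ _ _ (fun p => normc (g (mkC p)) ^+ 2) (fun p => e * normc (mkC p) ^+ 2)).
    by rewrite /continuous_at; apply: cvgM; exact: c1.
  by apply: cvgM; [exact: cvg_cst|apply: cvgM; exact: c2].
rewrite inE => Apm Fpm.
pose am : C := mkC pm.
have FE (x : C) : normc x <= s ->
    normc (g x) ^+ 2 + e * normc x ^+ 2 <= normc (g am) ^+ 2 + e * normc am ^+ 2.
  move=> xs; have := Fpm (ReIm x); rewrite /F /=.
  have -> : mkC (ReIm x) = x by case: (x).
  by apply; rewrite inE /A /=; case: (x) xs.
have ams : normc am < s.
  rewrite lt_neqAle Apm andbT; apply/negP => /eqP ams.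
  have := FE _ a0s; rewrite leNgt => /negP; apply.
  have : normc (g am) ^+ 2 <= B ^+ 2.
    by rewrite lerXn2r ?nnegrE ?normc_ge0 ?hB.
  rewrite ams => h.
  have e2 : e * s ^+ 2 = (normc (g a0) ^+ 2 - B ^+ 2) / 2.
    by rewrite /e; field; rewrite gt_eqF.
  rewrite e2.
  have : 0 <= e * normc a0 ^+ 2 by rewrite mulr_ge0 ?(ltW e0)// exprn_ge0// normc_ge0.
  lra.
have [c [r [K [r0 H]]]] := hg am (ltW ams).
have K0 : 0 <= K.
  have := H 0%N 0; rewrite normc0 => /(_ r0).
  by rewrite big_ord0 expr0 mulr1; apply: le_trans; exact: normc_ge0.
have ga : g am = c 0%N by apply: has_pser0; exists r, K.
(* [D * t ^+ 3] dominates the cross term 2 Re (c0 conj E), where E is the third-order remainder at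
   distance t. *)
set D := 2 * (normc (c 0%N) * (K * r^-1 ^+ 3)).
have D0 : 0 <= D.
  by rewrite mulr_ge0// mulr_ge0 ?normc_ge0// mulr_ge0// exprn_ge0// invr_ge0 ltW.
(* Averaging |g|^2 + e |.|^2 over the four points am + i^j t beats its value
   at am, by e t^2 against an error O(t^3). *)
pose t := Num.min (Num.min (r / 2) (s - normc am)) (e / (D + 1)).
have D1 : 0 < D + 1 by rewrite ltr_wpDl.
have t0 : 0 < t by rewrite !lt_min divr_gt0// subr_gt0 ams divr_gt0.
have tr : t < r by rewrite /t !gt_min (_ : r / 2 < r)//; lra.
have ts : t <= s - normc am by rewrite /t !ge_min lexx orbT.
have te : D * t < e.
  apply: (@lt_le_trans _ _ ((D + 1) * t)); first by rewrite ltr_pM2r// ltrDl.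
  by rewrite mulrC -ler_pdivlMr// /t ge_min lexx orbT.
have key (w : C) : normc w = 1 ->
    normc (c 0%N) ^+ 2 + 2 * complex.Re (c 0%N * (c 1%N * (t%:C * w) + c 2%N * (t%:C * w) ^+ 2)^*)
     - D * t ^+ 3 + e * normc (am + t%:C * w) ^+ 2
     <= normc (c 0%N) ^+ 2 + e * normc am ^+ 2.
  move=> w1.
  have nu : normc (t%:C * w) = t by rewrite normcM w1 mulr1 normc_real gtr0_norm.
  have := H 3%N (t%:C * w); rewrite nu => /(_ tr).
  rewrite !big_ord_recl big_ord0 /= expr0 mulr1 addr0 expr1.
  set G := g _; set S := c 1%N * _ + _ => hE.
  have hs : normc (am + t%:C * w) <= s.
    by apply: le_trans (le_normcD _ _) _; rewrite nu; lra.
  have := FE _ hs; rewrite ga -/G; apply: le_trans.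
  rewrite lerD2r.
  have GE : G = c 0%N + (S + (G - (c 0%N + S))) by ring.
  move: hE GE; set E := G - _ => hE ->.
  rewrite [in X in _ <= X]sqr_normcD [(S + E)^*]rmorphD mulrDr ReD.
  have : - (normc (c 0%N) * (K * r^-1 ^+ 3) * t ^+ 3) <= complex.Re (c 0%N * E^*).
    rewrite lerNl; apply: le_trans (ler_norm _) _; rewrite normrN.
    apply: le_trans (normr_Re_le _) _; rewrite normcM normc_conj -mulrA.
    rewrite ler_wpM2l ?normc_ge0//; apply: le_trans hE _.
    by rewrite expr_div_n exprVn [_ ^+ 3 / _]mulrC mulrA.
  have := exprn_ge0 2 (normc_ge0 (S + E)).
  rewrite /D; lra.
(* Over the directions 1, -1, i, -i both w and w^2 sum to zero, so the linear and quadratic terms of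
   g drop out of the sum of the four inequalities. *)
have := key 1; have := key (-1); have := key (0 +i* 1); have := key (- (0 +i* 1)).
have ni : normc (0 +i* 1 : C) = 1 by rewrite /normc /= expr0n/= add0r expr1n sqrtr1.
rewrite !normcN normc1 ni => /(_ erefl) k1 /(_ erefl) k2 /(_ erefl) k3 /(_ erefl) k4.
have : 0 < e * t ^+ 2 - D * t ^+ 3.
  rewrite (_ : _ - _ = t ^+ 2 * (e - D * t)); last by ring.
  by rewrite mulr_gt0 ?exprn_gt0// subr_gt0.
move: k1 k2 k3 k4; rewrite !sqr_normcE.
rewrite !conjE.
move: (am) (c 0%N) (c 1%N) (c 2%N) => [x y] [c00 c01] [c10 c11] [c20 c21].
rewrite /= !expr2 /=; lra.
Qed.

End max_modulus.

(** ['X^n - 1] splits into distinct linear factors, and n distinct n-th roots of unity in a field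
    include a primitive one. *)
Lemma prim_root_exists (R : rcfType) n : (0 < n)%N ->
  exists z : R[i], n.-primitive_root z.
Proof.
pose p : {poly R[i]} := 'X^n - 1; have [r Dp] := closed_field_poly_normal p.
move=> n_gt0; rewrite (monicP _) ?monicXnsubC // scale1r in Dp.
have rn1 : all n.-unity_root r by apply/allP => z; rewrite -root_prod_XsubC -Dp.
have sz_r : (n < (size r).+1)%N.
  by rewrite -(size_prod_XsubC r id) -Dp size_XnsubC.
have [|z] := hasP (cyclic.has_prim_root n_gt0 rn1 _ sz_r); last by exists z.
by rewrite -separable.separable_prod_XsubC -Dp cyclotomic.separable_Xn_sub_1 // pnatr_eq0 -lt0n.
Qed.

Lemma prim_root_normc (R : rcfType) n (z : R[i]) :
  n.-primitive_root z -> normc z = 1.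
Proof.
move=> pz; have n0 := prim_order_gt0 pz.
apply/eqP; rewrite -(@pexpr_eq1 _ _ n) ?normc_ge0// -normcX.
by rewrite (prim_expr_order pz) normc1.
Qed.

(** Orthogonality of characters: for i != k this is a geometric sum whose ratio z^(i-k) is a
    nontrivial n-th root of unity. *)
Lemma sum_prim_root (R : rcfType) n (z : R[i]) (i k : 'I_n) :
  n.-primitive_root z ->
  \sum_(j < n) (z ^+ k)^-1 ^+ j * z ^+ i ^+ j = (n * (i == k))%:R.
Proof.
move=> pz; have z0 : z != 0 by rewrite -normc_gt0 (prim_root_normc pz).
have [->|ik] := eqVneq i k.
  rewrite muln1 (eq_bigr (fun=> 1)) ?sumr_const ?card_ord// => j _.
  by rewrite -exprMn mulVf ?expf_neq0// expr1n.
rewrite muln0; pose x := z ^+ i / z ^+ k.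
rewrite (eq_bigr (fun j : 'I_n => x ^+ j)); last by move=> j _; rewrite -exprMn mulrC.
have x1 : x - 1 != 0.
  rewrite subr_eq0; apply: contra ik => /eqP xe.
  have : z ^+ i == z ^+ k by rewrite -[z ^+ k]mul1r -xe divfK ?expf_neq0.
  by rewrite (eq_prim_root_expr pz) !modn_small.
apply: (mulfI x1); rewrite -subrX1 mulr0 /x expr_div_n -!exprM.
by rewrite ![(_ * n)%N]mulnC !exprM (prim_expr_order pz) !expr1n divr1 subrr.
Qed.

(* Bernoulli's inequality lets s tend to 1. *)
Lemma le_of_expr_le (R : realFieldType) (A M s0 : R) k : s0 < 1 -> 0 <= A ->
  (forall s, 0 < s -> s0 <= s -> s < 1 -> A * s ^+ k <= M) -> A <= M.
Proof.
move=> s01 A0 H; rewrite leNgt; apply/negP => MA.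
have bern (d : R) : 0 <= d <= 1 -> 1 - k%:R * d <= (1 - d) ^+ k.
  move=> /andP[d0 d1]; elim: k {H} => [|k IH]; first by rewrite expr0 mul0r subr0.
  rewrite exprS; apply: le_trans (ler_wpM2l _ IH); last by lra.
  have : 0 <= k%:R * d ^+ 2 by rewrite mulr_ge0// sqr_ge0.
  by rewrite -natr1 expr2; lra.
have M0 : 0 <= M.
  have m0 : 0 <= Num.max s0 0 by rewrite le_max lexx orbT.
  have m1 : s0 <= Num.max s0 0 by rewrite le_max lexx.
  have m2 : Num.max s0 0 < 1 by rewrite gt_max s01 ltr01.
  apply: le_trans (H ((Num.max s0 0 + 1) / 2) _ _ _); try lra.
  by rewrite mulr_ge0// exprn_ge0//; lra.
have A1 : 0 < A by exact: le_lt_trans MA.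
(* Small enough that A (1 - k d) still exceeds M, while 1 - d remains in the range of s allowed by
   the hypothesis. *)
pose d := Num.min (Num.min 2^-1 (1 - s0)) ((A - M) / (2 * A * (k%:R + 1))).
have dd : 0 < (A - M) / (2 * A * (k%:R + 1)).
  by rewrite divr_gt0 ?subr_gt0// !mulr_gt0// ltr_wpDl.
have d0 : 0 < d by rewrite !lt_min subr_gt0 s01 invr_gt0 ltr0n dd.
have d12 : d <= 2^-1 by rewrite !ge_min lexx.
have ds : d <= 1 - s0 by rewrite !ge_min lexx orbT.
have dM : d <= (A - M) / (2 * A * (k%:R + 1)) by rewrite !ge_min lexx orbT.
have h1 : 0 < 1 - d by lra.
have h2 : s0 <= 1 - d by lra.
have h3 : 1 - d < 1 by lra.
have := H _ h1 h2 h3; rewrite leNgt => /negP; apply.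
have b : 1 - k%:R * d <= (1 - d) ^+ k by apply: bern; rewrite ltW//=; lra.
apply: (lt_le_trans _ (ler_wpM2l A0 b)).
move: dM; rewrite ler_pdivlMr ?mulr_gt0// ?ltr_wpDl// => dM.
have k0 : 0 <= k%:R :> R by [].
have : 0 <= k%:R * d by rewrite mulr_ge0// ltW.
have : 0 < A * d by rewrite mulr_gt0.
nra.
Qed.

Section disc.
Variable R : realType.
Local Notation C := R[i].
Implicit Types (g q : C -> C) (a u : C) (c : nat -> C).

Definition hol_disc g := forall a, normc a < 1 -> exists c, has_pser g a c.

(** The coefficients of q solve a d_j + d_(j-1) = c_j. Taking r <= |a|/2 makes the geometric bound
    on them inductive and keeps |a + u| >= |a|/2 when the remainder is divided. *)
Lemma has_pser_divX g q a c : a != 0 -> (forall x, x * q x = g x) ->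
  has_pser g a c -> exists d, has_pser q a d.
Proof.
move=> a0 gq hg; have [r1 [K1 [r10 K10 Hc]]] := has_pser_coef hg.
case: hg => [r2 [K2 [r20 H]]].
have na : 0 < normc a by rewrite normc_gt0.
set r := Num.min (Num.min r1 r2) (normc a / 2).
have r0 : 0 < r by rewrite !lt_min r10 r20 divr_gt0.
have m1 : r <= r1 by rewrite !ge_min lexx.
have m2 : r <= r2 by rewrite !ge_min lexx orbT.
have m3 : r <= normc a / 2 by rewrite !ge_min lexx orbT.
have K20 : 0 <= K2.
  have := H 0%N 0; rewrite normc0 => /(_ r20).
  by rewrite big_ord0 expr0 mulr1; apply: le_trans; exact: normc_ge0.
pose d := fix d j := if j is j'.+1 then (c j - d j') / a else c 0%N / a.
(* Fixed point of the induction: K1 + D r <= K1 + D |a| / 2 = D |a|. *)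
pose D := 2 * K1 / normc a.
have D0 : 0 <= D by rewrite divr_ge0 ?mulr_ge0// ltW.
have cb k : normc (c k) <= K1 * r^-1 ^+ k.
  apply: le_trans (Hc k) _; rewrite ler_wpM2l// lerXn2r ?nnegrE ?invr_ge0 ?(ltW r0) ?(ltW r10)//.
  by rewrite lef_pV2 ?posrE.
have db k : normc (d k) <= D * r^-1 ^+ k.
  elim: k => [|k IH] /=; rewrite normcM normcV ler_pdivrMr//.
    apply: le_trans (cb 0%N) _; rewrite !expr0 !mulr1 /D divfK ?gt_eqF//; lra.
  apply: le_trans (normcB _ _) _; apply: le_trans (lerD (cb k.+1) IH) _.
  have -> : D * r^-1 ^+ k = D * r * r^-1 ^+ k.+1.
    by rewrite exprS; field; rewrite gt_eqF.
  rewrite -mulrDl [leRHS]mulrAC ler_wpM2r ?exprn_ge0 ?invr_ge0 ?(ltW r0)//.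
  have e : D * normc a = 2 * K1 by rewrite /D divfK ?gt_eqF.
  have := ler_wpM2l D0 m3; nra.
exists d, r, ((K2 + r * D) / (normc a / 2)); split=> // N u ur.
have au : normc a / 2 <= normc (a + u).
  have := ler_normcB a (- u); rewrite opprK normcN; lra.
rewrite mulrAC ler_pdivlMr ?divr_gt0//.
apply: (le_trans (ler_wpM2l (normc_ge0 _) au)).
rewrite mulrC -normcM mulrBr gq.
have e : (a + u) * (\sum_(k < N) d k * u ^+ k) = \sum_(k < N) c k * u ^+ k +
    (if N is N'.+1 then d N' * u ^+ N else 0).
  elim: N => [|N IH]; first by rewrite !big_ord0 mulr0 addr0.
  rewrite !big_ord_recr/= mulrDr IH; case: N {IH} => [|N] /=.
    by rewrite !big_ord0 expr0 expr1; field.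
  by rewrite [u ^+ N.+2]exprS; field.
rewrite e opprD addrA; apply: le_trans (normcB _ _) _.
have nu0 := normc_ge0 u.
rewrite [X in _ <= X]mulrDl; apply: lerD.
  exact: (has_pserW r20 r0 m2 (lexx K2) H).
case: N {e} => [|N]; first by rewrite normc0 expr0 mulr1 mulr_ge0// ltW.
rewrite normcM normcX.
rewrite (_ : r * D * _ = D * r^-1 ^+ N * normc u ^+ N.+1); last first.
  rewrite expr_div_n exprVn (exprS r); field.
  by rewrite expf_neq0 gt_eqF.
by rewrite ler_wpM2r ?exprn_ge0.
Qed.

Lemma hol_disc_div g c : hol_disc g -> has_pser g 0 c ->
  exists q, [/\ hol_disc q, has_pser q 0 (fun j => c j.+1) &
    forall x, g x = c 0%N + x * q x].
Proof.
(* The value at 0 removes the singularity of the difference quotient. *)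
move=> hg hc; pose q x := if x == 0 then c 1%N else (g x - c 0%N) / x.
have gE x : x * q x = g x - c 0%N.
  rewrite /q; case: eqVneq => [->|x0]; last by rewrite mulrC divfK.
  by rewrite mul0r (has_pser0 hc) subrr.
have hq0 : has_pser q 0 (fun j => c j.+1).
  case: hc => r [K [r0 H]].
  have K0 : 0 <= K.
    have := H 0%N 0; rewrite normc0 => /(_ r0).
    by rewrite big_ord0 expr0 mulr1; apply: le_trans; exact: normc_ge0.
  have Kr : 0 <= K / r by rewrite divr_ge0// ltW.
  (* K / r covers u != 0; the other summand serves u = 0 with N = 0, where the remainder is c 1. *)
  exists r, (K / r + normc (c 1%N)); split=> // N u ur; rewrite add0r.
  have pw : 0 <= (normc u / r) ^+ N by rewrite exprn_ge0// divr_ge0 ?normc_ge0// ltW.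
  rewrite /q; case: eqVneq => [u0|u0].
    case: N pw => [|N] pw.
      by rewrite big_ord0 subr0 expr0 mulr1 lerDr.
    rewrite big_ord_recl u0 expr0 mulr1 big1 ?addr0 ?subrr ?normc0.
      by rewrite mul0r expr0n mulr0.
    by move=> i _; rewrite lift0 expr0n/= mulr0.
  have nu : 0 < normc u by rewrite normc_gt0.
  rewrite [leRHS]mulrDl ler_wpDr ?mulr_ge0 ?normc_ge0//.
  have := H N.+1 u ur; rewrite add0r big_ord_recl expr0 mulr1 opprD addrA.
  rewrite (eq_bigr (fun i : 'I_N => u * (c i.+1 * u ^+ i))); last first.
    by move=> i _; rewrite /= /bump/= add1n exprS mulrCA.
  rewrite -mulr_sumr; set S := \sum_(i < N) _.
  have -> : g u - c 0%N - u * S = u * ((g u - c 0%N) / u - S) by field.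
  rewrite normcM mulrC -ler_pdivlMr// => /le_trans; apply.
  by rewrite exprS le_eqVlt; apply/orP; left; apply/eqP; field; rewrite !gt_eqF.
exists q; split=> // [a a1|x]; last by rewrite gE addrC subrK.
have [->|a0] := eqVneq a 0; first by eexists; exact: hq0.
have [ca hca] := hg a a1.
apply: (has_pser_divX a0 gE (c := fun j => ca j + (if j == 0%N then - c 0%N else 0))).
exact: has_pserD hca (has_pser_cst _ _).
Qed.

Lemma hol_disc_divn g c N : hol_disc g -> has_pser g 0 c ->
  exists q, [/\ hol_disc q, has_pser q 0 (fun j => c (N + j)%N) &
    forall x, g x = \sum_(k < N) c k * x ^+ k + x ^+ N * q x].
Proof.
move=> hg hc; elim: N => [|N [q [hq hq0 gq]]].
  by exists g; split=> // x; rewrite big_ord0 add0r expr0 mul1r.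
have [q' [hq' hq'0 qq']] := hol_disc_div hq hq0.
exists q'; split=> // [|x].
  by under [X in has_pser _ _ X]funext do rewrite addSnnS.
rewrite gq qq' big_ord_recr/= addn0 exprS; ring.
Qed.

Lemma hol_discD g1 g2 : hol_disc g1 -> hol_disc g2 -> hol_disc (fun x => g1 x + g2 x).
Proof.
move=> h1 h2 a a1; have [c1 hc1] := h1 a a1; have [c2 hc2] := h2 a a1.
by eexists; exact: has_pserD hc1 hc2.
Qed.

Lemma hol_discZ g (k : C) : hol_disc g -> hol_disc (fun x => k * g x).
Proof. by move=> h a a1; have [c hc] := h a a1; eexists; exact: has_pserZ hc. Qed.

Lemma hol_disc_cst (k : C) : hol_disc (fun=> k).
Proof. by move=> a _; eexists; exact: has_pser_cst. Qed.

Lemma hol_disc_sum n (F : 'I_n -> C -> C) : (forall i, hol_disc (F i)) ->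
  hol_disc (fun x => \sum_(i < n) F i x).
Proof.
elim: n F => [|n IH] F hF.
  by under [X in hol_disc X]funext do rewrite big_ord0; exact: hol_disc_cst.
under [X in hol_disc X]funext do rewrite big_ord_recr/=.
by apply: hol_discD => //; apply: IH => i; exact: hF.
Qed.

Lemma hol_disc_max g (s B : R) : 0 < s < 1 -> 0 <= B -> hol_disc g ->
  (forall a, normc a = s -> normc (g a) <= B) ->
  forall a, normc a <= s -> normc (g a) <= B.
Proof.
move=> /andP[s0 s1] B0 hg; apply: max_modulus => // a a1.
by apply: hg; exact: le_lt_trans s1.
Qed.

(* Averaging g over the rotations by N-th roots of unity isolates the
   coefficients of index k modulo N; the maximum principle is then applied to
   the average divided by x ^+ k. *)
Lemma cauchy_estimate g c (M : R) : hol_disc g -> has_pser g 0 c ->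
  (forall a, normc a < 1 -> normc (g a) <= M) -> forall k, normc (c k) <= M.
Proof.
move=> hg hc gM k.
have M0 : 0 <= M by apply: le_trans (gM 0 _); rewrite ?normc_ge0// normc0.
have [w pw] := prim_root_exists R (ltn0Sn k).
have w1 := prim_root_normc pw.
have [q [hq _ gq]] := hol_disc_divn k.+1 hg hc.
(* Among the exponents below N only k survives the weights [zk ^+ j]; since (w^j)^N = 1, the tail
   x^N q sums to x^N Q = x^k (x Q). *)
pose N := k.+1; pose zk := (w ^+ k)^-1.
pose Q x := \sum_(j < N) zk ^+ j * q (w ^+ j * x).
have hQ : hol_disc Q.
  apply: hol_disc_sum => j; apply: hol_discZ => a a1.
  have wj : normc (w ^+ j) = 1 by rewrite normcX w1 expr1n.
  have [d hd] := hq (w ^+ j * a) ltac:(by rewrite normcM wj mul1r).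
  by eexists; exact: has_pser_rot hd.
pose H x := N%:R * c k + x * Q x.
have hH : hol_disc H.
  apply: hol_discD; first exact: hol_disc_cst.
  by move=> a a1; have [d hd] := hQ a a1; eexists; exact: has_pser_mulX hd.
have GE x : \sum_(j < N) zk ^+ j * g (w ^+ j * x) = x ^+ k * H x.
  under eq_bigr do rewrite gq mulrDr.
  rewrite big_split/=.
  have -> : \sum_(j < N) zk ^+ j * (\sum_(i < k.+1) c i * (w ^+ j * x) ^+ i) =
      N%:R * c k * x ^+ k.
    under eq_bigr do rewrite mulr_sumr.
    rewrite exchange_big/= (bigD1 (ord_max : 'I_N))//= [X in _ + X]big1 ?addr0.
      under eq_bigr => j _ do rewrite exprMn exprAC mulrCA.
      rewrite (eq_bigr (fun j : 'I_N => (zk ^+ j * w ^+ k ^+ j) * (c k * x ^+ k))); last first.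
        by move=> j _; ring.
      by rewrite -mulr_suml (sum_prim_root ord_max ord_max pw) eqxx muln1 mulrA.
    move=> i ik.
    rewrite (eq_bigr (fun j : 'I_N => (zk ^+ j * w ^+ i ^+ j) * (c i * x ^+ i))); last first.
      by move=> j _; rewrite exprMn -!exprM [(j * i)%N]mulnC; ring.
    by rewrite -mulr_suml (sum_prim_root i ord_max pw) (negbTE ik) muln0 mul0r.
  rewrite /H /Q mulrDr mulrA -exprSr mulr_sumr; congr (_ + _); first by ring.
  apply: eq_bigr => j _; rewrite exprMn -exprM mulnC exprM (prim_expr_order pw).
  by rewrite expr1n mul1r mulrCA.
have N0 : 0 < N%:R :> R by rewrite ltr0n.
apply: (@le_of_expr_le _ _ _ 0 k) => //; first exact: normc_ge0.
move=> s s0 _ s1.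
have sk : 0 < s ^+ k by rewrite exprn_gt0.
rewrite -ler_pdivlMr// -(ler_pM2l N0).
have -> : N%:R * normc (c k) = normc (H 0).
  by rewrite /H mul0r addr0 normcM -[N%:R as X in normc X](rmorph_nat (real_complex R))
    normc_real normr_nat.
apply: (@hol_disc_max H s); rewrite ?s0 ?s1 ?normc0 ?(ltW s0)//.
  by rewrite mulr_ge0 ?(ltW N0)// divr_ge0// ltW.
move=> a sa; rewrite mulrA ler_pdivlMr//.
rewrite -sa -normcX mulrC -normcM -GE.
apply: le_trans (normc_sum _ _ _) _.
apply: (@le_trans _ _ (\sum_(j < N) M)); last by rewrite sumr_const card_ord mulr_natl.
apply: ler_sum => j _.
rewrite normcM !normcX /zk normcV normcX w1 expr1n invr1 expr1n mul1r.
by apply: gM; rewrite normcM normcX w1 expr1n mul1r sa.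
Qed.

(** Cauchy's estimate bounds g minus its N Taylor terms by (N + 1) M on the disc. Dividing by x^N
    and applying the maximum principle on circles of radius s, with s tending to 1, transfers the
    bound to x. *)
Lemma taylor_remainder g c (M : R) : hol_disc g -> has_pser g 0 c ->
  (forall a, normc a < 1 -> normc (g a) <= M) -> forall N x, normc x < 1 ->
  normc (g x - \sum_(k < N) c k * x ^+ k) <= N.+1%:R * M * normc x ^+ N.
Proof.
move=> hg hc gM N x x1.
have cM := cauchy_estimate hg hc gM.
have M0 : 0 <= M by apply: le_trans (gM 0 _); rewrite ?normc_ge0// normc0.
have [q [hq _ gq]] := hol_disc_divn N hg hc.
rewrite gq addrAC subrr add0r normcM normcX mulrC.
rewrite ler_wpM2r ?exprn_ge0 ?normc_ge0//.
apply: (@le_of_expr_le _ _ _ (normc x) N) => //; first exact: normc_ge0.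
move=> s s0 xs s1.
have sN : 0 < s ^+ N by rewrite exprn_gt0.
rewrite -ler_pdivlMr//.
apply: (@hol_disc_max q s); rewrite ?s0 ?s1//.
  by rewrite divr_ge0 ?mulr_ge0// ltW.
move=> a sa; rewrite ler_pdivlMr// -{1}sa -normcX mulrC -normcM.
have -> : a ^+ N * q a = g a - \sum_(k < N) c k * a ^+ k by rewrite gq addrAC subrr add0r.
apply: le_trans (normcB _ _) _.
rewrite -natr1 mulrDl mul1r addrC; apply: lerD; last by rewrite gM ?sa.
apply: le_trans (normc_sum _ _ _) _.
apply: (@le_trans _ _ (\sum_(j < N) M)); last by rewrite sumr_const card_ord mulr_natl.
apply: ler_sum => j _; rewrite normcM normcX sa -[leRHS]mulr1.
by apply: ler_pM; rewrite ?normc_ge0 ?exprn_ge0 ?(ltW s0)// exprn_ile1// ltW.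
Qed.

End disc.

(** * Polynomials and power series on the ball *)

Section vectors.
Variables (R : realType) (n : nat).
Local Notation C := R[i].
Local Notation Cn := (n.-tuple C).
Implicit Types (x y z : Cn) (l : C).

Definition tscale l z : Cn := [tuple l * tnth z i | i < n].
Definition tadd x y : Cn := [tuple tnth x i + tnth y i | i < n].

Lemma tscaleDl l1 l2 z : tadd (tscale l1 z) (tscale l2 z) = tscale (l1 + l2) z.
Proof. by apply: eq_from_tnth => i; rewrite !tnth_mktuple mulrDl. Qed.

Lemma tscale1 z : tscale 1 z = z.
Proof. by apply: eq_from_tnth => i; rewrite !tnth_mktuple mul1r. Qed.

Lemma enorm_ge0 z : 0 <= enorm z.
Proof. exact: sqrtr_ge0. Qed.

Lemma sqr_enorm z : enorm z ^+ 2 = \sum_(i < n) normc (tnth z i) ^+ 2.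
Proof. by rewrite sqr_sqrtr// sumr_ge0// => i _; exact: sqr_ge0. Qed.

Lemma enorm_tscale l z : enorm (tscale l z) = normc l * enorm z.
Proof.
apply/eqP; rewrite -(@eqrXn2 _ 2)// ?mulr_ge0 ?normc_ge0 ?enorm_ge0//.
rewrite exprMn !sqr_enorm mulr_sumr; apply/eqP/eq_bigr => i _.
by rewrite tnth_mktuple normcM exprMn.
Qed.

Lemma normc_tnth_le z i : normc (tnth z i) <= enorm z.
Proof.
rewrite -(@ler_pXn2r _ 2) ?nnegrE ?normc_ge0 ?enorm_ge0// sqr_enorm.
by rewrite (bigD1 i)//= lerDl sumr_ge0// => j _; exact: sqr_ge0.
Qed.

Lemma innerDl x y z : inner (tadd x y) z = inner x z + inner y z.
Proof.
by rewrite /inner -big_split/=; apply: eq_bigr => i _; rewrite tnth_mktuple mulrDl.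
Qed.

Lemma inner_conj x y : (inner x y)^* = inner y x.
Proof.
rewrite /inner rmorph_sum; apply: eq_bigr => i _.
by rewrite /= rmorphM /= conjCK mulrC.
Qed.

(* Normalizing both vectors, 2 |x_i y_i| <= |x_i|^2 + |y_i|^2 sums to 2. *)
Lemma normc_inner_le x y : normc (inner x y) <= enorm x * enorm y.
Proof.
have [x0|x0] := eqVneq (enorm x) 0.
  have t0 i : tnth x i = 0 by apply: normc_le0_eq0; rewrite -x0 normc_tnth_le.
  by rewrite /inner big1 ?normc0 ?x0 ?mul0r// => i _; rewrite t0 mul0r.
have [y0|y0] := eqVneq (enorm y) 0.
  have t0 i : tnth y i = 0 by apply: normc_le0_eq0; rewrite -y0 normc_tnth_le.
  by rewrite /inner big1 ?normc0 ?y0 ?mulr0// => i _; rewrite t0 rmorph0 mulr0.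
have X : 0 < enorm x by rewrite lt_def x0 enorm_ge0.
have Y : 0 < enorm y by rewrite lt_def y0 enorm_ge0.
apply: le_trans (normc_sum _ _ _) _.
rewrite -ler_pdivrMl// -[leRHS]mulr1 -ler_pdivrMl// !mulr_sumr.
apply: (@le_trans _ _ (\sum_(i < n) 2^-1 * ((enorm x ^+ 2)^-1 * normc (tnth x i) ^+ 2 +
   (enorm y ^+ 2)^-1 * normc (tnth y i) ^+ 2))).
  apply: ler_sum => i _; rewrite normcM normc_conj.
  have := sqr_ge0 ((enorm x)^-1 * normc (tnth x i) - (enorm y)^-1 * normc (tnth y i)).
  rewrite sqrrB !exprMn !exprVn; lra.
rewrite -mulr_sumr big_split/= -!mulr_sumr -!sqr_enorm !mulVf ?sqrf_eq0//.
Qed.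

End vectors.

Section polynomial_functions.
Variables (R : realType) (n : nat).
Local Notation C := R[i].
Local Notation Cn := (n.-tuple C).
Implicit Types (f g : Cn -> C).

Definition is_poly f := exists p : mpoly.mpoly n C, f = polynomial_fun p.

Lemma is_poly_fun (p : mpoly.mpoly n C) : is_poly (polynomial_fun p).
Proof. by exists p. Qed.

Lemma is_poly_cst (k : C) : is_poly (fun=> k).
Proof. by exists (mpoly.mpolyC n k); apply/funext => z; rewrite /polynomial_fun mpoly.mevalC. Qed.

Lemma is_poly_coord (i : 'I_n) : is_poly (fun z => tnth z i).
Proof.
exists (mpoly.mpolyX C (mpoly.mnm1 i)); apply/funext => z.
by rewrite /polynomial_fun mpoly.mevalXU.
Qed.

Lemma is_polyD f g : is_poly f -> is_poly g -> is_poly (fun z => f z + g z).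
Proof.
move=> [p ->] [q ->]; exists (p + q); apply/funext => z.
by rewrite /polynomial_fun mpoly.mevalD.
Qed.

Lemma is_polyM f g : is_poly f -> is_poly g -> is_poly (fun z => f z * g z).
Proof.
move=> [p ->] [q ->]; exists (p * q); apply/funext => z.
by rewrite /polynomial_fun mpoly.mevalM.
Qed.

Lemma is_polyB f g : is_poly f -> is_poly g -> is_poly (fun z => f z - g z).
Proof.
move=> [p ->] [q ->]; exists (p - q); apply/funext => z.
by rewrite /polynomial_fun mpoly.mevalB.
Qed.

Lemma is_polyX f k : is_poly f -> is_poly (fun z => f z ^+ k).
Proof.
move=> hf; elim: k => [|k IH]; first exact: is_poly_cst.
by under [X in is_poly X]funext do rewrite exprS; exact: is_polyM.
Qed.

Lemma is_poly_sum I (r : seq I) (P : pred I) (F : I -> Cn -> C) :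
  (forall i, is_poly (F i)) -> is_poly (fun z => \sum_(i <- r | P i) F i z).
Proof.
move=> h; elim: r => [|i r IH].
  by under [X in is_poly X]funext do rewrite big_nil; exact: is_poly_cst.
under [X in is_poly X]funext do rewrite big_cons.
by case: (P i) => //; exact: is_polyD.
Qed.

Lemma is_poly_prod I (r : seq I) (P : pred I) (F : I -> Cn -> C) :
  (forall i, is_poly (F i)) -> is_poly (fun z => \prod_(i <- r | P i) F i z).
Proof.
move=> h; elim: r => [|i r IH].
  by under [X in is_poly X]funext do rewrite big_nil; exact: is_poly_cst.
under [X in is_poly X]funext do rewrite big_cons.
by case: (P i) => //; exact: is_polyM.
Qed.

Lemma is_poly_monomial alpha : is_poly (@monomial R n alpha).
Proof. by apply: is_poly_prod => i; apply: is_polyX; exact: is_poly_coord. Qed.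

Lemma is_poly_inner w : is_poly (fun z : Cn => inner z w).
Proof.
apply: is_poly_sum => i; apply: is_polyM; first exact: is_poly_coord.
exact: is_poly_cst.
Qed.

Lemma is_polyE f : is_poly f -> exists (s : seq ({ffun 'I_n -> nat} * C)),
  forall z, f z = \sum_(a <- s) a.2 * monomial a.1 z.
Proof.
move=> [p ->]; exists [seq ([ffun i => (m : mpoly.multinom n) i],
  mpoly.mcoeff m p) | m <- mpoly.msupp p] => z.
rewrite big_map /polynomial_fun mpoly.mevalE; apply: eq_bigr => m _ /=.
by congr (_ * _); apply: eq_bigr => i _; rewrite ffunE.
Qed.

End polynomial_functions.

Section multi_indices.
Variable n : nat.
Local Notation idx := {ffun 'I_n -> nat}.

Definition cube_idx N (b : {ffun 'I_n -> 'I_N}) : idx := [ffun i => b i : nat].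

Definition mdeg (a : idx) : nat := \sum_(i < n) a i.

Lemma cube_idx_inj N : injective (@cube_idx N).
Proof.
move=> b1 b2 /ffunP e; apply/ffunP => i; apply: val_inj.
by have := e i; rewrite !ffunE.
Qed.

Lemma leq_mdeg (a : idx) i : (a i <= mdeg a)%N.
Proof. by rewrite /mdeg (bigD1 i)//= leq_addr. Qed.

(** Lets a sum over the smallest convenient cube of exponents be compared with the large cubes along
    which [analytic_at] sums. *)
Lemma cube_widen (V : nmodType) N N' (F : idx -> V) : (N < N')%N ->
  \sum_(b : {ffun 'I_n -> 'I_N'} | [forall i, (b i < N.+1)%N]) F (cube_idx b) =
  \sum_(b : {ffun 'I_n -> 'I_N.+1}) F (cube_idx b).
Proof.
move=> NN'; pose h (b : {ffun 'I_n -> 'I_N.+1}) : {ffun 'I_n -> 'I_N'} :=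
  [ffun i => widen_ord NN' (b i)].
pose h' (b : {ffun 'I_n -> 'I_N'}) : {ffun 'I_n -> 'I_N.+1} := [ffun i => inord (b i)].
rewrite [LHS](reindex_onto h h')/=; last first.
  move=> b /forallP bN; apply/ffunP => i; apply: val_inj.
  by rewrite !ffunE /= inordK.
apply: eq_big => [b|b _].
  apply/andP; split.
    by apply/forallP => i; rewrite ffunE /=.
  by apply/eqP/ffunP => i; apply: val_inj; rewrite !ffunE /= inordK.
by congr F; apply/ffunP => i; rewrite !ffunE.
Qed.

End multi_indices.

Section power_series.
Variables (R : realType) (n : nat).
Local Notation C := R[i].
Local Notation Cn := (n.-tuple C).
Local Notation idx := {ffun 'I_n -> nat}.
Implicit Types (c : idx -> C) (z h : Cn).

(** An exponent of degree k has entries at most k, so the cube of side k + 1 misses none of them. *)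
Definition homog_part c k z : C :=
  \sum_(b : {ffun 'I_n -> 'I_k.+1} | mdeg (cube_idx b) == k)
     c (cube_idx b) * monomial (cube_idx b) z.

Lemma is_poly_homog_part c k : is_poly (homog_part c k).
Proof.
apply: is_poly_sum => b; apply: is_polyM; first exact: is_poly_cst.
exact: is_poly_monomial.
Qed.

Lemma homog_part_cube c k N z : (k < N)%N -> homog_part c k z =
  \sum_(b : {ffun 'I_n -> 'I_N} | mdeg (cube_idx b) == k)
     c (cube_idx b) * monomial (cube_idx b) z.
Proof.
move=> kN; rewrite /homog_part big_mkcond/=.
rewrite -(@cube_widen n _ k N (fun a => if mdeg a == k then c a * monomial a z else 0))//.
rewrite -big_mkcondr/=; apply: eq_bigl => b.
case: eqP => [bk|]; rewrite ?andbF// andbT.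
apply/forallP => i; have := leq_mdeg (cube_idx b) i.
by rewrite bk ffunE ltnS.
Qed.

Lemma monomial_tscale (a : idx) l z :
  monomial a (tscale l z) = l ^+ mdeg a * monomial a z.
Proof.
rewrite /monomial /mdeg -prodrXr -big_split/=; apply: eq_bigr => i _.
by rewrite tnth_mktuple exprMn.
Qed.

Lemma cube_sum_homog c z N : \sum_(k < N) homog_part c k z =
  \sum_(b : {ffun 'I_n -> 'I_N} | (mdeg (cube_idx b) < N)%N)
     c (cube_idx b) * monomial (cube_idx b) z.
Proof.
under eq_bigr => k _ do rewrite (homog_part_cube _ _ (ltn_ord k)) big_mkcond/=.
rewrite exchange_big/= [RHS]big_mkcond/=; apply: eq_bigr => b _.
case: ifPn => [bN|bN].
  rewrite (bigD1 (Ordinal bN))//= eqxx big1 ?addr0// => k kb.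
  case: eqP => // e; case/eqP: kb; exact: val_inj.
rewrite big1// => k _; case: eqP => // e.
by rewrite -leqNgt e leqNgt ltn_ord in bN.
Qed.

(** A cube of side L >= N contains every exponent of degree below N, so cubical and homogeneous
    partial sums differ only by terms of high degree. *)
Lemma cube_sum_split c z N L : (N <= L)%N ->
  \sum_(b : {ffun 'I_n -> 'I_L}) c (cube_idx b) * monomial (cube_idx b) z =
  \sum_(k < N) homog_part c k z +
  \sum_(b : {ffun 'I_n -> 'I_L} | (N <= mdeg (cube_idx b))%N)
    c (cube_idx b) * monomial (cube_idx b) z.
Proof.
move=> NL; rewrite (bigID (fun b : {ffun 'I_n -> 'I_L} => (mdeg (cube_idx b) < N)%N))/=.
congr (_ + _); last by apply: eq_bigl => b; rewrite -leqNgt.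
rewrite cube_sum_homog [LHS]big_mkcond/=.
case: N NL => [|N] NL.
  by rewrite big1 ?[RHS]big_pred0//.
rewrite [RHS]big_mkcond/=.
rewrite -(@cube_widen n _ N L (fun a => if (mdeg a < N.+1)%N then c a * monomial a z else 0))//.
rewrite [RHS]big_mkcond/=; apply: eq_bigr => b _.
case: ifPn => // bN; case: forallP => // -[] i.
have := leq_mdeg (cube_idx b) i; rewrite ffunE => h.
exact: leq_ltn_trans h bN.
Qed.

Lemma cube_sum_le_esum (F : idx -> R) N : (forall a, 0 <= F a) ->
  ((\sum_(b : {ffun 'I_n -> 'I_N}) F (cube_idx b))%:E <=
   \esum_(a in [set: idx]) (F a)%:E)%E.
Proof.
move=> F0; apply: esum_ge; exists (@cube_idx n N @` [set: _]).
  by split=> //; exact: finite_image.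
rewrite fsbig_image; last by move=> x y _ _; exact: cube_idx_inj.
rewrite fsumEFin; last exact: finite_finset.
rewrite lee_fin le_eqVlt; apply/orP; left; apply/eqP.
rewrite fsbig_seq; last exact: index_enum_uniq.
by apply: eq_fsbigl; apply/seteqP; split => // x _ /=; exact: mem_index_enum.
Qed.

(** A finite set of exponents lies in the cube whose side exceeds all their degrees. *)
Lemma esum_le_cube_sum (F : idx -> R) (S : R) : (forall a, 0 <= F a) ->
  (forall N, \sum_(b : {ffun 'I_n -> 'I_N}) F (cube_idx b) <= S) ->
  (\esum_(a in [set: idx]) (F a)%:E < +oo)%E.
Proof.
move=> F0 FS; apply: (@le_lt_trans _ _ S%:E); last exact: ltry.
apply: ge_ereal_sup => _ [A [finA _] <-].
have /finite_seqP[s As] := finA.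
pose N := (\max_(a <- s) mdeg a).+1.
rewrite fsumEFin// lee_fin; apply: le_trans (FS N).
have -> : \sum_(b : {ffun 'I_n -> 'I_N}) F (cube_idx b) =
    \sum_(a \in @cube_idx n N @` [set: _]) F a.
  rewrite fsbig_image; last by move=> x y _ _; exact: cube_idx_inj.
  rewrite [LHS]fsbig_seq; last exact: index_enum_uniq.
  by apply: eq_fsbigl; apply/seteqP; split => // x _ /=; exact: mem_index_enum.
rewrite -lee_fin -!fsumEFin//; last exact: finite_image.
apply: lee_fsum_nneg_subset => //; first exact: finite_image.
  move=> a; rewrite !inE => Aa /=.
  have aN i : (a i < N)%N.
    rewrite ltnS; apply: leq_trans (leq_mdeg a i) _.
    by rewrite As /= in Aa; exact: leq_bigmax_seq.
  exists [ffun i => Ordinal (aN i)] => //.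
  by apply/ffunP => i; rewrite !ffunE.
by move=> a _; rewrite lee_fin.
Qed.

(** On a complex line the series regroups by degree. For |u| < rho its terms of degree at least N
    are at most (|u| / rho)^N times their values at distance rho, whose absolute sum S becomes the
    constant of [has_pser]. *)
Lemma slice_has_pser (f : Cn -> C) l z (r : R) c : enorm z <= 1 -> 0 < r ->
  (forall h : Cn, enorm h < r ->
      (\esum_(alpha in setT) (normc (c alpha * monomial alpha h))%:E < +oo)%E /\
      normc (\sum_(beta : {ffun 'I_n -> 'I_N})
               (let alpha := [ffun i => beta i : nat] in
                c alpha * monomial alpha h)
             - f [tuple tnth (tscale l z) i + tnth h i | i < n]) @[N --> \oo] --> (0 : R)) ->
  has_pser (fun x => f (tscale x z)) l (fun k => homog_part c k z).
Proof.
move=> z1 r0 H; pose rho := r / 2.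
have rho0 : 0 < rho by rewrite divr_gt0.
have sz u : normc u <= rho -> enorm (tscale u z) < r.
  move=> ur; rewrite enorm_tscale; apply: (@le_lt_trans _ _ rho); last by rewrite /rho; lra.
  by rewrite -[leRHS]mulr1; apply: ler_pM; rewrite ?normc_ge0 ?enorm_ge0.
have nrho : normc rho%:C = rho by rewrite normc_real gtr0_norm.
have [fin0 _] := H (tscale rho%:C z) (sz rho%:C ltac:(by rewrite nrho)).
pose F (a : idx) := normc (c a * monomial a (tscale rho%:C z)).
have F0 a : 0 <= F a by exact: normc_ge0.
have [S HS] : exists S : R, forall N, \sum_(b : {ffun 'I_n -> 'I_N}) F (cube_idx b) <= S.
  move: fin0; have := @cube_sum_le_esum F _ F0.
  have := @esum_ge0 R idx setT (fun a => (F a)%:E) (fun a _ => F0 a).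
  rewrite -/F; case: (esum _ _) => //= s _ h _; exists s => N.
  by have := h N; rewrite lee_fin.
exists rho, S; split=> // N u ur.
have [_ /cvgrPdist_lt lim] := H (tscale u z) (sz _ (ltW ur)).
apply/ler_addgt0Pr => e e0.
have [L _ HL] := lim e e0.
(* A cube of this side gives f up to e and contains all exponents of degree below N. *)
have := HL (maxn L N) (leq_maxl _ _); rewrite sub0r normrN ger0_norm ?normc_ge0//.
have -> : [tuple tnth (tscale l z) i + tnth (tscale u z) i | i < n] = tscale (l + u) z.
  by rewrite -tscaleDl.
rewrite [X in normc (X - _)](cube_sum_split c (tscale u z) (leq_maxr L N)).
have -> : \sum_(k < N) homog_part c k (tscale u z) = \sum_(k < N) homog_part c k z * u ^+ k.
  apply: eq_bigr => k _; rewrite mulr_suml; apply: eq_bigr => b /eqP bk.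
  by rewrite monomial_tscale bk; ring.
set P := \sum_(k < N) _; set T := \sum_(b | _) _; set G := f _ => h.
have -> : G - P = T - (P + T - G) by ring.
apply: le_trans (normcB _ _) _; apply: lerD; last exact: ltW.
apply: le_trans (normc_sum _ _ _) _.
apply: (@le_trans _ _ (\sum_(b : {ffun 'I_n -> 'I_(maxn L N)} | (N <= mdeg (cube_idx b))%N)
   F (cube_idx b) * (normc u / rho) ^+ N)).
  apply: ler_sum => b Nb; rewrite /F !monomial_tscale.
  rewrite !normcM !normcX nrho -!mulrA ler_wpM2l ?normc_ge0//.
  rewrite mulrC mulrCA ler_wpM2l ?normc_ge0//.
  have -> : normc u ^+ mdeg (cube_idx b) = (normc u / rho) ^+ mdeg (cube_idx b) * rho ^+ mdeg
    (cube_idx b).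
    by rewrite -exprMn divfK ?gt_eqF.
  rewrite mulrC ler_wpM2l ?exprn_ge0 ?(ltW rho0)//.
  have q0 : 0 <= normc u / rho by rewrite divr_ge0 ?normc_ge0// ltW.
  by rewrite ler_wiXn2l// ler_pdivrMr// mul1r ltW.
have q0 : 0 <= normc u / rho by rewrite divr_ge0 ?normc_ge0// ltW.
rewrite -mulr_suml ler_wpM2r ?exprn_ge0//.
apply: le_trans (HS (maxn L N)).
rewrite [leRHS](bigID (fun b : {ffun 'I_n -> 'I_(maxn L N)} => (N <= mdeg (cube_idx b))%N))/=.
by rewrite lerDl sumr_ge0.
Qed.

(** Each of the N + 1 terms of the geometric sum is at least s^N. *)
Lemma succ_expr_le (s : R) N : 0 <= s < 1 -> N.+1%:R * s ^+ N <= (1 - s)^-1.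
Proof.
move=> /andP[s0 s1]; rewrite -[leRHS]mul1r ler_pdivlMr ?subr_gt0//.
have h : N.+1%:R * s ^+ N <= \sum_(k < N.+1) s ^+ k.
  rewrite mulr_natl -[X in _ *+ X]card_ord -sumr_const; apply: ler_sum => k _.
  by rewrite ler_wiXn2l ?(ltW s1)// -ltnS.
have s1' : 0 <= 1 - s by rewrite subr_ge0 ltW.
apply: le_trans (ler_wpM2r s1' h) _.
have : (s - 1) * \sum_(k < N.+1) s ^+ k = s ^+ N.+1 - 1 by rewrite -subrX1.
have := exprn_ge0 N.+1 s0; lra.
Qed.

(** Stands in for boundary values: p is a Taylor polynomial at 0 of the dilate x |-> f(s^2 x). The
    dilate is bounded by M up to the sphere, [taylor_remainder] is uniform over the lines through 0,
    and continuity along those lines handles the points z_i. *)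
Lemma bounded_analytic_poly_approx (f : Cn -> C) (M : R) m (zs : 'I_m -> Cn) (e : R) :
  (forall z, unit_ball z -> analytic_at f z) ->
  (forall z, unit_ball z -> normc (f z) <= M) ->
  (forall i, unit_ball (zs i)) -> 0 < e ->
  exists p, [/\ is_poly p, forall x, enorm x = 1 -> normc (p x) <= M + e &
     forall i, normc (p (zs i) - f (zs i)) <= e].
Proof.
move=> af fM zb e0.
have in_ball l z : normc l < 1 -> enorm z <= 1 -> unit_ball (tscale l z).
  move=> l1 z1; rewrite /unit_ball/= enorm_tscale.
  apply: le_lt_trans l1; rewrite -[leRHS]mulr1.
  by rewrite ler_wpM2l ?normc_ge0.
pose o : Cn := [tuple 0 | i < n].
have o0 z : tscale 0 z = o by apply: eq_from_tnth => i; rewrite !tnth_mktuple mul0r.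
have ob : unit_ball o.
  by rewrite /unit_ball/= -(o0 o) enorm_tscale normc0 mul0r.
have M0 : 0 <= M by apply: le_trans (fM o ob); exact: normc_ge0.
have [r [c [r0 Hc]]] := af o ob.
have hs z : enorm z <= 1 -> hol_disc (fun x => f (tscale x z)).
  move=> z1 l l1; have [r' [c' [r'0 H']]] := af _ (in_ball l z l1 z1).
  by exists (fun k => homog_part c' k z); exact: slice_has_pser H'.
have h0 z : enorm z <= 1 ->
    has_pser (fun x => f (tscale x z)) 0 (fun k => homog_part c k z).
  by move=> z1; apply: (slice_has_pser z1 r0); rewrite o0.
have rem z : enorm z <= 1 -> forall N x, normc x < 1 ->
    normc (f (tscale x z) - \sum_(k < N) homog_part c k z * x ^+ k) <= N.+1%:R * M * normc x ^+ N.
  move=> z1; apply: (taylor_remainder (hs z z1) (h0 z z1)) => a a1.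
  by apply: fM; exact: in_ball.
have lip i : exists K d : R, 0 < d /\
    forall u, normc u < d -> normc (f (tscale (1 + u) (zs i)) - f (zs i)) <= K * normc u.
  have z1 : enorm (zs i) <= 1 by apply: ltW; exact: (zb i).
  have [r' [c' [r'0 H']]] := af _ (zb i).
  have /has_pser_lipschitz[K [d [d0 Hd]]] : has_pser (fun x => f (tscale x (zs i))) 1
      (fun k => homog_part c' k (zs i)) by apply: (slice_has_pser z1 r'0); rewrite tscale1.
  by exists K, d; split=> // u ud; have := Hd u ud; rewrite tscale1.
have [s [/andP[s0 s1] Hs]] : exists s : R, 0 < s < 1 /\
    forall i, normc (f (tscale (s ^+ 2)%:C (zs i)) - f (zs i)) <= e / 2.
  have /choice[K /choice[d Hd]] := lip.
  (* With s = 1 - t/2 one has |s^2 - 1| <= t, so t is taken below every Lipschitz radius and every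
     allowed error; the base value 1/2 keeps s positive. *)
  pose t := \big[Num.min/2^-1]_i Num.min (d i / 2) (e / 4 / (`|K i| + 1)).
  have t0 : 0 < t.
    rewrite /t; elim/big_ind : _ => [|x y x0 y0|i _]; rewrite ?invr_gt0 ?ltr0n ?lt_min ?x0//.
    have [di _] := Hd i.
    by rewrite divr_gt0//= !divr_gt0// ltr_wpDl.
  have t12 : t <= 2^-1 by rewrite /t; exact: bigmin_le_id.
  exists (1 - t / 2); split; first by apply/andP; split; lra.
  move=> i; have [di Hi] := Hd i.
  have ti : t <= Num.min (d i / 2) (e / 4 / (`|K i| + 1)) by rewrite /t; exact: bigmin_le_cond.
  move: ti; rewrite le_min => /andP[td tK].
  pose u : C := ((1 - t / 2) ^+ 2 - 1)%:C.
  have nu : normc u <= t.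
    rewrite /u normc_real ler_norml; apply/andP; split; nra.
  have -> : ((1 - t / 2) ^+ 2)%:C = 1 + u.
    by apply/eqP; rewrite eq_complex /= addr0 eqxx andbT; apply/eqP; ring.
  apply: le_trans (Hi u _) _; first by lra.
  have K1 : 0 < `|K i| + 1 by rewrite ltr_wpDl.
  apply: (@le_trans _ _ ((`|K i| + 1) * normc u)).
    rewrite ler_wpM2r ?normc_ge0//; apply: le_trans (ler_norm _) _.
    by rewrite lerDl.
  rewrite mulrC -ler_pdivlMr//; lra.
(* Dilating by s^2 rather than s lets one factor s^N absorb N + 1 while the other tends to 0. *)
have [N HN] : exists N, N.+1%:R * M * (s ^+ 2) ^+ N <= e / 2.
  have /cvgrPdist_lt cv : (fun N => (M / (1 - s) + 1) * s ^+ N) @ \oo --> (0 : R).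
    by apply: cvg_geometric; rewrite ger0_norm ?(ltW s0).
  have [N _ HN] := cv (e / 2) ltac:(by rewrite divr_gt0).
  exists N; have := HN N (leqnn N); rewrite /= sub0r normrN => h.
  apply: le_trans (ltW h); apply: le_trans (ler_norm _).
  rewrite -exprM mulnC exprM expr2 mulrA ler_wpM2r ?exprn_ge0 ?(ltW s0)//.
  have := ler_wpM2l M0 (@succ_expr_le s N ltac:(by rewrite (ltW s0) s1)).
  set A := _%:R; lra.
pose rr : C := (s ^+ 2)%:C.
have s21 : s ^+ 2 < 1 by rewrite expr_lt1// ltW.
have nr : normc rr = s ^+ 2 by rewrite normc_real ger0_norm// sqr_ge0.
exists (fun z => \sum_(k < N) homog_part c k z * rr ^+ k); split.
- apply: is_poly_sum => k; apply: is_polyM; first exact: is_poly_homog_part.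
  exact: is_poly_cst.
- move=> x x1; have := rem x ltac:(by rewrite x1) N rr; rewrite nr => /(_ s21) h.
  have fm : normc (f (tscale rr x)) <= M.
    by apply: fM; apply: in_ball; rewrite ?nr ?x1.
  have := ler_normcB (\sum_(k < N) homog_part c k x * rr ^+ k) (f (tscale rr x)).
  rewrite normc_distC; lra.
- move=> i; have z1 : enorm (zs i) <= 1 by apply: ltW; exact: (zb i).
  have := rem _ z1 N rr; rewrite nr => /(_ s21) h.
  have := Hs i; rewrite -/rr => h2.
  have -> : \sum_(k < N) homog_part c k (zs i) * rr ^+ k - f (zs i) =
    (f (tscale rr (zs i)) - f (zs i)) -
     (f (tscale rr (zs i)) - \sum_(k < N) homog_part c k (zs i) * rr ^+ k) by ring.
  by apply: le_trans (normcB _ _) _; lra.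
Qed.

End power_series.

(** * Square-integrable complex functions *)

Section measurable_complex.
Context d (T : measurableType d) (R : realType).
Implicit Types (f g : T -> R[i]).

Lemma mfun_Re f : measurable_fun setT f -> measurable_fun setT (fun x => complex.Re (f x)).
Proof. by move=> /measurable_fun_complexP[]. Qed.

Lemma mfun_Im f : measurable_fun setT f -> measurable_fun setT (fun x => complex.Im (f x)).
Proof. by move=> /measurable_fun_complexP[]. Qed.

Lemma mfun_normc f : measurable_fun setT f -> measurable_fun setT (fun x => normc (f x)).
Proof. by move=> mf; exact: (measurableT_comp (@measurable_normc R)). Qed.

Lemma mfun_cst (k : R[i]) : measurable_fun setT (fun _ : T => k).
Proof. exact: measurable_cst. Qed.

Lemma mfunD f g : measurable_fun setT f -> measurable_fun setT g ->
  measurable_fun setT (fun x => f x + g x).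
Proof.
move=> /measurable_fun_complexP[fr fi] /measurable_fun_complexP[gr gi].
apply/measurable_fun_complexP; split.
  by under eq_fun do rewrite ReD; exact: measurable_funD.
by under eq_fun do rewrite ImD; exact: measurable_funD.
Qed.

Lemma mfunM f g : measurable_fun setT f -> measurable_fun setT g ->
  measurable_fun setT (fun x => f x * g x).
Proof.
move=> /measurable_fun_complexP[fr fi] /measurable_fun_complexP[gr gi].
apply/measurable_fun_complexP; split.
  by under eq_fun do rewrite ReM; apply: measurable_funB; exact: measurable_funM.
by under eq_fun do rewrite ImM; apply: measurable_funD; exact: measurable_funM.
Qed.

Lemma mfunZ f (k : R[i]) : measurable_fun setT f -> measurable_fun setT (fun x => k * f x).
Proof. by move=> mf; apply: mfunM => //; exact: mfun_cst. Qed.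

Lemma mfunB f g : measurable_fun setT f -> measurable_fun setT g ->
  measurable_fun setT (fun x => f x - g x).
Proof.
move=> mf mg; under eq_fun do rewrite -mulN1r.
by apply: mfunD => //; exact: mfunZ.
Qed.

Lemma mfun_conj f : measurable_fun setT f -> measurable_fun setT (fun x => (f x)^*).
Proof.
move=> /measurable_fun_complexP[fr fi]; apply/measurable_fun_complexP; split.
  by under eq_fun do rewrite Re_conj.
by under eq_fun do rewrite Im_conj; exact: measurable_funN.
Qed.

Lemma mfunX f k : measurable_fun setT f -> measurable_fun setT (fun x => f x ^+ k).
Proof.
move=> mf; elim: k => [|k IH]; first exact: mfun_cst.
by under eq_fun do rewrite exprS; exact: mfunM.
Qed.

Lemma mfun_sum I (r : seq I) (P : pred I) (F : I -> T -> R[i]) :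
  (forall i, measurable_fun setT (F i)) ->
  measurable_fun setT (fun x => \sum_(i <- r | P i) F i x).
Proof.
move=> h; elim: r => [|i r IH].
  by under eq_fun do rewrite big_nil; exact: mfun_cst.
by under eq_fun do rewrite big_cons; case: (P i) => //; exact: mfunD.
Qed.

Lemma mfun_prod I (r : seq I) (P : pred I) (F : I -> T -> R[i]) :
  (forall i, measurable_fun setT (F i)) ->
  measurable_fun setT (fun x => \prod_(i <- r | P i) F i x).
Proof.
move=> h; elim: r => [|i r IH].
  by under eq_fun do rewrite big_nil; exact: mfun_cst.
by under eq_fun do rewrite big_cons; case: (P i) => //; exact: mfunM.
Qed.

Lemma mfun_real (f : T -> R) : measurable_fun setT f ->
  measurable_fun setT (fun x => (f x)%:C).
Proof.
by move=> mf; apply/measurable_fun_complexP; split => //=; exact: measurable_cst.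
Qed.

(** The formula x^-1 = conj x / |x|^2 also holds at 0, where inverses are 0. *)
Lemma mfunV f : measurable_fun setT f -> measurable_fun setT (fun x => (f x)^-1).
Proof.
move=> mf; under eq_fun => x.
  rewrite (_ : (f x)^-1 = (f x)^* * ((normc (f x) ^+ 2) `^ (-1))%:C); last first.
    rewrite powR_inv1 ?exprn_ge0 ?normc_ge0//.
    have [->|f0] := eqVneq (f x) 0; first by rewrite invr0 rmorph0 mul0r.
    apply: (mulfI f0); rewrite divff// mulrA mulr_conj -rmorphM/= divff ?rmorph1//.
    by rewrite expf_neq0// normc_eq0.
  over.
apply: mfunM; first exact: mfun_conj.
apply: mfun_real.
apply: (@measurableT_comp _ _ _ _ _ _ (@powR R ^~ (-1))) => //.
by apply: measurable_funX; exact: mfun_normc.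
Qed.

End measurable_complex.

Section complex_integral.
Context d (T : measurableType d) (R : realType).
Variable mu : {measure set T -> \bar R}.
Implicit Types (f g : T -> R[i]).

Lemma integrable_EFinD (f g : T -> R) :
  mu.-integrable setT (EFin \o f) -> mu.-integrable setT (EFin \o g) ->
  mu.-integrable setT (EFin \o (fun x => f x + g x)).
Proof. by move=> fi gi; have := integrableD measurableT fi gi; exact. Qed.

Lemma integrable_EFinZ (k : R) (f : T -> R) : mu.-integrable setT (EFin \o f) ->
  mu.-integrable setT (EFin \o (fun x => k * f x)).
Proof. by move=> fi; have := integrableZl measurableT k fi; exact. Qed.

Definition cint f := measurable_fun setT f /\
  mu.-integrable setT (EFin \o (fun x => normc (f x))).

Lemma cint_Re f : cint f -> mu.-integrable setT (EFin \o (fun x => complex.Re (f x))).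
Proof.
move=> [mf fi]; apply: le_integrable fi => //.
  by apply/measurable_EFinP; exact: mfun_Re.
by move=> x _ /=; rewrite lee_fin [leRHS]ger0_norm ?normc_ge0// normr_Re_le.
Qed.

Lemma cint_Im f : cint f -> mu.-integrable setT (EFin \o (fun x => complex.Im (f x))).
Proof.
move=> [mf fi]; apply: le_integrable fi => //.
  by apply/measurable_EFinP; exact: mfun_Im.
by move=> x _ /=; rewrite lee_fin [leRHS]ger0_norm ?normc_ge0// normr_Im_le.
Qed.

Lemma cint_le f (g : T -> R) : measurable_fun setT f ->
  mu.-integrable setT (EFin \o g) -> (forall x, normc (f x) <= g x) -> cint f.
Proof.
move=> mf gi fg; split=> //; apply: le_integrable gi => //.
  by apply/measurable_EFinP; exact: mfun_normc.
move=> x _ /=; rewrite lee_fin ger0_norm ?normc_ge0//.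
exact: le_trans (fg x) (ler_norm _).
Qed.

Lemma cintD f g : cint f -> cint g -> cint (fun x => f x + g x).
Proof.
move=> [mf fi] [mg gi]; apply: (cint_le (mfunD mf mg)); last first.
  by move=> x; exact: le_normcD.
exact: integrable_EFinD.
Qed.

Lemma cintZ f (k : R[i]) : cint f -> cint (fun x => k * f x).
Proof.
move=> [mf fi]; apply: (cint_le (mfunZ k mf) (integrable_EFinZ (normc k) fi)) => x.
by rewrite normcM.
Qed.

Lemma cint0 : cint (fun=> 0).
Proof.
split; first exact: mfun_cst.
rewrite /comp normc0; exact: integrable0.
Qed.

Lemma cint_sum I (r : seq I) (F : I -> T -> R[i]) :
  (forall i, cint (F i)) -> cint (fun x => \sum_(i <- r) F i x).
Proof.
move=> h; elim: r => [|i r IH].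
  by under eq_fun do rewrite big_nil; exact: cint0.
by under eq_fun do rewrite big_cons; exact: cintD.
Qed.

Lemma cintegralD f g : cint f -> cint g ->
  cintegral mu (fun x => f x + g x) = cintegral mu f + cintegral mu g.
Proof.
move=> fi gi; rewrite /cintegral.
under eq_Rintegral do rewrite ReD.
under [X in _ +i* X]eq_Rintegral do rewrite ImD.
rewrite !RintegralD//; [exact: cint_Im|exact: cint_Im|exact: cint_Re|exact: cint_Re].
Qed.

Lemma cintegralZ f (k : R[i]) : cint f ->
  cintegral mu (fun x => k * f x) = k * cintegral mu f.
Proof.
move=> fi; rewrite /cintegral.
have fr := cint_Re fi; have fim := cint_Im fi.
have fr' c : mu.-integrable setT (EFin \o (fun x => c * complex.Re (f x))).
  exact: (integrableZl measurableT c fr).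
have fi' c : mu.-integrable setT (EFin \o (fun x => c * complex.Im (f x))).
  exact: (integrableZl measurableT c fim).
under eq_Rintegral do rewrite ReM.
under [X in _ +i* X]eq_Rintegral do rewrite ImM.
rewrite RintegralB// RintegralD// !RintegralZl//.
by apply/eqP; rewrite eq_complex /= ReM ImM /= !eqxx.
Qed.

Lemma cintegral0 : cintegral mu (fun=> 0) = 0.
Proof.
rewrite -[RHS](mul0r (cintegral mu (fun=> 0))) -cintegralZ; last exact: cint0.
by congr cintegral; apply/funext => x; rewrite mul0r.
Qed.

Lemma cintegralB f g : cint f -> cint g ->
  cintegral mu (fun x => f x - g x) = cintegral mu f - cintegral mu g.
Proof.
move=> fi gi; rewrite (_ : (fun x => _) = (fun x => f x + (-1) * g x)).
  by rewrite cintegralD// ?cintegralZ ?mulN1r//; exact: cintZ.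
by apply/funext => x; rewrite mulN1r.
Qed.

Lemma cintegral_conj f : cint f ->
  cintegral mu (fun x => (f x)^*) = (cintegral mu f)^*.
Proof.
move=> fi; rewrite /cintegral.
under eq_Rintegral do rewrite Re_conj.
under [X in _ +i* X]eq_Rintegral do rewrite Im_conj -mulN1r.
rewrite RintegralZl//; last exact: cint_Im.
by rewrite conjE mulN1r.
Qed.

Lemma cintegral_sum I (r : seq I) (F : I -> T -> R[i]) :
  (forall i, cint (F i)) ->
  cintegral mu (fun x => \sum_(i <- r) F i x) = \sum_(i <- r) cintegral mu (F i).
Proof.
move=> h; elim: r => [|i r IH].
  by under eq_fun do rewrite big_nil; rewrite big_nil cintegral0.
under eq_fun do rewrite big_cons.
by rewrite big_cons cintegralD// ?IH//; exact: cint_sum.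
Qed.

Lemma Re_cintegral f : complex.Re (cintegral mu f) = Rintegral mu setT (fun x => complex.Re (f x)).
Proof. by []. Qed.

(* Rotate the integral onto the positive axis. *)
Lemma normc_cintegral_le f : cint f ->
  normc (cintegral mu f) <= Rintegral mu setT (fun x => normc (f x)).
Proof.
move=> fi; set I := cintegral mu f.
have [I0|I0] := eqVneq I 0.
  by rewrite I0 normc0; apply: Rintegral_ge0 => x _; exact: normc_ge0.
have nI : 0 < normc I by rewrite normc_gt0.
have : complex.Re (cintegral mu (fun x => I^* * f x)) = normc I ^+ 2.
  by rewrite cintegralZ// mulrC mulr_conj.
rewrite Re_cintegral expr2 => e.
rewrite -(ler_pM2l nI) -e -RintegralZl//; last by case: fi.
apply: le_Rintegral => //.
- exact: cint_Re (cintZ _ fi).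
- by apply: integrable_EFinZ; case: fi.
- move=> x _; apply: le_trans (ler_norm _) _; apply: le_trans (normr_Re_le _) _.
  by rewrite normcM normc_conj.
Qed.

End complex_integral.

(** Optimal choice t = p / a. If a = 0 and p > 0, the large value t = (b + 1) / p already gives a
    contradiction. *)
Lemma sq_le_of_param (R : realFieldType) (p a b : R) : 0 <= p -> 0 <= a -> 0 <= b ->
  (forall t, 0 < t -> 2 * p <= t * a + t^-1 * b) -> p ^+ 2 <= a * b.
Proof.
rewrite le_eqVlt => /predU1P[<-|p0] a0 b0 H; first by rewrite expr0n mulr_ge0.
move: a0; rewrite le_eqVlt => /predU1P[a0|a0].
  have := H ((b + 1) / p) ltac:(by rewrite divr_gt0// ltr_wpDl).
  rewrite -a0 mulr0 add0r mul0r invf_div -mulrA.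
  have : b / (b + 1) < 1 by rewrite ltr_pdivrMr ?ltr_wpDl// mul1r ltrDl.
  rewrite [_^-1 * b]mulrC; nra.
have := H (p / a) ltac:(by rewrite divr_gt0).
rewrite divfK ?gt_eqF// invf_div => h.
have : p <= a / p * b by lra.
by rewrite mulrAC ler_pdivlMr// expr2.
Qed.

Section L2.
Context d (T : measurableType d) (R : realType).
Variable mu : {measure set T -> \bar R}.
Implicit Types (f g : T -> R[i]).

(** [Rintegral] sends an infinite integral to 0, so this is the squared norm only under [L2]. *)
Definition N2 f : R := Rintegral mu setT (fun x => normc (f x) ^+ 2).

Lemma N2_ge0 f : 0 <= N2 f.
Proof. by apply: Rintegral_ge0 => x _; rewrite exprn_ge0 ?normc_ge0. Qed.

Lemma cLnorm2E f : cLnorm mu 2%:E f = ((\int[mu]_x (normc (f x) ^+ 2)%:E) `^ 2^-1)%E.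
Proof.
rewrite /cLnorm unlock; congr (_ `^ _)%E; apply: eq_integral => x _.
by rewrite abse_EFin ger0_norm ?normc_ge0// poweR_EFin powR_mulrn ?normc_ge0.
Qed.

Lemma L2P f : L2 mu f <-> measurable_fun setT f /\
  mu.-integrable setT (EFin \o (fun x => normc (f x) ^+ 2)).
Proof.
have eqi : (\int[mu]_x `|(EFin \o (fun x => (normc (f x) ^+ 2)%R)) x|)%E =
    (\int[mu]_x (normc (f x) ^+ 2)%:E)%E.
  by apply: eq_integral => x _ /=; rewrite ger0_norm// exprn_ge0 ?normc_ge0.
split=> [[mf fi]|[mf /integrableP[_ fi]]]; split=> //.
  apply/integrableP; split.
    by apply/measurable_EFinP; apply: measurable_funX; exact: mfun_normc.
  rewrite eqi; move: fi; rewrite cLnorm2E.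
  by apply: lty_poweRy; rewrite invr_eq0 pnatr_eq0.
by rewrite cLnorm2E; apply: poweR_lty; rewrite -eqi.
Qed.

Lemma L2_m f : L2 mu f -> measurable_fun setT f.
Proof. by case. Qed.

Lemma L2_int f : L2 mu f -> mu.-integrable setT (EFin \o (fun x => normc (f x) ^+ 2)).
Proof. by move/L2P => []. Qed.

Lemma N2E f : L2 mu f -> (\int[mu]_x (normc (f x) ^+ 2)%:E)%E = (N2 f)%:E.
Proof.
move=> /L2_int fi; rewrite /N2 /Rintegral fineK//.
exact: (integrable_fin_num measurableT fi).
Qed.

Definition nrm f : R := Num.sqrt (N2 f).

Lemma nrm_ge0 f : 0 <= nrm f.
Proof. exact: sqrtr_ge0. Qed.

Lemma sqr_nrm f : nrm f ^+ 2 = N2 f.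
Proof. by rewrite sqr_sqrtr// N2_ge0. Qed.

Lemma cLnorm2_nrm f : L2 mu f -> cLnorm mu 2%:E f = (nrm f)%:E.
Proof.
by move=> f2; rewrite cLnorm2E N2E// poweR_EFin powR12_sqrt// N2_ge0.
Qed.

Lemma L2_le f (g : T -> R) : measurable_fun setT f ->
  mu.-integrable setT (EFin \o g) -> (forall x, normc (f x) ^+ 2 <= g x) -> L2 mu f.
Proof.
move=> mf gi fg; apply/L2P; split=> //; apply: le_integrable gi => //.
  by apply/measurable_EFinP; apply: measurable_funX; exact: mfun_normc.
move=> x _ /=; rewrite lee_fin ger0_norm ?exprn_ge0 ?normc_ge0//.
exact: le_trans (fg x) (ler_norm _).
Qed.

Lemma L2D f g : L2 mu f -> L2 mu g -> L2 mu (fun x => f x + g x).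
Proof.
move=> hf hg.
apply: (@L2_le _ (fun x => 2 * (normc (f x) ^+ 2 + normc (g x) ^+ 2))).
- by apply: mfunD; [exact: L2_m|exact: L2_m].
- exact: integrable_EFinZ (integrable_EFinD (L2_int hf) (L2_int hg)).
- move=> x; apply: (@le_trans _ _ ((normc (f x) + normc (g x)) ^+ 2)).
    by rewrite lerXn2r ?nnegrE ?addr_ge0 ?normc_ge0// le_normcD.
  have := sqr_ge0 (normc (f x) - normc (g x)); rewrite sqrrB sqrrD; lra.
Qed.

Lemma L2Z f (k : R[i]) : L2 mu f -> L2 mu (fun x => k * f x).
Proof.
move=> hf; apply: (@L2_le _ (fun x => normc k ^+ 2 * normc (f x) ^+ 2)).
- exact: mfunZ (L2_m hf).
- exact: (integrable_EFinZ _ (L2_int hf)).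
- by move=> x; rewrite normcM exprMn.
Qed.

Lemma L2B f g : L2 mu f -> L2 mu g -> L2 mu (fun x => f x - g x).
Proof.
move=> hf hg; rewrite (_ : (fun x => _) = (fun x => f x + (-1) * g x)).
  by apply: L2D => //; exact: L2Z.
by apply/funext => x; rewrite mulN1r.
Qed.

Lemma L2_0 : L2 mu (fun=> 0).
Proof.
apply/L2P; split; first exact: mfun_cst.
rewrite /comp normc0 expr0n; exact: integrable0.
Qed.

Lemma L2_conj f : L2 mu f -> L2 mu (fun x => (f x)^*).
Proof.
move=> hf; apply: (L2_le (mfun_conj (L2_m hf)) (L2_int hf)) => x.
by rewrite normc_conj.
Qed.

Lemma L2_sum I (r : seq I) (F : I -> T -> R[i]) :
  (forall i, L2 mu (F i)) -> L2 mu (fun x => \sum_(i <- r) F i x).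
Proof.
move=> h; elim: r => [|i r IH].
  by under eq_fun do rewrite big_nil; exact: L2_0.
by under eq_fun do rewrite big_cons; exact: L2D.
Qed.

Lemma cint_mulL2 f g : L2 mu f -> L2 mu g -> cint mu (fun x => f x * g x).
Proof.
move=> hf hg; apply: (@cint_le _ _ _ _ _ (fun x => normc (f x) ^+ 2 + normc (g x) ^+ 2)).
- by apply: mfunM; exact: L2_m.
- exact: (integrable_EFinD (L2_int hf) (L2_int hg)).
- move=> x; rewrite normcM; have := sqr_ge0 (normc (f x) - normc (g x)).
  have := mulr_ge0 (normc_ge0 (f x)) (normc_ge0 (g x)); rewrite sqrrB; lra.
Qed.

Local Notation ip := (L2inner mu).

Lemma cint_ip f g : L2 mu f -> L2 mu g -> cint mu (fun x => f x * (g x)^*).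
Proof. by move=> hf hg; apply: cint_mulL2 => //; exact: L2_conj. Qed.

Lemma ipDl f g h : L2 mu f -> L2 mu g -> L2 mu h ->
  ip (fun x => f x + g x) h = ip f h + ip g h.
Proof.
move=> hf hg hh; rewrite /L2inner -cintegralD; try exact: cint_ip.
by under eq_fun do rewrite mulrDl.
Qed.

Lemma ipZl f g (k : R[i]) : L2 mu f -> L2 mu g ->
  ip (fun x => k * f x) g = k * ip f g.
Proof.
move=> hf hg; rewrite /L2inner -cintegralZ; last exact: cint_ip.
by under eq_fun do rewrite -mulrA.
Qed.

Lemma ip_conj f g : L2 mu f -> L2 mu g -> ip g f = (ip f g)^*.
Proof.
move=> hf hg; rewrite /L2inner -cintegral_conj; last exact: cint_ip.
by under [in RHS]eq_fun do rewrite rmorphM/= conjCK mulrC.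
Qed.

Lemma ipBl f g h : L2 mu f -> L2 mu g -> L2 mu h ->
  ip (fun x => f x - g x) h = ip f h - ip g h.
Proof.
move=> hf hg hh; rewrite /L2inner -cintegralB; try exact: cint_ip.
by under eq_fun do rewrite mulrBl.
Qed.

Lemma ipDr f g h : L2 mu f -> L2 mu g -> L2 mu h ->
  ip h (fun x => f x + g x) = ip h f + ip h g.
Proof.
move=> hf hg hh; rewrite ip_conj ?ipDl ?rmorphD//=; last exact: L2D.
by rewrite -!ip_conj.
Qed.

Lemma ipBr f g h : L2 mu f -> L2 mu g -> L2 mu h ->
  ip h (fun x => f x - g x) = ip h f - ip h g.
Proof.
move=> hf hg hh; rewrite ip_conj ?ipBl ?rmorphB//=; last exact: L2B.
by rewrite -!ip_conj.
Qed.

Lemma ipZr f g (k : R[i]) : L2 mu f -> L2 mu g ->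
  ip g (fun x => k * f x) = k^* * ip g f.
Proof.
move=> hf hg; rewrite ip_conj ?ipZl ?rmorphM//=; last exact: L2Z.
by rewrite -ip_conj.
Qed.

Lemma ip_suml I (r : seq I) (F : I -> T -> R[i]) g :
  (forall i, L2 mu (F i)) -> L2 mu g ->
  ip (fun x => \sum_(i <- r) F i x) g = \sum_(i <- r) ip (F i) g.
Proof.
move=> hF hg; rewrite /L2inner -cintegral_sum; last by move=> i; exact: cint_ip.
by under eq_fun do rewrite mulr_suml.
Qed.

Lemma ipxx f : ip f f = (N2 f)%:C.
Proof.
rewrite /L2inner; under eq_fun do rewrite mulr_conj.
by rewrite /cintegral /= Rintegral_cst// mul0r.
Qed.

Lemma N2D f g : L2 mu f -> L2 mu g ->
  N2 (fun x => f x + g x) = N2 f + N2 g + 2 * complex.Re (ip f g).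
Proof.
move=> hf hg; rewrite /L2inner Re_cintegral /N2.
rewrite -RintegralZl//; last exact: cint_Re (cint_ip hf hg).
have i1 := L2_int hf; have i2 := L2_int hg.
have i3 := integrable_EFinZ 2 (cint_Re (cint_ip hf hg)).
rewrite -RintegralD// -RintegralD//; last exact: (integrable_EFinD i1 i2).
by apply: eq_Rintegral => x _; rewrite sqr_normcD.
Qed.

Lemma N2Z f (k : R[i]) : L2 mu f -> N2 (fun x => k * f x) = normc k ^+ 2 * N2 f.
Proof.
move=> hf; rewrite /N2 -RintegralZl//; last exact: L2_int.
by apply: eq_Rintegral => x _; rewrite normcM exprMn.
Qed.

Lemma N2B f g : L2 mu f -> L2 mu g ->
  N2 (fun x => f x - g x) = N2 f + N2 g - 2 * complex.Re (ip f g).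
Proof.
move=> hf hg; rewrite (_ : (fun x => _) = (fun x => f x + (-1) * g x)).
  rewrite N2D//; last exact: L2Z.
  by rewrite N2Z// ipZr// normcN normc1 expr1n mul1r rmorphN rmorph1 mulN1r ReN; ring.
by apply/funext => x; rewrite mulN1r.
Qed.

Lemma parallelogram f g : L2 mu f -> L2 mu g ->
  N2 (fun x => f x - g x) + N2 (fun x => f x + g x) = 2 * N2 f + 2 * N2 g.
Proof. by move=> hf hg; rewrite (N2D hf hg) (N2B hf hg); ring. Qed.

(** Integrate 2 |f g| <= t |f|^2 + t^-1 |g|^2 and optimize over t. *)
Lemma int_normcM_le f g : L2 mu f -> L2 mu g ->
  Rintegral mu setT (fun x => normc (f x * g x)) <= nrm f * nrm g.
Proof.
move=> hf hg; set p := Rintegral _ _ _.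
have p0 : 0 <= p by apply: Rintegral_ge0 => x _; exact: normc_ge0.
rewrite -(@ler_pXn2r _ 2) ?nnegrE ?mulr_ge0 ?nrm_ge0//.
rewrite exprMn !sqr_nrm; apply: sq_le_of_param; rewrite ?N2_ge0// => t t0.
have i1 := integrable_EFinZ t (L2_int hf).
have i2 := integrable_EFinZ t^-1 (L2_int hg).
rewrite /p /N2 -!RintegralZl//; [|exact: L2_int|exact: L2_int|by case: (cint_mulL2 hf hg)].
rewrite -RintegralD//; apply: le_Rintegral => //.
- by apply: integrable_EFinZ; case: (cint_mulL2 hf hg).
- exact: (integrable_EFinD i1 i2).
move=> x _; rewrite normcM.
have st : 0 < Num.sqrt t by rewrite sqrtr_gt0.
have -> : t = Num.sqrt t ^+ 2 by rewrite sqr_sqrtr// ltW.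
have := sqr_ge0 (Num.sqrt t * normc (f x) - (Num.sqrt t)^-1 * normc (g x)).
have -> : forall s a b : R, 0 < s -> (s * a - s^-1 * b) ^+ 2 =
    s ^+ 2 * a ^+ 2 + s ^- 2 * b ^+ 2 - 2 * (a * b).
  by move=> s a b s0; field; rewrite gt_eqF.
  by rewrite subr_ge0.
exact: st.
Qed.

Lemma cauchy_schwarz f g : L2 mu f -> L2 mu g -> normc (ip f g) <= nrm f * nrm g.
Proof.
move=> hf hg; apply: le_trans (normc_cintegral_le (cint_ip hf hg)) _.
apply: le_trans (int_normcM_le hf (L2_conj hg)) _.
rewrite /nrm /N2; under [X in _ * Num.sqrt X]eq_Rintegral do rewrite normc_conj.
exact: lexx.
Qed.

Lemma nrmD f g : L2 mu f -> L2 mu g -> nrm (fun x => f x + g x) <= nrm f + nrm g.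
Proof.
move=> hf hg; rewrite -(@ler_pXn2r _ 2) ?nnegrE ?addr_ge0 ?nrm_ge0//.
rewrite sqr_nrm N2D// sqrrD !sqr_nrm.
have := cauchy_schwarz hf hg; have := normr_Re_le (ip f g).
have := ler_norm (complex.Re (ip f g)); lra.
Qed.

Lemma nrmZ f (k : R[i]) : L2 mu f -> nrm (fun x => k * f x) = normc k * nrm f.
Proof.
by move=> hf; rewrite /nrm N2Z// sqrtrM ?exprn_ge0 ?normc_ge0// sqrtr_sqr ger0_norm ?normc_ge0.
Qed.

Lemma nrm_distC f g : nrm (fun x => f x - g x) = nrm (fun x => g x - f x).
Proof. by rewrite /nrm /N2; under eq_Rintegral do rewrite normc_distC. Qed.

Lemma nrm_triangle f g h : L2 mu f -> L2 mu g -> L2 mu h ->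
  nrm (fun x => f x - h x) <= nrm (fun x => f x - g x) + nrm (fun x => g x - h x).
Proof.
move=> hf hg hh; apply: le_trans (nrmD (L2B hf hg) (L2B hg hh)).
by rewrite le_eqVlt; apply/orP; left; apply/eqP; congr nrm; apply/funext => x; ring.
Qed.

End L2.

Lemma le_of_geometric (R : realType) (a b c : R) :
  (forall i, a <= b + c * 2^-1 ^+ i) -> a <= b.
Proof.
move=> H; have h : (fun i => b + c * 2^-1 ^+ i) @ \oo --> b.
  rewrite -[X in _ --> X]addr0; apply: cvgD; first exact: cvg_cst.
  by apply: cvg_geometric; rewrite ger0_norm ?invr_ge0// invf_lt1// ltr1n.
by rewrite -(cvg_lim _ h)//; apply: limr_ge; [exact/cvgP/h|exact: nearW].
Qed.

(** * Completeness of L^2 and least-norm points of convex sets *)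

Section L2_completeness.
Context d (T : measurableType d) (R : realType).
Variable mu : {measure set T -> \bar R}.
Hypothesis mufin : (mu setT < +oo)%E.
Implicit Types (f g : T -> R[i]).
Local Notation nrm := (nrm mu).
Local Notation N2 := (N2 mu).

Lemma integrable_cst_fin (k : R) : mu.-integrable setT (EFin \o (fun=> k)).
Proof.
apply/integrableP; split; first exact: measurable_cst.
by rewrite integral_cst//= lte_mul_pinfty.
Qed.

Lemma L2_cst (k : R[i]) : L2 mu (fun=> k).
Proof.
apply/L2P; split; first exact: mfun_cst.
exact: integrable_cst_fin.
Qed.

Lemma L2_cint f : L2 mu f -> cint mu f.
Proof.
move=> hf; have := cint_mulL2 hf (L2_cst 1).
by under eq_fun do rewrite mulr1.
Qed.

Lemma int_normc_le f : L2 mu f ->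
  Rintegral mu setT (fun x => normc (f x)) <= nrm f * nrm (fun=> 1).
Proof.
move=> hf; have := int_normcM_le hf (L2_cst 1).
by under eq_Rintegral do rewrite mulr1.
Qed.

(* Summability of the increments in L^1 gives pointwise convergence off a null
   set, and Fatou's lemma upgrades it to convergence in L^2. *)
Lemma L2_complete (F : nat -> T -> R[i]) : (forall k, L2 mu (F k)) ->
  (forall k i j, (k <= i)%N -> (k <= j)%N ->
     nrm (fun x => F i x - F j x) <= 2^-1 ^+ k) ->
  exists f, L2 mu f /\ forall k, nrm (fun x => F k x - f x) <= 2^-1 ^+ k.
Proof.
move=> F2 Fc.
pose u k x := normc (F k.+1 x - F k x).
have mu_ k : measurable_fun setT (fun x => (u k x)%:E).
  by apply/measurable_EFinP; apply: mfun_normc; apply: mfunB; exact: L2_m (F2 _).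
have u0 k x : (0 <= (u k x)%:E)%E by rewrite lee_fin normc_ge0.
pose S x := (\sum_(k <oo) (u k x)%:E)%E.
have mS : measurable_fun setT S.
  by apply: ge0_emeasurable_sum => // k x _ _; exact: u0.
have Sfin : mu.-integrable setT S.
  apply/integrableP; split=> //.
  have S0 x : (0 <= S x)%E by apply: nneseries_ge0 => k _ _; exact: u0.
  under eq_integral do rewrite gee0_abs//.
  rewrite /S integral_nneseries//.
  apply: (@le_lt_trans _ _ (\sum_(k <oo) (2^-1 ^+ k * nrm (fun=> 1))%:E)%E).
    apply: lee_nneseries => k _; first by move=> _; exact: integral_ge0.
    have uk := L2_cint (L2B (F2 k.+1) (F2 k)).
    have -> : (\int[mu]_x (u k x)%:E)%E = (Rintegral mu setT (u k))%:E.
      by rewrite /Rintegral fineK//; case: uk => _ /integrable_fin_num; exact.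
    rewrite lee_fin; apply: le_trans (int_normc_le (L2B (F2 k.+1) (F2 k))) _.
    by rewrite ler_wpM2r ?nrm_ge0// Fc// leqnSn.
  have cg : (series (fun k => nrm (fun=> 1) * 2^-1 ^+ k : R)) @ \oo -->
    nrm (fun=> 1) * (1 - 2^-1)^-1.
    by apply: cvg_geometric_series; rewrite ger0_norm ?invr_ge0// invf_lt1// ltr1n.
  under eq_eseriesr do rewrite mulrC.
  have /cvg_lim -> // : (fun n => \sum_(0 <= k < n) (nrm (fun=> 1) * 2^-1 ^+ k)%:E)%E @ \oo -->
      (nrm (fun=> 1) * (1 - 2^-1)^-1)%:E.
    under eq_fun do rewrite sumEFin.
    by apply: cvg_EFin => //; exact: nearW.
  by rewrite ltry.
pose A := [set x | (S x < +oo)%E].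
have mA : measurable A.
  rewrite -[A]setTI; apply: emeasurable_fun_infty_o => //.
(* Replacing the sequence by 0 off A makes it converge everywhere, so the limit is measurable
   without discarding a null set. *)
pose H k x := if x \in A then F k x else 0.
have mH k : measurable_fun setT (H k).
  rewrite (_ : H k = (fun x => (\1_A x)%:C * F k x)).
    by apply: mfunM; [apply: mfun_real; exact: measurable_indic|exact: L2_m (F2 k)].
  by apply/funext => x; rewrite /H indicE; case: (x \in A); rewrite ?rmorph1 ?rmorph0 ?mul1r ?mul0r.
(* g stands for the real or the imaginary part, whose increments are dominated by the summable
   [u k x]. *)
have cvA x (g : R[i] -> R) : (forall a b, g (a - b) = g a - g b) -> (forall a, `|g a| <= normc a) ->
    cvgn (fun k => g (H k x)).
  move=> gB gle; rewrite /H; have [xA|xA] := boolP (x \in A); last exact: is_cvg_cst.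
  have {xA} Sx : (S x < +oo)%E by rewrite inE in xA.
  have cu : cvgn (series (fun k => u k x)).
    apply: (@nondecreasing_is_cvgn R).
      apply/nondecreasing_seqP => n.
      by rewrite seriesSr lerDl normc_ge0.
    exists (fine (S x)) => _ [n _ <-]; rewrite -lee_fin fineK; last first.
      by rewrite ge0_fin_numE// nneseries_ge0// => k _ _; exact: u0.
    rewrite /series/= -sumEFin; apply: nneseries_lim_ge => k _ _; exact: u0.
  have : cvgn (series (telescope (fun k => g (F k x)))).
    apply: normed_cvg; apply: series_le_cvg cu.
    - by move=> n /=; exact: normr_ge0.
    - by move=> n /=; exact: normc_ge0.
    - by move=> n /=; rewrite /telescope/= -gB.
  rewrite telescopeK => h.
  have -> : (fun k => g (F k x)) = (fun k => (g (F k x) - g (F 0%N x)) + g (F 0%N x)).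
    by apply/funext => k; rewrite subrK.
  by apply: is_cvgD => //; exact: is_cvg_cst.
have cR x := @cvA x (@complex.Re R) ltac:(by move=> a b; rewrite ReD ReN) (@normr_Re_le R).
have ImN (a : R[i]) : complex.Im (- a) = - complex.Im a by case: a.
have cI x := @cvA x (@complex.Im R) ltac:(by move=> a b; rewrite ImD ImN) (@normr_Im_le R).
pose f x : R[i] := limn (fun k => complex.Re (H k x)) +i* limn (fun k => complex.Im (H k x)).
have mf : measurable_fun setT f.
  apply/measurable_fun_complexP; split.
    by apply: (@measurable_fun_cvg _ _ _ _ (fun k x => complex.Re (H k x))) => [k|x _];
      [exact: mfun_Re|exact: cR].
  by apply: (@measurable_fun_cvg _ _ _ _ (fun k x => complex.Im (H k x))) => [k|x _];
    [exact: mfun_Im|exact: cI].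
have muA : mu (~` A) = 0.
  have [N [mN N0 NS]] := integrable_ae measurableT Sfin.
  apply: (subset_measure0 _ mN) => //; first exact: measurableC.
  move=> x /= Ax; apply: NS => /= h; apply: Ax; rewrite /A/=.
  by have := h I; rewrite ge0_fin_numE// nneseries_ge0// => k _ _; exact: u0.
have key j : (\int[mu]_x (normc (F j x - f x) ^+ 2)%:E <= (2^-1 ^+ j ^+ 2)%:E)%E.
  have mg i : measurable_fun setT (fun x => (normc (F j x - H i x) ^+ 2)%:E).
    apply/measurable_EFinP; apply: measurable_funX; apply: mfun_normc.
    by apply: mfunB => //; exact: L2_m (F2 j).
  have fat := fatou mu measurableT mg (fun i x _ => ltac:(by rewrite lee_fin exprn_ge0 ?normc_ge0)).
  have e1 x : (normc (F j x - f x) ^+ 2)%:E = limn_einf (fun i => (normc (F j x - H i x) ^+ 2)%:E).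
    have cv : (fun i => (normc (F j x - H i x) ^+ 2)%:E) @ \oo --> (normc (F j x - f x) ^+ 2)%:E.
      apply: cvg_EFin; first exact: nearW.
      under eq_fun do rewrite /= sqr_normcE !(ReD, ImD, ReN, ImN).
      rewrite sqr_normcE !(ReD, ImD, ReN, ImN) /=.
      apply: cvgD; rewrite expr2; under eq_fun do rewrite expr2.
        by apply: cvgM; apply: cvgB; [exact: cvg_cst|exact: cR|exact: cvg_cst|exact: cR].
      by apply: cvgM; apply: cvgB; [exact: cvg_cst|exact: cI|exact: cvg_cst|exact: cI].
    by rewrite is_cvg_limn_einfE; [rewrite (cvg_lim _ cv)|exact/cvgP/cv].
  under eq_integral do rewrite e1.
  apply: le_trans fat _.
  rewrite limn_einf_lim; apply: lime_le; first exact: is_cvg_einfs.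
  (* The index [maxn m j] is at least m, as the infimum requires, and at least j, so that the Cauchy
     hypothesis of rank j applies. *)
  apply: nearW => m; apply: (@le_trans _ _ (\int[mu]_x (normc (F j x - H (maxn m j) x) ^+ 2)%:E)%E).
    by apply: ereal_inf_lbound; exists (maxn m j) => //=; exact: leq_maxl.
  have -> : (\int[mu]_x (normc (F j x - H (maxn m j) x) ^+ 2)%:E)%E =
      (\int[mu]_x (normc (F j x - F (maxn m j) x) ^+ 2)%:E)%E.
    apply: ge0_ae_eq_integral => //.
    - apply/measurable_EFinP; apply: measurable_funX; apply: mfun_normc.
      by apply: mfunB; exact: L2_m (F2 _).
    - by move=> x _; rewrite lee_fin exprn_ge0 ?normc_ge0.
    - by move=> x _; rewrite lee_fin exprn_ge0 ?normc_ge0.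
    exists (~` A); split => //; first exact: measurableC.
    move=> x /= h Ax; apply: h => _; rewrite /H ifT//; exact: mem_set.
  rewrite N2E; last exact: L2B.
  rewrite lee_fin -sqr_nrm lerXn2r ?nnegrE ?nrm_ge0 ?exprn_ge0 ?invr_ge0//.
  by apply: Fc => //; exact: leq_maxr.
have L2d j : L2 mu (fun x => F j x - f x).
  apply/L2P; split; first by apply: mfunB => //; exact: L2_m (F2 j).
  apply/integrableP; split.
    apply/measurable_EFinP; apply: measurable_funX; apply: mfun_normc.
    by apply: mfunB => //; exact: L2_m (F2 j).
  apply: le_lt_trans (ltry (2^-1 ^+ j ^+ 2)); apply: le_trans (key j).
  rewrite le_eqVlt; apply/orP; left; apply/eqP; apply: eq_integral => x _ /=.
  by rewrite ger0_norm ?exprn_ge0 ?normc_ge0.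
exists f; split.
  have := L2B (F2 0%N) (L2d 0%N); congr L2; apply/funext => x; ring.
move=> j; rewrite -(@ler_pXn2r _ 2) ?nnegrE ?nrm_ge0 ?exprn_ge0 ?invr_ge0//.
by rewrite sqr_nrm -lee_fin -N2E//.
Qed.

Definition is_convex (C : set (T -> R[i])) := forall x y (t : R), C x -> C y -> 0 <= t <= 1 ->
  C (fun p => (1 - t)%:C * x p + t%:C * y p).

(* Cantor's intersection argument: near-minimizers of the norm form a Cauchy
   sequence by the parallelogram identity. *)
Lemma nested_convex (C : nat -> set (T -> R[i])) (M : R) :
  (forall k, C k `<=` L2 mu) -> (forall k, is_convex (C k)) ->
  (forall i j, (i <= j)%N -> C j `<=` C i) ->
  (forall k, exists x, C k x /\ N2 x <= M) ->
  exists (F : nat -> T -> R[i]) (D : R) f, [/\ L2 mu f,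
     forall k, C k (F k) /\ N2 (F k) <= D + (2^-1 ^+ k) ^+ 2,
     forall k, nrm (fun x => F k x - f x) <= 2^-1 ^+ k &
     forall z, (forall k, C k z) -> D <= N2 z].
Proof.
move=> CL2 Cconv Cdec Cne.
pose dd k := inf (N2 @` C k).
have N2lb k : has_inf (N2 @` C k).
  split; first by have [x [Cx _]] := Cne k; exists (N2 x), x.
  by exists 0 => _ [x _ <-]; exact: N2_ge0.
have dle k x : C k x -> dd k <= N2 x.
  by move=> Cx; apply: ge_inf; [case: (N2lb k)|exists x].
have dM k : dd k <= M by have [x [Cx h]] := Cne k; exact: le_trans (dle k x Cx) h.
have sD : has_sup (range dd).
  by split; [exists (dd 0%N), 0%N|exists M => _ [k _ <-]; exact: dM].
pose D := sup (range dd).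
have dD k : dd k <= D by apply: sup_upper_bound => //; exists k.
(* The parallelogram identity will bound the squared distance by 2 (D + eta) + 2 (D + eta) - 4 (D -
   eta) = 8 eta, hence the 8. *)
pose eta k : R := (2^-1 ^+ k) ^+ 2 / 8.
have eta0 k : 0 < eta k by rewrite divr_gt0// exprn_gt0// exprn_gt0// invr_gt0.
have etale i k : (k <= i)%N -> eta i <= eta k.
  move=> ki; rewrite /eta ler_wpM2r ?invr_ge0// lerXn2r ?nnegrE ?exprn_ge0 ?invr_ge0//.
  by rewrite ler_wiXn2l ?invr_ge0// invf_le1// ler1n.
(* The first component is a rank beyond k at which the infimum is already close to its limit D; the
   second is a near-minimizer there. *)
have exF k : exists p : nat * (T -> R[i]),
    [/\ (k <= p.1)%N, C p.1 p.2, D - eta k < dd p.1 & N2 p.2 < D + eta k].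
  have [_ [K _ <-] hK] := sup_adherent (eta0 k) sD.
  have dmono i j : (i <= j)%N -> dd i <= dd j.
    move=> ij; apply: lb_le_inf; first by case: (N2lb j).
    by move=> _ [x Cx <-]; apply: dle; exact: Cdec ij _ Cx.
  have [_ [x Cx <-] hx] := inf_adherent (eta0 k) (N2lb (maxn k K)).
  exists (maxn k K, x); split=> //=; first exact: leq_maxl.
    apply: lt_le_trans hK _; exact/dmono/leq_maxr.
  by apply: lt_le_trans hx _; rewrite lerD2r; exact: dD.
have [P HP] := choice exF.
pose F k := (P k).2.
have FC k i : (k <= i)%N -> C k (F i).
  by move=> ki; have [h1 h2 _ _] := HP i; exact: Cdec (leq_trans ki h1) _ h2.
have F2 k : L2 mu (F k) by apply: CL2; exact: (FC k k).
have Fcau k i j : (k <= i)%N -> (k <= j)%N -> nrm (fun x => F i x - F j x) <= 2^-1 ^+ k.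
  move=> ki kj; rewrite -(@ler_pXn2r _ 2) ?nnegrE ?nrm_ge0 ?exprn_ge0 ?invr_ge0//.
  rewrite sqr_nrm.
  have [hi1 hi2 hi3 hi4] := HP i; have [hj1 hj2 hj3 hj4] := HP j.
  have par := parallelogram (F2 i) (F2 j).
  pose mid := fun p => (1 - 2^-1)%:C * F i p + (2^-1)%:C * F j p.
  have hmid : D - eta k < N2 mid.
    have t01 : 0 <= (2^-1 : R) <= 1 by apply/andP; split; lra.
    (* Both points lie in the set of smaller rank, hence so does their midpoint. *)
    have [PP|PP] := leqP (P i).1 (P j).1.
      have Cm := Cconv _ _ _ _ hi2 (Cdec _ _ PP _ hj2) t01.
      apply: lt_le_trans (dle _ _ Cm); apply: le_lt_trans hi3.
      by rewrite lerD2l lerN2 etale.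
    have Cm := Cconv _ _ _ _ (Cdec _ _ (ltnW PP) _ hi2) hj2 t01.
    apply: lt_le_trans (dle _ _ Cm); apply: le_lt_trans hj3.
    by rewrite lerD2l lerN2 etale.
  have e1 : N2 (fun x => F i x + F j x) = 4 * N2 mid.
    have -> : mid = (fun x => (2^-1)%:C * (F i x + F j x)).
      apply/funext => x; rewrite /mid mulrDr; congr (_%:C * _ + _); lra.
    rewrite N2Z; last exact: L2D.
    by rewrite normc_real ger0_norm ?invr_ge0//; field.
  have := etale _ _ ki; have := etale _ _ kj; move: par hi4 hj4 hmid; rewrite e1 -/(F i) -/(F j).
  by rewrite /eta; set p := 2^-1 ^+ k; lra.
have [f [f2 hf]] := L2_complete F2 Fcau.
exists F, D, f; split=> //.
- move=> k; split; first exact: FC.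
  have [_ _ _ h] := HP k; apply: le_trans (ltW h) _.
  rewrite lerD2l /eta ler_pdivrMr// ler_peMr ?sqr_ge0// ler1n//.
- move=> z Cz; apply: ge_sup; first by case: sD.
  by move=> _ [k _ <-]; apply: dle.
Qed.

(** f is the least-norm point of the closure of C, which enters only through the approximating
    sequence F; the last clause is the first-order condition for moving from f towards y. *)
Lemma min_norm_convex (C : set (T -> R[i])) : C !=set0 -> C `<=` L2 mu -> is_convex C ->
  exists (F : nat -> T -> R[i]) f, [/\ L2 mu f, forall k, C (F k),
     forall k, nrm (fun x => F k x - f x) <= 2^-1 ^+ k &
     forall y, C y -> 0 <= complex.Re (L2inner mu (fun x => y x - f x) f)].
Proof.
move=> [x0 Cx0] CL2 Cc.
have [F [D [f [f2 HF hf HD]]]] := @nested_convex (fun=> C) (N2 x0) (fun=> CL2) (fun=> Cc)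
  (fun i j _ => @subset_refl _ C) (fun=> ex_intro _ x0 (conj Cx0 (lexx _))).
exists F, f; split=> // [k|y Cy]; first by have [] := HF k.
have F2 k : L2 mu (F k) by apply: CL2; have [] := HF k.
have y2 := CL2 _ Cy.
have D0 : 0 <= D.
  rewrite leNgt; apply/negP => Dn.
  have : 0 <= D.
    apply: (@le_of_geometric R 0 D 1) => i; have [_ h] := HF i.
    apply: le_trans (le_trans (N2_ge0 mu (F i)) h) _; rewrite lerD2l mul1r.
    by rewrite expr2 ler_piMr ?exprn_ge0 ?invr_ge0// exprn_ile1 ?invr_ge0// invf_le1// ler1n.
  by rewrite leNgt Dn.
have fD : nrm f <= Num.sqrt D.
  apply: (@le_of_geometric R _ _ 2) => i; have [_ h] := HF i.
  have h1 : nrm (F i) <= Num.sqrt D + 2^-1 ^+ i.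
    rewrite -(@ler_pXn2r _ 2) ?nnegrE ?nrm_ge0 ?addr_ge0 ?sqrtr_ge0 ?exprn_ge0 ?invr_ge0//.
    rewrite sqr_nrm sqrrD sqr_sqrtr//; apply: le_trans h _.
    by rewrite lerD2r lerDl mulrn_wge0// mulr_ge0 ?sqrtr_ge0 ?exprn_ge0 ?invr_ge0.
  have h2 := hf i.
  have := nrm_triangle f2 (F2 i) (L2_0 mu).
  under [X in nrm X <= _]eq_fun do rewrite subr0.
  under [X in _ + nrm X]eq_fun do rewrite subr0.
  by rewrite nrm_distC; lra.
have step t : 0 < t <= 1 -> 0 <= 2 * complex.Re (L2inner mu (fun x => y x - f x) f) + t * N2 (fun
  x => y x - f x).
  move=> /andP[t0 t1].
  pose w x := f x + t%:C * (y x - f x).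
  have w2 : L2 mu w by apply: L2D => //; apply: L2Z; exact: L2B.
  have wD : Num.sqrt D <= nrm w.
    apply: (@le_of_geometric R _ _ 1) => i.
    (* f itself need not lie in C, so the point w of the segment is approximated by a point of C
       built from F i. *)
    pose v x := (1 - t)%:C * F i x + t%:C * y x.
    have Cv : C v by apply: Cc => //; [have [] := HF i|rewrite (ltW t0) t1].
    have v2 := CL2 _ Cv.
    have h1 : Num.sqrt D <= nrm v by rewrite ler_wsqrtr// HD.
    have h2 : nrm (fun x => v x - w x) <= 2^-1 ^+ i.
      have -> : (fun x => v x - w x) = (fun x => (1 - t)%:C * (F i x - f x)).
        by apply/funext => x; rewrite /v /w rmorphB/= rmorph1; ring.
      rewrite nrmZ; last exact: L2B.
      rewrite normc_real ger0_norm ?subr_ge0//; apply: le_trans (hf i).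
      by rewrite ler_piMl ?nrm_ge0// lerBlDl lerDr ltW.
    have := nrm_triangle v2 w2 (L2_0 mu).
    under [X in nrm X <= _]eq_fun do rewrite subr0.
    under [X in _ + nrm X]eq_fun do rewrite subr0.
    lra.
  have : N2 f <= N2 w.
    rewrite -!sqr_nrm lerXn2r ?nnegrE ?nrm_ge0//; exact: le_trans wD.
  rewrite /w N2D//; last by apply: L2Z; exact: L2B.
  rewrite N2Z; last exact: L2B.
  rewrite ipZr//; last exact: L2B.
  rewrite normc_real ger0_norm ?(ltW t0)// conj_real ReM (_ : complex.Im t%:C = 0)// (_ :
    complex.Re t%:C = t)// mul0r subr0.
  rewrite (ip_conj (L2B y2 f2) f2) Re_conj => h.
  have : 0 <= t * (2 * complex.Re (L2inner mu (fun x => y x - f x) f) + t * N2 (fun x => y x - f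
    x)) by lra.
  by rewrite pmulr_rge0.
set A := complex.Re _; set B := N2 (fun x => y x - f x) in step *.
have B0 : 0 <= B by exact: N2_ge0.
rewrite leNgt; apply/negP => An.
(* For this t, t B <= - A, so 2 A + t B <= A < 0 against [step]. *)
pose t := Num.min 1 (- A / (B + 1)).
have t0 : 0 < t by rewrite lt_min ltr01 divr_gt0// ?oppr_gt0// ltr_wpDl.
have t1 : t <= 1 by rewrite ge_min lexx.
have tB : t * B <= - A.
  have : t * (B + 1) <= - A by rewrite -ler_pdivlMr ?ltr_wpDl// ge_min lexx orbT.
  by rewrite mulrDr; lra.
have := step t ltac:(by rewrite t0 t1); rewrite -/A; lra.
Qed.

End L2_completeness.

Lemma measurable_fun_inv d (T : measurableType d) (R : realType) (f : T -> R) :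
  measurable_fun setT f -> (forall x, 0 <= f x) ->
  measurable_fun setT (fun x => (f x)^-1).
Proof.
move=> mf f0; under eq_fun do rewrite -powR_inv1//.
exact: (@measurableT_comp _ _ _ _ _ _ (@powR R ^~ (-1))).
Qed.

Lemma measurable_fun_ltr_nat d (T : measurableType d) (R : realType) (f g : T -> R) :
  measurable_fun setT f -> measurable_fun setT g ->
  measurable_fun setT (fun x => (f x < g x)%R%:R : R).
Proof.
move=> mf mg; rewrite (_ : (fun x => _) = \1_[set x | f x < g x]); last first.
  by apply/funext => x; rewrite indicE mem_setE.
apply: measurable_indic; rewrite -[X in measurable X]setTI.
have := measurable_fun_ltr mf mg => /(_ measurableT [set true] I).
by congr measurable; rewrite !setTI; apply/seteqP; split => x.
Qed.

(** * Gaussian integrals *)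

Section real_integrals.
Variable R : realType.
Local Notation mu := (@lebesgue_measure R).
Implicit Types (f g : R -> \bar R).

(** Checked on half-open intervals, which determine Lebesgue measure. *)
Lemma lebesgue_measure_translate (a : R) (A : set R) : measurable A ->
  mu ((fun x => x + a) @^-1` A) = mu A.
Proof.
move=> mA.
have mt : measurable_fun [set: R] (fun x : R => x + a : measurableTypeR R).
  by apply: measurable_funD => //; exact: measurable_cst.
have tE X : ocitv X -> mu X = mu ((fun x => x + a) @^-1` X).
  move=> [[b c]] _ <-.
  rewrite (_ : _ @^-1` _ = `]b - a, c - a]%classic); last first.
    by apply/seteqP; split=> x /=; rewrite !in_itv/= ltrBlDr lerBrDr.
  rewrite !lebesgue_measure_itv/= !lte_fin ltrD2r; case: ifP => // _.
  by rewrite -!EFinD; congr EFin; ring.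
exact/esym/(@lebesgue_measure_unique R
  (measure_function_pushforward__canonical__measure_function_Measure mu mt) tE A mA).
Qed.

Lemma lebesgue_measure_dilate (r : R) (A : set R) : 0 < r -> measurable A ->
  mu ((fun x => r * x) @^-1` A) = ((r^-1)%:E * mu A)%E.
Proof.
move=> r0 mA.
have mt : measurable_fun [set: R] (fun x : R => r * x : measurableTypeR R).
  by apply: measurable_funM => //; exact: measurable_cst.
have r0' : 0 <= r by exact: ltW.
have tE X : ocitv X -> mu X = (r%:E * mu ((fun x => (r * x)%R) @^-1` X))%E.
  move=> [[b c]] _ <-.
  rewrite (_ : _ @^-1` _ = `]b / r, c / r]%classic); last first.
    by apply/seteqP; split=> x /=; rewrite !in_itv/= ltr_pdivrMr// ler_pdivlMr// mulrC.
  rewrite !lebesgue_measure_itv/= !lte_fin ltr_pM2r ?invr_gt0//; case: ifP => // _.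
    by rewrite -!EFinD -EFinM; congr EFin; field; rewrite gt_eqF.
  by rewrite mule0.
have := @lebesgue_measure_unique R (mscale (NngNum r0')
  (measure_function_pushforward__canonical__measure_function_Measure mu mt)) tE A mA.
rewrite /mscale/= /pushforward => ->.
by rewrite muleA -EFinM mulVf ?gt_eqF// mul1e.
Qed.

Lemma FTC2_is_derive (F f : R -> R) (a b : R) : a < b ->
  (forall x, a <= x <= b -> is_derive x (1 : R) F (f x)) ->
  (forall x, a <= x <= b -> {for x, continuous f}) ->
  (\int[mu]_(x in `[a, b]) (f x)%:E = (F b - F a)%:E)%E.
Proof.
move=> ab dF cf; rewrite EFinB; apply: continuous_FTC2 => //.
- by apply: continuous_in_subspaceT => x; rewrite inE /= in_itv /= => /cf.
- have cF x : a <= x <= b -> {for x, continuous F}.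
    by move=> /dF h; apply/differentiable_continuous/derivable1_diffP; exact: ex_derive.
  split.
  + by move=> x; rewrite in_itv/= => /andP[/ltW h1 /ltW h2]; have := dF x;
    rewrite h1 h2 => /(_ erefl) h; exact: ex_derive.
  + by apply: cvg_at_right_filter; apply: cF; rewrite lexx ltW.
  + by apply: cvg_at_left_filter; apply: cF; rewrite lexx ltW.
- move=> x; rewrite in_itv/= => /andP[/ltW h1 /ltW h2]; have := dF x; rewrite h1 h2 => /(_ erefl) h.
  by rewrite derive1E; exact: derive_val.
Qed.

(** Mediates between 0/1 factors on the whole line, suited to exchanging integrals, and integrals
    over an interval, suited to the fundamental theorem of calculus. *)
Lemma integral_indic_itv (w : R -> R) (D : set R) (P : R -> bool) :
  (forall x, D x <-> P x) ->
  (\int[mu]_x (w x * (P x)%:R)%:E = \int[mu]_(x in D) (w x)%:E)%E.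
Proof.
move=> DP; rewrite [RHS]integral_mkcond; apply: eq_integral => x _.
rewrite patchE; case: ifPn => [|] h.
  by move: h; rewrite inE => /DP ->; rewrite mulr1.
case: (boolP (P x)) => [/DP Dx|]; last by rewrite mulr0.
by exfalso; move/negP: h; apply; rewrite inE.
Qed.

Lemma is_derive_expr n (x : R) : is_derive x (1 : R) (fun x => x ^+ n) (n%:R * x ^+ n.-1).
Proof.
have := @is_deriveX R R id n x 1 1 (is_derive_id _ _).
rewrite /GRing.scale/= mulr1; congr is_derive.
by apply/funext => y; rewrite exprfctE.
Qed.

Lemma integral_expr n (t : R) : 0 < t ->
  (\int[mu]_x (n.+1%:R * x ^+ n * ((0 < x) && (x < t))%:R)%:E = (t ^+ n.+1)%:E)%E.
Proof.
move=> t0; rewrite (@integral_indic_itv (fun x => n.+1%:R * x ^+ n) `]0, t[%classic); last first.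
  by move=> x /=; rewrite in_itv.
have mf : measurable_fun setT (fun x : R => (n.+1%:R * x ^+ n)%:E).
  by apply/measurable_EFinP; apply: measurable_funM; [exact: measurable_cst|exact: measurable_funX].
rewrite -(@integral_itv_bndoo _ _ _ _ true false); last exact: measurable_funTS.
have dF x : 0 <= x <= t -> is_derive x (1 : R) (fun x => x ^+ n.+1) (n.+1%:R * x ^+ n).
  by move=> _; exact: is_derive_expr.
have cf x : 0 <= x <= t -> {for x, continuous (fun x : R => n.+1%:R * x ^+ n)}.
  by move=> _; apply: cvgM; [exact: cvg_cst|exact: exprn_continuous].
by rewrite (FTC2_is_derive t0 dF cf) expr0n/= subr0.
Qed.

(** Writes exp(-u) as the mass above u of a positive weight, the form needed by [layer_cake]. *)
Lemma integral_expRN (u : R) : 0 <= u ->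
  (\int[mu]_x (expR (- x) * (0 < x)%R%:R * (u < x)%R%:R)%:E = (expR (- u))%:E)%E.
Proof.
move=> u0.
under eq_integral => x _ do rewrite -mulrA -natrM mulnb.
rewrite (@integral_indic_itv (fun x => expR (- x)) `]u, +oo[%classic); last first.
  move=> x /=; rewrite in_itv/= andbT; split=> [ux|/andP[]//].
  by rewrite ux (le_lt_trans u0 ux).
have cE : continuous (fun x : R => expR (- x)).
  by move=> x; apply: (@continuous_comp _ _ _ (fun x : R => - x) expR);
    [exact: opp_continuous|exact: continuous_expR].
rewrite integral_itv_obnd_cbnd; last first.
  apply/measurable_EFinP/measurable_funTS.
  by apply: (@measurableT_comp _ _ _ _ _ _ (@expR R)) => //; exact: measurable_funN.
rewrite (@ge0_continuous_FTC2y _ (fun x => expR (- x)) (fun x => - expR (- x)) u 0).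
- by rewrite EFinN oppeK add0e.
- by move=> x _; exact: expR_ge0.
- by apply: continuous_subspaceT.
- by rewrite -[0]oppr0; apply: cvgN; exact: cvgr_expR.
- by move=> x _; exact: ex_derive.
- by apply: cvg_at_right_filter; apply: cvgN; exact: cE.
- move=> x _; rewrite derive1_comp// derive1N// derive1_id mulN1r derive1_comp// derive1E.
  have /funeqP -> := @derive_expR R.
  by rewrite derive1N// derive1_id mulrN1 opprK.
Qed.

(** The integrand is the derivative of - x^-k, written so that k = 0 needs no separate treatment; it
    represents u^-k - 1 as the mass above u of a positive weight. *)
Lemma integral_neg_expr k (u : R) : 0 < u ->
  (\int[mu]_x (k%:R * x ^+ k.-1 / (x ^+ k) ^+ 2 * ((0 < x) && (x < 1))%:R * (u < x)%R%:R)%:E =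
   (((u ^+ k)^-1 - 1) * (u < 1)%R%:R)%:E)%E.
Proof.
move=> u0; have [u1|u1] := ltP u 1; last first.
  rewrite mulr0; apply: integral0_eq => x _.
  case: (ltP u x) => ux; last by rewrite mulr0.
  by rewrite [x < 1]ltNge (le_trans u1 (ltW ux)) andbF mulr0 mul0r.
rewrite mulr1.
under eq_integral => x _ do rewrite -mulrA -natrM mulnb.
rewrite (@integral_indic_itv (fun x => k%:R * x ^+ k.-1 / (x ^+ k) ^+ 2) `]u, 1[%classic);
  last first.
  move=> x /=; rewrite in_itv/=; split=> [/andP[ux x1]|/andP[/andP[_ ->] ->]//].
  by rewrite ux x1 (lt_trans u0 ux).
have dF x : u <= x <= 1 -> is_derive x (1 : R) (fun x => - (x ^+ k)^-1) (k%:R * x ^+ k.-1 / (x ^+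
  k) ^+ 2).
  move=> /andP[ux _]; have x0 : x != 0 by rewrite gt_eqF// (lt_le_trans u0).
  have xk : x ^+ k != 0 by rewrite expf_neq0.
  have := is_deriveN (@is_deriveV R (fun x => x ^+ k) x _ 1 xk (is_derive_expr k x)).
  rewrite /GRing.scale/= => hh; apply: is_derive_eq hh _.
  by field.
have cf x : u <= x <= 1 -> {for x, continuous (fun x : R => k%:R * x ^+ k.-1 / (x ^+ k) ^+ 2 : R)}.
  move=> /andP[ux _]; have x0 : x != 0 by rewrite gt_eqF// (lt_le_trans u0).
  apply: cvgM; first by apply: cvgM; [exact: cvg_cst|exact: exprn_continuous].
  apply: cvgV; first by rewrite !expf_neq0.
  by apply: (@continuous_comp _ _ _ (fun x : R => x ^+ k) (fun x => x ^+ 2));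
    exact: exprn_continuous.
rewrite -(@integral_itv_bndoo _ _ _ _ true false); last first.
  apply/measurable_EFinP/measurable_funTS; apply: measurable_funM.
    by apply: measurable_funM; [exact: measurable_cst|exact: measurable_funX].
  apply: measurable_fun_inv => [|x]; last exact: sqr_ge0.
  by do 2 apply: measurable_funX.
rewrite (FTC2_is_derive u1 dF cf) expr1n invr1.
by congr EFin; ring.
Qed.

End real_integrals.

(** * The layer-cake formula and the Gamma integral *)

Section layer_cake.
Context d (T : measurableType d) (R : realType).
Variables (lam : {sigma_finite_measure set T -> \bar R}) (q H : T -> R).
Hypotheses (mq : measurable_fun setT q) (mH : measurable_fun setT H).
Hypothesis H0 : forall x, 0 <= H x.
Local Notation mu := (@lebesgue_measure R).

(** Tonelli. Integrals of H times a decreasing function of q are thereby reduced to the H-mass of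
    the sublevel sets of q. *)
Lemma layer_cake (w : R -> R) : measurable_fun setT w -> (forall s, 0 <= w s) ->
  (\int[lam]_x ((H x)%:E * \int[mu]_s (w s * (q x < s)%R%:R)%:E) =
   \int[mu]_s ((w s)%:E * \int[lam]_x (H x * (q x < s)%R%:R)%:E))%E.
Proof.
move=> mw w0.
have mqs : measurable_fun setT (fun p : T * R => (q p.1 < p.2)%R%:R : R).
  apply: measurable_fun_ltr_nat; last exact: measurable_snd.
  exact: (measurableT_comp mq measurable_fst).
pose f (p : T * R) : \bar R := (H p.1 * (w p.2 * (q p.1 < p.2)%R%:R))%:E.
have mf : measurable_fun setT f.
  apply/measurable_EFinP; apply: measurable_funM.
    exact: (measurableT_comp mH measurable_fst).
  apply: measurable_funM => //.
  exact: (measurableT_comp mw measurable_snd).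
have f0 p : (0 <= f p)%E by rewrite lee_fin mulr_ge0// mulr_ge0.
have := @fubini_tonelli _ _ T (measurableTypeR R) R lam mu f mf f0.
rewrite /fubini_F /fubini_G /f /= => e.
transitivity (\int[lam]_x \int[mu]_s (H x * (w s * (q x < s)%R%:R))%:E)%E.
  apply: eq_integral => x _; under [RHS]eq_integral do rewrite EFinM.
  rewrite ge0_integralZl ?lee_fin//; last first.
    by move=> s _; rewrite lee_fin mulr_ge0.
  apply/measurable_EFinP; apply: measurable_funM => //.
  by apply: measurable_fun_ltr_nat => //; exact: measurable_cst.
rewrite e; apply: eq_integral => s _.
under eq_integral do rewrite mulrCA EFinM.
rewrite ge0_integralZl ?lee_fin//; last first.
  by move=> x _; rewrite lee_fin mulr_ge0.
apply/measurable_EFinP; apply: measurable_funM => //.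
by apply: measurable_fun_ltr_nat => //; exact: measurable_cst.
Qed.

End layer_cake.

Section layer_cake_applications.
Variable R : realType.
Local Notation mu := (@lebesgue_measure R).

Let wexp (s : R) := expR (- s) * (0 < s)%R%:R.

Let mwexp : measurable_fun setT wexp.
Proof.
apply: measurable_funM; last first.
  by apply: measurable_fun_ltr_nat => //; exact: measurable_cst.
by apply: (@measurableT_comp _ _ _ _ _ _ (@expR R)) => //; exact: measurable_funN.
Qed.

Let wexp0 s : 0 <= wexp s.
Proof. by rewrite mulr_ge0 ?expR_ge0. Qed.

(** [layer_cake] with the weight exp(-s): mass c t^k below every level t determines the Gaussian
    integral. *)
Lemma layer_cake_expR d (T : measurableType d) (lam : {sigma_finite_measure set T -> \bar R})
    (q H : T -> R) (c : R) k : measurable_fun setT q -> measurable_fun setT H ->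
  (forall x, 0 <= q x) -> (forall x, 0 <= H x) -> 0 <= c ->
  (forall t, 0 < t -> (\int[lam]_x (H x * (q x < t)%R%:R)%:E = (c * t ^+ k)%:E)%E) ->
  (\int[lam]_x (H x * expR (- q x))%:E =
   c%:E * \int[mu]_s (s ^+ k * expR (- s) * (0 < s)%R%:R)%:E)%E.
Proof.
move=> mq mH q0 H0 c0 HV.
have := @layer_cake _ T R lam q H mq mH H0 wexp mwexp wexp0.
under eq_integral => x _ do rewrite integral_expRN// -EFinM.
move=> ->.
rewrite -ge0_integralZl//; last 2 first.
- apply/measurable_EFinP; apply: measurable_funM; last first.
    by apply: measurable_fun_ltr_nat => //; exact: measurable_cst.
  apply: measurable_funM; first exact: measurable_funX.
  by apply: (@measurableT_comp _ _ _ _ _ _ (@expR R)) => //; exact: measurable_funN.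
- move=> s _; case: (ltP 0 s) => s0; last by rewrite mulr0.
  by rewrite lee_fin !mulr_ge0 ?expR_ge0// exprn_ge0// ltW.
apply: eq_integral => s _; rewrite /wexp; case: (ltP 0 s) => s0; last first.
  by rewrite !mulr0 mul0e mule0.
by rewrite HV// -!EFinM; congr EFin; ring.
Qed.

(** Induction by [layer_cake_expR] in place of integration by parts: the density (k+1) x^k on the
    half line has mass t^(k+1) below t. Taking q = max(0, x) keeps q nonnegative on the whole
    line. *)
Lemma integral_gamma k :
  (\int[mu]_s (s ^+ k * expR (- s) * (0 < s)%R%:R)%:E = (k`!%:R : R)%:E)%E.
Proof.
elim: k => [|k IH].
  have := integral_expRN (lexx (0 : R)); rewrite oppr0 expR0 fact0 => <-.
  apply: eq_integral => s _; rewrite expr0 mul1r.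
  by case: (0 < s); rewrite ?mulr1// !mulr0.
pose H (x : R) := k.+1%:R * x ^+ k * (0 < x)%R%:R.
pose q (x : R) := Num.max 0 x.
have mH : measurable_fun setT H.
  apply: measurable_funM; last by apply: measurable_fun_ltr_nat => //; exact: measurable_cst.
  by apply: measurable_funM; [exact: measurable_cst|exact: measurable_funX].
have mq : measurable_fun setT q by apply: measurable_maxr => //; exact: measurable_cst.
have H0 x : 0 <= H x.
  rewrite /H; case: (ltP 0 x) => x0; last by rewrite mulr0.
  by rewrite !mulr_ge0// exprn_ge0// ltW.
have q0 x : 0 <= q x by rewrite le_max lexx.
have HV (t : R) : 0 < t -> (\int[mu]_x (H x * (q x < t)%R%:R)%:E = (1 * t ^+ k.+1)%:E)%E.
  move=> t0; rewrite mul1r -integral_expr//; apply: eq_integral => x _.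
  by rewrite /H /q; case: (ltP 0 x) => x0 /=; rewrite ?mulr1// !mulr0 mul0r.
have := @layer_cake_expR _ _ mu q H 1 k.+1 mq mH q0 H0 ler01 HV.
rewrite mul1e => <-.
transitivity (\int[mu]_x (k.+1%:R%:E * (x ^+ k * expR (- x) * (0 < x)%R%:R)%:E))%E.
  apply: eq_integral => x _; rewrite /H /q -EFinM; congr EFin.
  case: (ltP 0 x) => x0; last by rewrite !(mulr0, mul0r).
  by ring.
rewrite ge0_integralZl//; last 2 first.
- apply/measurable_EFinP; apply: measurable_funM; last first.
    by apply: measurable_fun_ltr_nat => //; exact: measurable_cst.
  apply: measurable_funM; first exact: measurable_funX.
  by apply: (@measurableT_comp _ _ _ _ _ _ (@expR R)) => //; exact: measurable_funN.
- move=> s _; case: (ltP 0 s) => s0; last by rewrite mulr0.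
  by rewrite lee_fin !mulr_ge0 ?expR_ge0// exprn_ge0// ltW.
by rewrite IH -EFinM factS natrM.
Qed.

(** Split q^-k = 1 + (q^-k - 1) on q < 1: the first part has mass c, and the layer-cake formula
    gives c k / (n + 1) for the second. Where q = 0 the inverse is 0 by convention, which is
    harmless if k = 0 or H vanishes there. This turns integrals over the ball into integrals over
    the sphere. *)
Lemma layer_cake_neg_expr d (T : measurableType d) (lam : {sigma_finite_measure set T -> \bar R})
    (q H : T -> R) (c : R) k n : measurable_fun setT q -> measurable_fun setT H ->
  (forall x, 0 <= q x) -> (forall x, 0 <= H x) -> 0 <= c ->
  (forall x, q x = 0 -> k = 0%N \/ H x = 0) ->
  (forall t, 0 < t -> (\int[lam]_x (H x * (q x < t)%R%:R)%:E = (c * t ^+ (k + n.+1))%:E)%E) ->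
  (\int[lam]_x (H x * (q x ^+ k)^-1 * (q x < 1)%R%:R)%:E = (c * ((k + n.+1)%:R / n.+1%:R))%:E)%E.
Proof.
move=> mq mH q0 H0 c0 Hq HV.
case: k Hq HV => [|k] Hq HV.
  rewrite divff ?pnatr_eq0// mulr1.
  under eq_integral do rewrite expr0 invr1 mulr1.
  by rewrite HV// expr1n mulr1.
pose w (x : R) := k.+1%:R * x ^+ k.+1.-1 / (x ^+ k.+1) ^+ 2 * ((0 < x) && (x < 1))%:R.
have w0 s : 0 <= w s.
  rewrite /w; case: (ltP 0 s) => s0; last by rewrite mulr0.
  have s0' : 0 <= s by exact: ltW.
  by rewrite !mulr_ge0 ?invr_ge0 ?exprn_ge0.
have mw : measurable_fun setT w.
  rewrite /w; under eq_fun do rewrite -mulnb natrM.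
  apply: measurable_funM; last first.
    by apply: measurable_funM; apply: measurable_fun_ltr_nat => //; exact: measurable_cst.
  apply: measurable_funM.
    by apply: measurable_funM; [exact: measurable_cst|exact: measurable_funX].
  apply: measurable_fun_inv => [|x]; last exact: sqr_ge0.
  by do 2 apply: measurable_funX.
have Wq x : (H x * (q x ^+ k.+1)^-1 * (q x < 1)%R%:R)%:E =
    ((H x * (q x < 1)%R%:R)%:E + (H x)%:E * \int[mu]_s (w s * (q x < s)%R%:R)%:E)%E.
  have [qx0|qx0] := eqVneq (q x) 0.
    by have [//|->] := Hq x qx0; rewrite !mul0r mul0e adde0.
  have qx : 0 < q x by rewrite lt_def qx0 q0.
  rewrite /w integral_neg_expr// -!EFinM -EFinD; congr EFin.
  by ring.
under eq_integral do rewrite Wq.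
have mHq : measurable_fun setT (fun x => (H x * (q x < 1)%R%:R)%:E).
  apply/measurable_EFinP; apply: measurable_funM => //.
  by apply: measurable_fun_ltr_nat => //; exact: measurable_cst.
rewrite ge0_integralD//; last 3 first.
- by move=> x _; rewrite lee_fin mulr_ge0.
- by move=> x _; rewrite mule_ge0// ?lee_fin// integral_ge0// => s _; rewrite lee_fin mulr_ge0.
- rewrite (_ : (fun x => _) = (fun x => ((H x * (q x ^+ k.+1)^-1 * (q x < 1)%R%:R)%:E - (H x * (q
  x < 1)%R%:R)%:E)%E)).
    apply: emeasurable_funB => //.
    apply/measurable_EFinP; apply: measurable_funM; last first.
      by apply: measurable_fun_ltr_nat => //; exact: measurable_cst.
    apply: measurable_funM => //.
    apply: measurable_fun_inv => [|x]; last exact: exprn_ge0.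
    exact: measurable_funX.
  by apply/funext => x; rewrite Wq addeAC subee// add0e.
rewrite HV// expr1n mulr1 layer_cake//.
have k0 : 0 <= c * k.+1%:R by rewrite mulr_ge0.
transitivity (c%:E + \int[mu]_s ((c * k.+1%:R / n.+1%:R)%:E * (n.+1%:R * s ^+ n * ((0 < s) && (s
  < 1))%:R)%:E))%E.
  congr (_ + _)%E; apply: eq_integral => s _; rewrite /w.
  case: (ltP 0 s) => s0 /=; last by rewrite !mulr0 mul0e mule0.
  rewrite HV// -!EFinM; congr EFin.
  rewrite (_ : (k.+1 + n.+1)%N = (k.+1 + k.+1 + n.+1 - k.+1)%N); last by rewrite addnAC addnK.
  case: (s < 1); last by rewrite !mulr0 mul0r.
  rewrite addnAC addnK exprD (exprS s k) (exprS s n); field.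
  by rewrite addrC natr1 pnatr_eq0 /= expf_neq0 gt_eqF.
rewrite ge0_integralZl//; last 3 first.
- apply/measurable_EFinP; under eq_fun do rewrite -mulnb natrM.
  apply: measurable_funM; last first.
    by apply: measurable_funM; apply: measurable_fun_ltr_nat => //; exact: measurable_cst.
  by apply: measurable_funM; [exact: measurable_cst|exact: measurable_funX].
- move=> s _; case: (ltP 0 s) => s0; last by rewrite mulr0.
  by rewrite lee_fin !mulr_ge0// exprn_ge0// ltW.
- by rewrite lee_fin divr_ge0.
rewrite integral_expr// expr1n mule1 -EFinD; congr EFin.
by rewrite natrD; field; rewrite addrC natr1 pnatr_eq0.
Qed.

End layer_cake_applications.

(** * Lebesgue measure on complex vectors *)

Section scaling_maps.
Context d (T : measurableType d) (R : realType).
Variable m : {measure set T -> \bar R}.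

(** A change of variables with constant Jacobian, stated for integrals and not only for sets so that
    it passes to products through iterated integration. *)
Definition scales (f : T -> T) (s : R) := [/\ measurable_fun setT f, 0 <= s &
  forall g : T -> \bar R, measurable_fun setT g -> (forall x, (0 <= g x)%E) ->
    (\int[m]_x g (f x) = s%:E * \int[m]_x g x)%E].

Lemma scales_of_measure f s : measurable_fun setT f -> 0 <= s ->
  (forall A, measurable A -> m (f @^-1` A) = (s%:E * m A)%E) -> scales f s.
Proof.
move=> mf s0 H; split=> // g mg g0.
have := @ge0_integral_pushforward _ _ T T R f mf m setT g measurableT mg (fun x _ => g0 x).
rewrite preimage_setT => <-.
rewrite -(@ge0_integral_mscale _ _ _ m setT measurableT (NngNum s0) g)//.
by apply: eq_measure_integral => A mA _; rewrite /mscale/= /pushforward H.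
Qed.

Lemma scales_comp f g s t : scales f s -> scales g t -> scales (f \o g) (s * t).
Proof.
move=> [mf s0 Hf] [mg t0 Hg]; split; first exact: measurableT_comp.
  exact: mulr_ge0.
move=> h mh h0; have mhf : measurable_fun setT (h \o f) by exact: measurableT_comp.
rewrite /= (Hg (h \o f))//; last by move=> x; exact: h0.
by rewrite Hf// muleA EFinM [(t%:E * _)%E]muleC.
Qed.

Lemma scales_measure f s A : scales f s -> measurable A ->
  m (f @^-1` A) = (s%:E * m A)%E.
Proof.
move=> [mf s0 H] mA.
have := H (EFin \o \1_A) ltac:(by apply/measurable_EFinP;
  exact: measurable_indic) ltac:(by move=> x /=; rewrite lee_fin).
have -> : (\int[m]_x (EFin \o \1_A) x = m A)%E by rewrite /= integral_indic// setIT.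
move=> <-; transitivity (\int[m]_x (\1_(f @^-1` A) x)%:E)%E.
  rewrite integral_indic ?setIT//.
  by rewrite -[X in measurable X]setTI; exact: mf.
by apply: eq_integral => x _; rewrite /= !indicE; congr (_%:R%:E); apply/idP/idP; rewrite !inE.
Qed.

End scaling_maps.

Section product_image_integral.
Context d1 d2 d3 (T1 : measurableType d1) (T2 : measurableType d2)
  (T3 : measurableType d3) (R : realType).
Variables (m1 : {sigma_finite_measure set T1 -> \bar R})
  (m2 : {sigma_finite_measure set T2 -> \bar R}).
Variables (f : T1 * T2 -> T3) (g : T3 -> T1 * T2).
Hypotheses (mf : measurable_fun setT f) (mg : measurable_fun setT g).
Hypothesis fK : cancel f g.

Lemma integral_product_image (h : T3 -> \bar R) : measurable_fun setT h ->
  (forall x, (0 <= h x)%E) ->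
  (\int[product_image m1 m2 mf mg fK]_x h x = \int[m1]_x \int[m2]_y h (f (x, y)))%E.
Proof.
move=> mh h0.
have mhf : measurable_fun setT (h \o f) by exact: measurableT_comp.
have := @ge0_integral_pushforward _ _ _ T3 R f mf (m1 \x m2)%E setT h measurableT mh (fun x _ =>
  h0 x).
rewrite preimage_setT => e; have := @fubini_tonelli1 _ _ _ _ _ m1 m2 (h \o f) mhf (fun x => h0 _).
rewrite -e /fubini_F /= => <-.
exact: eq_measure_integral.
Qed.

Lemma integral_product_image2 (h : T3 -> \bar R) : measurable_fun setT h ->
  (forall x, (0 <= h x)%E) ->
  (\int[product_image m1 m2 mf mg fK]_x h x = \int[m2]_y \int[m1]_x h (f (x, y)))%E.
Proof.
move=> mh h0; rewrite integral_product_image//.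
have mhf : measurable_fun setT (h \o f) by exact: measurableT_comp.
exact: (@fubini_tonelli _ _ _ _ _ m1 m2 (h \o f) mhf (fun x => h0 _)).
Qed.

Lemma scales_product_image f1 f2 s1 s2 (F : T3 -> T3) : scales m1 f1 s1 -> scales m2 f2 s2 ->
  measurable_fun setT F ->
  (forall x y, F (f (x, y)) = f (f1 x, f2 y)) ->
  scales (product_image m1 m2 mf mg fK) F (s1 * s2).
Proof.
move=> [mf1 s10 H1] [mf2 s20 H2] mF FE; split=> //; first exact: mulr_ge0.
move=> h mh h0; rewrite integral_product_image//; last exact: measurableT_comp.
have mhf : measurable_fun setT (h \o f) by exact: measurableT_comp.
have mF0 : measurable_fun setT (fun x => \int[m2]_y h (f (x, y)))%E.
  exact: (@measurable_fun_fubini_tonelli_F _ _ T1 T2 R m2 (h \o f) mhf (fun x => h0 _)).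
transitivity (\int[m1]_x (s2%:E * \int[m2]_y h (f (f1 x, y))))%E.
  apply: eq_integral => x _; under eq_integral do rewrite FE.
  rewrite (H2 (fun y => h (f (f1 x, y))))//.
  by apply: (measurableT_comp mhf); exact: measurable_fun_pair.
rewrite ge0_integralZl//; last 2 first.
- by apply: (measurableT_comp mF0 mf1).
- by move=> x _; apply: integral_ge0.
rewrite (H1 (fun x => \int[m2]_y h (f (x, y)))%E)//; last by move=> x; apply: integral_ge0.
by rewrite muleA -EFinM mulrC integral_product_image.
Qed.

End product_image_integral.

Section lebesgueC.
Variable R : realType.
Local Notation C := R[i].
Local Notation mu := (@lebesgue_measure R).
Local Notation lamC := (@lebesgueC R).

Lemma scales_lebesgue_translate (a : R) :
  scales mu (fun x : measurableTypeR R => x + a : measurableTypeR R) 1.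
Proof.
apply: scales_of_measure => //.
  by apply: measurable_funD => //; exact: measurable_cst.
by move=> A mA; rewrite mul1e; exact: lebesgue_measure_translate.
Qed.

Lemma scales_lebesgue_dilate (r : R) : 0 < r ->
  scales mu (fun x : measurableTypeR R => r * x : measurableTypeR R) r^-1.
Proof.
move=> r0; apply: scales_of_measure; last first.
- by move=> A mA; exact: lebesgue_measure_dilate.
- by rewrite invr_ge0 ltW.
- by apply: measurable_funM => //; exact: measurable_cst.
Qed.

Definition shear_Re (a : R) (z : C) : C := (complex.Re z + a * complex.Im z) +i* complex.Im z.
Definition shear_Im (a : R) (z : C) : C := complex.Re z +i* (complex.Im z + a * complex.Re z).

Lemma measurable_shear_Re a : measurable_fun setT (shear_Re a).
Proof.
apply/measurable_fun_complexP; split => /=; last exact: measurable_Im.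
apply: measurable_funD; first exact: measurable_Re.
by apply: measurable_funM; [exact: measurable_cst|exact: measurable_Im].
Qed.

Lemma measurable_shear_Im a : measurable_fun setT (shear_Im a).
Proof.
apply/measurable_fun_complexP; split => /=; first exact: measurable_Re.
apply: measurable_funD; first exact: measurable_Im.
by apply: measurable_funM; [exact: measurable_cst|exact: measurable_Re].
Qed.

Lemma measurable_mkC1 (b : R) : measurable_fun setT (fun x : measurableTypeR R => x +i* b : C).
Proof. by apply/measurable_fun_complexP; split => //=; exact: measurable_cst. Qed.

Lemma measurable_mkC2 (b : R) : measurable_fun setT (fun x : measurableTypeR R => b +i* x : C).
Proof. by apply/measurable_fun_complexP; split => //=; exact: measurable_cst. Qed.

(** For a fixed imaginary part the shear is a translation of the real part. *)
Lemma scales_shear_Re a : scales lamC (shear_Re a) 1.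
Proof.
split=> //; first exact: measurable_shear_Re.
move=> g mg g0; rewrite mul1e integral_product_image2//; last first.
  by apply: measurableT_comp => //; exact: measurable_shear_Re.
rewrite integral_product_image2//; apply: eq_integral => y _.
have [_ _ H] := scales_lebesgue_translate (a * y).
rewrite /mkC /shear_Re /=.
rewrite (H (fun x => g (x +i* y))) ?mul1e//.
by apply: measurableT_comp => //; exact: measurable_mkC1.
Qed.

Lemma scales_shear_Im a : scales lamC (shear_Im a) 1.
Proof.
split=> //; first exact: measurable_shear_Im.
move=> g mg g0; rewrite mul1e integral_product_image//; last first.
  by apply: measurableT_comp => //; exact: measurable_shear_Im.
rewrite integral_product_image//; apply: eq_integral => x _.
have [_ _ H] := scales_lebesgue_translate (a * x).
rewrite /mkC /shear_Im /=.
rewrite (H (fun y => g (x +i* y))) ?mul1e//.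
by apply: measurableT_comp => //; exact: measurable_mkC2.
Qed.

(* A rotation is a product of three shears. *)
Lemma scales_rotation (w : C) : normc w = 1 -> w != -1 -> scales lamC (fun z => w * z) 1.
Proof.
case: w => c s w1 wN1.
have [c1|c1] := eqVneq c (-1).
  have s0 : s = 0.
    have := sqr_normcE (c +i* s); rewrite w1 /= c1 sqrrN !expr1n => /eqP.
    by rewrite -[X in X == _]addr0 (inj_eq (addrI _)) eq_sym sqrf_eq0 => /eqP.
  by move: wN1; rewrite c1 s0 eq_complex /= oppr0 !eqxx.
have cs : c ^+ 2 + s ^+ 2 = 1 by rewrite -[RHS](expr1n _ 2) -w1 sqr_normcE.
have c10 : 1 + c != 0 by rewrite addrC addr_eq0.
(* For w = exp(i theta) this is - tan(theta / 2), the slope of the two outer shears; the middle one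
   has slope sin theta. *)
pose a := - s / (1 + c).
have as_ : a * s = c - 1.
  apply: (mulfI c10); rewrite mulrA [(1 + c) * a]mulrC /a divfK//.
  have -> : (1 + c) * (c - 1) = c ^+ 2 - 1 by ring.
  by rewrite -cs; ring.
have a2 : 2 * a + a ^+ 2 * s = - s.
  rewrite expr2 -mulrA as_ (_ : 2 * a + a * (c - 1) = a * (1 + c)); last by ring.
  by rewrite /a divfK.
have -> : (fun z => (c +i* s) * z) = shear_Re a \o (shear_Im s \o shear_Re a).
  apply/funext => -[x y]; rewrite /shear_Re /shear_Im /=.
  apply/eqP; rewrite eq_complex /=; apply/andP; split; apply/eqP.
    have -> : x + a * y + a * (y + s * (x + a * y)) = x + (a * s) * x + (2 * a + a ^+ 2 * s) * y
      by ring.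
    by rewrite as_ a2; ring.
  have -> : y + s * (x + a * y) = y + s * x + (a * s) * y by ring.
  by rewrite as_; ring.
have := scales_comp (scales_shear_Re a) (scales_comp (scales_shear_Im s) (scales_shear_Re a)).
by rewrite !mulr1.
Qed.

Lemma measurable_mulC (w : C) : measurable_fun setT (fun z : C => w * z).
Proof. by apply: mfunZ; exact: measurable_id. Qed.

Lemma scales_dilationC (r : R) : 0 < r -> scales lamC (fun z => r%:C * z) (r^-1 ^+ 2).
Proof.
move=> r0; rewrite expr2; apply: scales_product_image.
- exact: scales_lebesgue_dilate.
- exact: scales_lebesgue_dilate.
- exact: measurable_mulC.
- by move=> x y; rewrite /mkC /=; apply/eqP; rewrite eq_complex /= !mul0r subr0 addr0 !eqxx.
Qed.

Lemma scales_idC : scales lamC (fun z => z) 1.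
Proof. by split=> // g mg g0; rewrite mul1e. Qed.

End lebesgueC.

Section lebesgueCn.
Variable R : realType.
Local Notation C := R[i].
Local Notation lamC := (@lebesgueC R).

Definition tmap n (F : 'I_n -> C -> C) (z : n.-tuple C) : n.-tuple C :=
  [tuple F i (tnth z i) | i < n].

Lemma measurable_tmap n (F : 'I_n -> C -> C) : (forall i, measurable_fun setT (F i)) ->
  measurable_fun setT (tmap F).
Proof.
move=> mF; apply/measurable_fun_tnthP => i.
rewrite (_ : _ \o _ = F i \o (fun z => tnth z i)).
  by apply: measurableT_comp => //; exact: measurable_tnth.
by apply/funext => z /=; rewrite tnth_mktuple.
Qed.

Lemma tmap_tcons n (F : 'I_n.+1 -> C -> C) x (z : n.-tuple C) :
  tmap F (tcons (x, z)) = tcons (F ord0 x, tmap (fun i => F (lift ord0 i)) z).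
Proof.
apply: eq_from_tnth => i; rewrite tnth_mktuple.
case: (unliftP ord0 i) => [j ->|->]; last by rewrite !(tnth_nth 0).
by rewrite !tnthS tnth_mktuple.
Qed.

Lemma scales_tmap n (F : 'I_n -> C -> C) (s : 'I_n -> R) :
  (forall i, scales lamC (F i) (s i)) ->
  scales (@lebesgueCn R n) (tmap F) (\prod_i s i).
Proof.
elim: n F s => [|n IH] F s H.
  rewrite big_ord0; split=> //.
    by apply: measurable_tmap => -[].
  move=> g mg g0; rewrite mul1e; apply: eq_integral => z _.
  by congr g; apply: eq_from_tnth => -[].
rewrite big_ord_recl; apply: scales_product_image.
- exact: H.
- by apply: IH => i; exact: H.
- by apply: measurable_tmap => i; case: (H i).
- exact: tmap_tcons.
Qed.

Lemma integral_tuple_prod n (g : 'I_n -> C -> R) (v : 'I_n -> R) :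
  (forall i, measurable_fun setT (g i)) -> (forall i x, 0 <= g i x) ->
  (forall i, (\int[lamC]_x (g i x)%:E = (v i)%:E)%E) ->
  (\int[@lebesgueCn R n]_z (\prod_i g i (tnth z i))%:E = (\prod_i v i)%:E)%E.
Proof.
elim: n g v => [|n IH] g v mg g0 H.
  rewrite big_ord0 /lebesgueCn /=.
  rewrite (eq_integral (fun=> 1%:E)); last by move=> z _; rewrite big_ord0.
  by rewrite integral_cst//= mul1e diracE in_setT.
have mprod k (h : 'I_k -> C -> R) : (forall i, measurable_fun setT (h i)) ->
    measurable_fun setT (fun z : k.-tuple C => \prod_i h i (tnth z i)).
  move=> mh; apply: measurable_prod => i _.
  by apply: (measurableT_comp (mh i)); exact: measurable_tnth.
have v0 i : 0 <= v i by rewrite -lee_fin -H integral_ge0// => x _; rewrite lee_fin.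
rewrite /lebesgueCn /= integral_product_image; last 2 first.
- by apply/measurable_EFinP; exact: mprod.
- by move=> z; rewrite lee_fin prodr_ge0.
transitivity (\int[lamC]_x ((\prod_(i < n) v (lift ord0 i))%:E * (g ord0 x)%:E))%E.
  apply: eq_integral => x _.
  transitivity (\int[@lebesgueCn R n]_y ((g ord0 x)%:E * (\prod_i g (lift ord0 i) (tnth y
    i))%:E))%E.
    apply: eq_integral => y _; rewrite -EFinM; congr EFin; rewrite big_ord_recl; congr (_ * _).
    by apply: eq_bigr => i _; rewrite tnthS.
  rewrite ge0_integralZl//.
  - by rewrite (IH (fun i => g (lift ord0 i)) (fun i => v (lift ord0 i)))// muleC.
  - by apply/measurable_EFinP; exact: (mprod _ (fun i => g (lift ord0 i))).
  - by move=> y _; rewrite lee_fin prodr_ge0.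
  - by rewrite lee_fin.
rewrite ge0_integralZl ?lee_fin ?prodr_ge0//.
- by rewrite H -EFinM big_ord_recl mulrC.
- by apply/measurable_EFinP.
- by move=> x _; rewrite lee_fin.
Qed.

End lebesgueCn.

Section disc_integrals.
Variable R : realType.
Local Notation C := R[i].
Local Notation lamC := (@lebesgueC R).

Lemma measurable_sqr_normc : measurable_fun setT (fun z : C => normc z ^+ 2).
Proof. by apply: measurable_funX; apply: mfun_normc; exact: measurable_id. Qed.

(* Homogeneity of H and dilation of the measure. *)
Lemma integral_homogeneous d (T : measurableType d) (m : {measure set T -> \bar R})
    (D : R -> T -> T) (q H : T -> R) (k n : nat) (c : R) :
  measurable_fun setT q -> measurable_fun setT H ->
  (forall x, 0 <= q x) -> (forall x, 0 <= H x) ->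
  (forall r, 0 < r -> scales m (D r) (r^-1 ^+ (2 * n))) ->
  (forall r x, 0 < r -> q (D r x) = r ^+ 2 * q x) ->
  (forall r x, 0 < r -> H (D r x) = r ^+ (2 * k) * H x) ->
  (\int[m]_x (H x * (q x < 1)%R%:R)%:E = c%:E)%E ->
  forall t, 0 < t -> (\int[m]_x (H x * (q x < t)%R%:R)%:E = (c * t ^+ (k + n))%:E)%E.
Proof.
move=> mq mH q0 H0 Hs qD HD Hc t t0.
(* q has degree 2, so dilating by the square root of t maps the level 1 to the level t. *)
pose r := Num.sqrt t; have r0 : 0 < r by rewrite sqrtr_gt0.
have r2 : r ^+ 2 = t by rewrite sqr_sqrtr// ltW.
have [_ _ Hg] := Hs r r0.
have mg s : measurable_fun setT (fun x => (H x * (q x < s)%R%:R)%:E).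
  apply/measurable_EFinP; apply: measurable_funM => //.
  by apply: measurable_fun_ltr_nat => //; exact: measurable_cst.
have g0 s x : (0 <= (H x * (q x < s)%R%:R)%:E)%E by rewrite lee_fin mulr_ge0.
have := Hg _ (mg t) (g0 t).
under eq_integral => x _.
  rewrite HD// qD// r2 -[X in _ < X]mulr1 ltr_pM2l// -mulrA EFinM.
  over.
rewrite ge0_integralZl//; last by rewrite lee_fin exprn_ge0// ltW.
rewrite Hc exprM r2 => /(congr1 (fun y => ((t ^+ n)%:E * y)%E)).
rewrite muleA -!EFinM exprM exprVn r2 muleA -EFinM exprVn mulfV ?mul1e; last first.
  by rewrite expf_neq0// gt_eqF.
by move=> <-; congr EFin; rewrite exprD; ring.
Qed.

(** This is pi; only its being finite and positive matters, since it cancels in the normalized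
    measure. *)
Definition disc_area : R := fine (\int[lamC]_z ((normc z ^+ 2 < 1)%R%:R)%:E)%E.

(** The disc lies in a square of side 2. *)
Let area_le4 : (\int[lamC]_z ((normc z ^+ 2 < 1)%R%:R)%:E <= 4%:E)%E.
Proof.
pose b (x : R) : R := ((-1 < x) && (x < 1))%:R.
have ib : (\int[lebesgue_measure]_x (b x)%:E = 2%:E)%E.
  have := @integral_indic_itv R (fun=> 1) `]-1,
    1[%classic (fun x => (-1 < x) && (x < 1)) ltac:(by move=> x; rewrite /= in_itv).
  rewrite integral_cst//= lebesgue_measure_itv/= lte_fin ifT; last by lra.
  rewrite mul1e -EFinD opprK => <-; apply: eq_integral => x _.
  by rewrite mul1r.
have mb : measurable_fun setT b.
  rewrite /b; under eq_fun do rewrite -mulnb natrM.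
  by apply: measurable_funM; apply: measurable_fun_ltr_nat => //; exact: measurable_cst.
apply: (@le_trans _ _ (\int[lamC]_z (b (complex.Re z) * b (complex.Im z))%:E)%E).
  apply: ge0_le_integral => //.
  - apply/measurable_EFinP; apply: measurable_fun_ltr_nat; last exact: measurable_cst.
    exact: measurable_sqr_normc.
  - apply/measurable_EFinP; apply: measurable_funM.
      by apply: (measurableT_comp mb); exact: measurable_Re.
    by apply: (measurableT_comp mb); exact: measurable_Im.
  - move=> z _; rewrite lee_fin; case: (ltP (normc z ^+ 2) 1) => [|_]; last by rewrite mulr_ge0.
    rewrite expr_lt1 ?normc_ge0// => z1.
    have := le_lt_trans (normr_Re_le z) z1; have := le_lt_trans (normr_Im_le z) z1.
    by rewrite !ltr_norml /b => -> ->; rewrite mulr1.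
rewrite integral_product_image; last 2 first.
- apply/measurable_EFinP; apply: measurable_funM.
    by apply: (measurableT_comp mb); exact: measurable_Re.
  by apply: (measurableT_comp mb); exact: measurable_Im.
- by move=> z; rewrite lee_fin mulr_ge0.
have -> : (\int[lebesgue_measure]_x \int[lebesgue_measure]_y
    (b (complex.Re (mkC (x, y))) * b (complex.Im (mkC (x, y))))%:E =
    \int[lebesgue_measure]_x (2%:E * (b x)%:E))%E.
  apply: eq_integral => x _ /=; under eq_integral do rewrite EFinM.
  transitivity ((b x)%:E * \int[lebesgue_measure]_y (b y)%:E)%E; last by rewrite ib muleC.
  by apply: ge0_integralZl; rewrite ?lee_fin//; [exact/measurable_EFinP|move=> y _;
    rewrite lee_fin].
rewrite (_ : (\int[lebesgue_measure]_x _) = 2%:E * \int[lebesgue_measure]_y (b y)%:E)%E; last first.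
  by apply: ge0_integralZl; rewrite ?lee_fin//; [exact/measurable_EFinP|move=> y _;
    rewrite lee_fin].
rewrite ib; by rewrite -EFinM lee_fin; lra.
Qed.

(** The disc contains a square of side 1, on which |Re z| + |Im z| < 1. *)
Let area_ge1 : (1%:E <= \int[lamC]_z ((normc z ^+ 2 < 1)%R%:R)%:E)%E.
Proof.
pose b (x : R) : R := ((- 2^-1 < x) && (x < 2^-1))%:R.
have ib : (\int[lebesgue_measure]_x (b x)%:E = 1%:E)%E.
  have := @integral_indic_itv R (fun=> 1) `]- 2^-1,
    2^-1[%classic (fun x => (- 2^-1 < x) && (x < 2^-1)) ltac:(by move=> x; rewrite /= in_itv).
  rewrite integral_cst//= lebesgue_measure_itv/= lte_fin ifT; last by lra.
  rewrite mul1e -EFinD opprK (_ : 2^-1 + 2^-1 = 1); last by lra.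
  move=> <-; apply: eq_integral => x _.
  by rewrite mul1r.
have mb : measurable_fun setT b.
  rewrite /b; under eq_fun do rewrite -mulnb natrM.
  by apply: measurable_funM; apply: measurable_fun_ltr_nat => //; exact: measurable_cst.
have mbb : measurable_fun setT (fun z : C => (b (complex.Re z) * b (complex.Im z))%:E).
  apply/measurable_EFinP; apply: measurable_funM.
    by apply: (measurableT_comp mb); exact: measurable_Re.
  by apply: (measurableT_comp mb); exact: measurable_Im.
apply: (@le_trans _ _ (\int[lamC]_z (b (complex.Re z) * b (complex.Im z))%:E)%E); last first.
  apply: ge0_le_integral => //.
  - by move=> z _; rewrite lee_fin mulr_ge0.
  - apply/measurable_EFinP; apply: measurable_fun_ltr_nat; last exact: measurable_cst.
    exact: measurable_sqr_normc.
  - move=> z _; rewrite lee_fin /b -!ltr_norml.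
    case: (ltP `|complex.Re z| 2^-1) => h1; last by rewrite mul0r.
    case: (ltP `|complex.Im z| 2^-1) => h2; last by rewrite mulr0.
    suff -> : normc z ^+ 2 < 1 by rewrite mulr1.
    rewrite expr_lt1 ?normc_ge0//.
    by apply: le_lt_trans (normc_le_ReIm z) _; lra.
rewrite integral_product_image//; last by move=> z; rewrite lee_fin mulr_ge0.
have -> : (\int[lebesgue_measure]_x \int[lebesgue_measure]_y
    (b (complex.Re (mkC (x, y))) * b (complex.Im (mkC (x, y))))%:E =
    \int[lebesgue_measure]_x (b x)%:E)%E.
  apply: eq_integral => x _ /=; under eq_integral do rewrite EFinM.
  transitivity ((b x)%:E * \int[lebesgue_measure]_y (b y)%:E)%E; last by rewrite ib mule1.
  by apply: ge0_integralZl; rewrite ?lee_fin//; [exact/measurable_EFinP|move=> y _;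
    rewrite lee_fin].
by rewrite ib.
Qed.

Lemma disc_areaE : (\int[lamC]_z ((normc z ^+ 2 < 1)%R%:R)%:E = disc_area%:E)%E.
Proof.
rewrite /disc_area fineK// ge0_fin_numE; last by apply: le_trans area_ge1; rewrite lee_fin.
by apply: le_lt_trans area_le4 _; rewrite ltry.
Qed.

Lemma disc_area_gt0 : 0 < disc_area.
Proof. by have := area_ge1; rewrite disc_areaE lee_fin; apply: lt_le_trans. Qed.

End disc_integrals.

Section restricted_measure.
Context d (T : measurableType d) (R : realType).
Variables (m : {measure set T -> \bar R}) (B : set T) (mB : measurable B).

(** Write m as the sum of its restrictions to B and to the complement; the integrand on the right
    vanishes almost everywhere for the latter. *)
Lemma ge0_integral_mrestr (h : T -> \bar R) : measurable_fun setT h ->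
  (forall x, (0 <= h x)%E) ->
  (\int[mrestr m mB]_x h x = \int[m]_x (h x * (\1_B x)%:E))%E.
Proof.
move=> mh h0.
have mBc := measurableC mB.
have mi : measurable_fun setT (fun x => h x * (\1_B x)%:E)%E.
  by apply: emeasurable_funM => //; apply/measurable_EFinP; exact: measurable_indic.
have hi0 x : (0 <= h x * (\1_B x)%:E)%E by rewrite mule_ge0// lee_fin.
rewrite [RHS](@eq_measure_integral _ _ _ _ (measure_add (mrestr m mB) (mrestr m mBc))); last first.
  move=> A mA _; transitivity (mrestr m mB A + mrestr m mBc A)%E; last first.
    by rewrite /measure_add/= /msum !big_ord_recl big_ord0 adde0.
  rewrite /mrestr -measureU//; last 3 first.
  - exact: measurableI.
  - exact: measurableI.
  - by rewrite setIACA setICr setI0.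
  by rewrite -setIUr setUv setIT.
rewrite ge0_integral_measure_add//.
rewrite [X in (_ + X)%E](_ : _ = 0%E) ?adde0; last first.
  rewrite (ge0_ae_eq_integral (g := cst 0%E))//; first by rewrite integral0.
  exists B; split => //; first by rewrite /= /mrestr setICr measure0.
  move=> x /= H; apply: contrapT => Bx; apply: H => _.
  by rewrite indicE memNset// mule0.
apply: ge0_ae_eq_integral => //.
exists (~` B); split => //; first by rewrite /= /mrestr setICl measure0.
move=> x /= H Bx; apply: H => _.
by rewrite indicE mem_set// mule1.
Qed.

End restricted_measure.

(** * The surface measure *)

Section sphere_monomials.
Variables (R : realType) (n' : nat).
Local Notation n := n'.+1.
Local Notation C := R[i].
Local Notation Cn := (n.-tuple C).
Local Notation lam := (@lebesgueCn R n).
Local Notation lamC := (@lebesgueC R).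
Local Notation sigma := (@sphere_measure R n).
Local Notation kappa := (disc_area R).

Let mN : measurable_fun setT (fun z : Cn => enorm z ^+ 2).
Proof. by apply: measurable_funX; exact: measurable_enorm. Qed.

Let q0 (z : Cn) : 0 <= enorm z ^+ 2.
Proof. exact: sqr_ge0. Qed.

(** The square of the modulus of a monomial, split into one-variable factors for iterated
    integration. *)
Definition mono_sqr (a : {ffun 'I_n -> nat}) (z : Cn) : R :=
  \prod_i (normc (tnth z i) ^+ 2) ^+ a i.

Lemma mono_sqr_ge0 a z : 0 <= mono_sqr a z.
Proof. by rewrite prodr_ge0// => i _; rewrite exprn_ge0// sqr_ge0. Qed.

Lemma mono_sqrE a z : mono_sqr a z = normc (monomial a z) ^+ 2.
Proof.
rewrite normc_prod -prodrXl; apply: eq_bigr => i _.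
by rewrite normcX exprAC.
Qed.

Let measurable_normc_tnth k (i : 'I_k) : measurable_fun setT (fun z : k.-tuple C => normc (tnth z
  i) ^+ 2).
Proof. by apply: measurable_funX; apply: mfun_normc; exact: measurable_tnth. Qed.

Lemma measurable_mono_sqr a : measurable_fun setT (mono_sqr a).
Proof.
by apply: measurable_prod => i _; apply: measurable_funX; exact: measurable_normc_tnth.
Qed.

Let mlt d (T : measurableType d) (f : T -> R) (s : R) : measurable_fun setT f ->
  measurable_fun setT (fun x => (f x < s)%R%:R : R).
Proof. by move=> mf; apply: measurable_fun_ltr_nat => //; exact: measurable_cst. Qed.

(** The set lies in every {q < t}, whose measure c t^(k+1) tends to 0 with t. *)
Lemma null_of_integral d (T : measurableType d) (m : {measure set T -> \bar R})
    (q : T -> R) (c : R) k : measurable_fun setT q -> 0 <= c ->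
  (forall t, 0 < t -> (\int[m]_x ((q x < t)%R%:R)%:E = (c * t ^+ k.+1)%:E)%E) ->
  m [set x | q x <= 0] = 0%E.
Proof.
move=> mq c0 H.
have mE : measurable [set x | q x <= 0].
  by rewrite -[X in measurable X]setTI; exact: (mq measurableT _ (measurable_itv `]-oo, 0])).
have le (t : R) : 0 < t -> (m [set x | (q x <= 0)%R] <= (c * t ^+ k.+1)%:E)%E.
  move=> t0; rewrite -H// -(setIT [set x | _]) -integral_indic//.
  apply: ge0_le_integral => //.
  - by apply/measurable_EFinP; exact: measurable_indic.
  - by apply/measurable_EFinP; exact: mlt.
  - move=> x _; rewrite lee_fin indicE; case: (boolP (x \in _)) => // /[!inE] /= h.
    by rewrite (le_lt_trans h t0).
have m0 : (0 <= m [set x | (q x <= 0)%R])%E by exact: measure_ge0.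
have fin : m [set x | q x <= 0] \is a fin_num.
  by rewrite ge0_fin_numE//; apply: le_lt_trans (le 1 ltr01) _; rewrite ltry.
rewrite -(fineK fin); congr EFin; apply/eqP; rewrite eq_le fine_ge0// andbT.
apply: (@le_of_geometric R _ 0 c) => i; rewrite add0r -lee_fin fineK//.
apply: le_trans (le (2^-1 ^+ i) _) _; first by rewrite exprn_gt0// invr_gt0.
rewrite lee_fin ler_wpM2l// exprS ler_piMr ?exprn_ge0 ?invr_ge0//.
by rewrite !exprn_ile1 ?exprn_ge0 ?invr_ge0// invf_le1// ler1n.
Qed.

(** By homogeneity |z|^(2k) has mass c t^(k+1) on {|z|^2 < t} for some constant c; once c is found
    from the area of the disc, the layer-cake formula gives c (k+1)!. *)
Lemma gauss_disc k :
  (\int[lamC]_z ((normc z ^+ 2) ^+ k * expR (- normc z ^+ 2))%:E = (kappa * k`!%:R)%:E)%E.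
Proof.
have mq := @measurable_sqr_normc R.
have sc (r : R) : 0 < r -> scales lamC (fun z => r%:C * z) (r^-1 ^+ (2 * 1)).
  by move=> r0; rewrite muln1; exact: scales_dilationC.
have qD (r : R) (z : C) : 0 < r -> normc (r%:C * z) ^+ 2 = r ^+ 2 * normc z ^+ 2.
  by move=> r0; rewrite normcM normc_real gtr0_norm// exprMn.
have V0 t : 0 < t -> (\int[lamC]_z ((normc z ^+ 2 < t)%R%:R)%:E = (kappa * t ^+ 1)%:E)%E.
  move=> t0; have := @integral_homogeneous R _ _ lamC (fun r z => r%:C * z) (fun z => normc z ^+ 2)
    (fun=> 1) 0 1 kappa mq (measurable_cst _) (fun=> sqr_ge0 _) (fun=> ler01) sc qD
    (fun r x _ => ltac:(by rewrite muln0 expr0 mulr1)).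
  under eq_integral do rewrite mul1r.
  by rewrite disc_areaE => /(_ erefl t t0); under eq_integral do rewrite mul1r.
have k0 := disc_area_gt0 R.
have N0 := null_of_integral mq (ltW k0) V0.
pose H (z : C) := (normc z ^+ 2) ^+ k.
have mH : measurable_fun setT H by apply: measurable_funX.
have H0 z : 0 <= H z by rewrite exprn_ge0// sqr_ge0.
have [c [c0 Hc]] : exists c : R,
  0 <= c /\ (\int[lamC]_z (H z * (normc z ^+ 2 < 1)%R%:R)%:E = c%:E)%E.
  set I := (\int[lamC]_z _)%E.
  have I0 : (0 <= I)%E by apply: integral_ge0 => z _; rewrite lee_fin mulr_ge0.
  have : (I <= kappa%:E)%E.
    rewrite -disc_areaE; apply: ge0_le_integral => //.
    - by move=> z _; rewrite lee_fin mulr_ge0.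
    - by apply/measurable_EFinP; apply: measurable_funM => //; exact: mlt.
    - by apply/measurable_EFinP; exact: mlt.
    - move=> z _; rewrite lee_fin; case: (ltP (normc z ^+ 2) 1) => h; last by rewrite mulr0.
      by rewrite mulr1 exprn_ile1// ?sqr_ge0// ltW.
  by case: I I0 => // c c0 _; exists c; rewrite lee_fin in c0.
have V := @integral_homogeneous R _ _ lamC (fun r z => r%:C * z) (fun z => normc z ^+ 2)
    H k 1 c mq mH (fun=> sqr_ge0 _) H0 sc qD
    (fun r x r0 => ltac:(by rewrite /H qD// exprMn exprM)) Hc.
(* Dividing H by |z|^(2k) leaves 1 off the origin, so [layer_cake_neg_expr] must return the area of
   the disc. *)
have e1 : c * (k + 1)%:R = kappa.
  have [k00|k00] := eqVneq k 0%N.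
    move: Hc; rewrite /H k00; under eq_integral do rewrite expr0 mul1r.
    by rewrite disc_areaE => -[->]; rewrite mulr1.
  have := @layer_cake_neg_expr R _ _ lamC (fun z => normc z ^+ 2) H c k 0 mq mH
    (fun=> sqr_ge0 _) H0 c0 (fun z z0 => ltac:(by right; rewrite /H z0 expr0n (negbTE k00))) V.
  rewrite (_ : (\int[lamC]_x _)%E = kappa%:E); first by rewrite divr1 => -[->].
  rewrite -disc_areaE; apply: ge0_ae_eq_integral => //.
  - apply/measurable_EFinP; apply: measurable_funM; last exact: mlt.
    apply: measurable_funM => //; apply: measurable_fun_inv => [|x];
      last by rewrite exprn_ge0// sqr_ge0.
    exact: measurable_funX.
  - by apply/measurable_EFinP; exact: mlt.
  - by move=> z _; rewrite lee_fin !mulr_ge0// invr_ge0 exprn_ge0// sqr_ge0.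
  exists [set z | normc z ^+ 2 <= 0]; split => //.
    by rewrite -[X in measurable X]setTI; exact: (mq measurableT _ (measurable_itv `]-oo, 0])).
  move=> z /= h; rewrite leNgt; apply/negP => z0; apply: h => _.
  by rewrite /H divff ?mul1r// expf_neq0// gt_eqF.
rewrite (@layer_cake_expR R _ _ lamC (fun z => normc z ^+ 2) H c (k + 1) mq mH (fun=> sqr_ge0 _)
  H0 c0 V).
rewrite integral_gamma -EFinM -e1 addn1 factS natrM; congr EFin; ring.
Qed.

Let scCn (r : R) : 0 < r -> scales lam (tscale r%:C) (r^-1 ^+ (2 * n)).
Proof.
move=> r0; have := @scales_tmap R n (fun i x => r%:C * x) (fun=> r^-1 ^+ 2) (fun=>
  scales_dilationC r0).
by rewrite prodr_const card_ord -exprM.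
Qed.

Let qDn (r : R) (z : Cn) : 0 < r -> enorm (tscale r%:C z) ^+ 2 = r ^+ 2 * enorm z ^+ 2.
Proof. by move=> r0; rewrite enorm_tscale normc_real gtr0_norm// exprMn. Qed.

Let mono_sqrD a (r : R) (z : Cn) : 0 < r ->
  mono_sqr a (tscale r%:C z) = r ^+ (2 * mdeg a) * mono_sqr a z.
Proof.
move=> r0; rewrite !mono_sqrE monomial_tscale normcM exprMn normcX normc_real gtr0_norm//.
by rewrite -exprM mulnC.
Qed.

(** Homogeneity; the constant is finite because the ball lies in the polydisc and monomials are at
    most 1 there. Its value is determined in [ball_radial]. *)
Let ball_int a : exists c : R, 0 <= c /\
  forall t, 0 < t -> (\int[lam]_z (mono_sqr a z * (enorm z ^+ 2 < t)%R%:R)%:E = (c * t ^+ (mdeg a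
    + n))%:E)%E.
Proof.
have [c [c0 Hc]] : exists c : R,
  0 <= c /\ (\int[lam]_z (mono_sqr a z * (enorm z ^+ 2 < 1)%R%:R)%:E = c%:E)%E.
  set I := (\int[lam]_z _)%E.
  have I0 : (0 <= I)%E by apply: integral_ge0 => z _; rewrite lee_fin mulr_ge0// mono_sqr_ge0.
  have : (I <= (\prod_(i < n) kappa)%:E)%E.
    rewrite -(@integral_tuple_prod R n (fun i z => (normc z ^+ 2 < 1)%R%:R) (fun=> kappa))//;
      last 2 first.
    - by move=> i; apply: mlt; exact: measurable_sqr_normc.
    - by move=> i; exact: disc_areaE.
    apply: ge0_le_integral => //.
    - by move=> z _; rewrite lee_fin mulr_ge0// mono_sqr_ge0.
    - apply/measurable_EFinP; apply: measurable_funM; last exact: mlt.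
      exact: measurable_mono_sqr.
    - apply/measurable_EFinP; apply: measurable_prod => i _; apply: mlt.
      exact: measurable_normc_tnth.
    - move=> z _; rewrite lee_fin; case: (ltP (enorm z ^+ 2) 1) => h;
      last by rewrite mulr0 prodr_ge0.
      rewrite mulr1.
      have zi i : normc (tnth z i) ^+ 2 < 1.
        apply: le_lt_trans h; rewrite lerXn2r ?nnegrE ?normc_ge0 ?enorm_ge0//.
        exact: normc_tnth_le.
      rewrite [leRHS]big1 ?prodr_ile1// => i _; last by rewrite zi.
      by rewrite exprn_ge0 ?sqr_ge0// exprn_ile1// ?sqr_ge0// ltW.
  by case: I I0 => // c c0 _; exists c; rewrite lee_fin in c0.
exists c; split=> // t t0.
exact: (@integral_homogeneous R _ _ lam (fun r => tscale r%:C) _ _ (mdeg a) n c mN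
  (measurable_mono_sqr a) q0 (mono_sqr_ge0 a) scCn qDn (mono_sqrD a) Hc).
Qed.

(** The Gaussian integral of |z^a|^2 is the product of the one-variable values and also, by the
    layer-cake formula, c (|a| + n)!. Equating them gives the constant c of [ball_int]; dividing by
    |z|^(2|a|) multiplies it by (|a| + n) / n. *)
Let ball_radial a :
  (\int[lam]_z (mono_sqr a z * (enorm z ^+ 2 ^+ mdeg a)^-1 * (enorm z ^+ 2 < 1)%R%:R)%:E =
   (kappa ^+ n * (\prod_i (a i)`!)%:R / (n%:R * (mdeg a + n').+1.-1`!%:R))%:E)%E.
Proof.
have [c [c0 V]] := ball_int a.
rewrite (@layer_cake_neg_expr R _ _ lam (fun z => enorm z ^+ 2) (mono_sqr a) c (mdeg a) n' mN
  (measurable_mono_sqr a) q0 (mono_sqr_ge0 a) c0 _ V); last first.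
  move=> z z0; have [|k0] := posnP (mdeg a); first by left.
  right; have [i ai] : exists i, a i != 0%N.
    apply: contrapT => h; move: k0; rewrite lt0n => /eqP; apply.
    by rewrite /mdeg big1// => i _; apply/eqP; apply: contrapT => hi; apply: h; exists i;
      apply/negP.
  rewrite /mono_sqr (bigD1 i)//=.
  suff -> : normc (tnth z i) ^+ 2 = 0 by rewrite expr0n (negbTE ai) mul0r.
  apply/eqP; rewrite eq_le sqr_ge0 andbT -z0 lerXn2r ?nnegrE ?normc_ge0 ?enorm_ge0//.
  exact: normc_tnth_le.
have e := @layer_cake_expR R _ _ lam (fun z => enorm z ^+ 2) (mono_sqr a) c (mdeg a + n) mN
  (measurable_mono_sqr a) q0 (mono_sqr_ge0 a) c0 V.
have := @integral_tuple_prod R n (fun i z => (normc z ^+ 2) ^+ a i * expR (- normc z ^+ 2))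
  (fun i => kappa * (a i)`!%:R).
have -> : (fun z : Cn => (\prod_i ((normc (tnth z i) ^+ 2) ^+ a i * expR (- normc (tnth z i) ^+
  2)))%:E)
   = (fun z => (mono_sqr a z * expR (- enorm z ^+ 2))%:E).
  apply/funext => z; congr EFin; rewrite big_split/=; congr (_ * _).
  by rewrite sqr_enorm -sumrN expR_sum.
rewrite e integral_gamma -EFinM => /(_ _ _ (fun i => gauss_disc (a i))) h.
have {h} : c * (mdeg a + n)`!%:R = \prod_(i < n) (kappa * (a i)`!%:R).
  apply: EFin_inj; apply: h.
    move=> i; apply: measurable_funM.
      by apply: measurable_funX; exact: measurable_sqr_normc.
    apply: (@measurableT_comp _ _ _ _ _ _ (@expR R)) => //.
    by apply: measurable_funN; exact: measurable_sqr_normc.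
  by move=> i x; rewrite mulr_ge0 ?expR_ge0// exprn_ge0// sqr_ge0.
rewrite big_split/= prodr_const card_ord -natr_prod addnS => hc.
rewrite -hc factS natrM /=; congr EFin; field.
by rewrite [1 + _]addrC natr1 !pnatr_eq0 -?lt0n fact_gt0.
Qed.

Let zero_idx : {ffun 'I_n -> nat} := [ffun=> 0%N].

Let mdeg0 : mdeg zero_idx = 0%N.
Proof. by rewrite /mdeg big1// => i _; rewrite ffunE. Qed.

Lemma ball_area : lam (@unit_ball R n) = (kappa ^+ n / n`!%:R)%:E.
Proof.
have := ball_radial zero_idx.
rewrite mdeg0 add0n big1; last by move=> i _; rewrite ffunE.
rewrite mulr1 factS natrM => <-.
rewrite -(setIT (@unit_ball R n)) -integral_indic//; last exact: measurable_unit_ball.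
apply: eq_integral => z _; congr EFin; rewrite expr0 invr1 mulr1.
rewrite /mono_sqr big1 ?mul1r; last by move=> i _; rewrite ffunE expr0.
rewrite indicE expr_lt1 ?enorm_ge0//; congr (nat_of_bool _)%:R.
by apply/idP/idP; rewrite inE.
Qed.

Lemma ge0_integral_sphere (h : Cn -> \bar R) : measurable_fun setT h -> (forall x, (0 <= h x)%E) ->
  (\int[sigma]_x h x =
   ((kappa ^+ n / n`!%:R)^-1)%:E * \int[lam]_x (h (radial x) * (\1_(@unit_ball R n) x)%:E))%E.
Proof.
move=> mh h0.
have k0 := disc_area_gt0 R.
have c0 : 0 <= (kappa ^+ n / n`!%:R)^-1.
  by rewrite invr_ge0 divr_ge0// exprn_ge0// ltW.
have mhr : measurable_fun setT (h \o @radial R n).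
  by apply: measurableT_comp => //; exact: measurable_radial.
rewrite -(@ge0_integral_mrestr _ _ _ lam _ (@measurable_unit_ball R n) (fun x => h (radial x)))//.
have := @ge0_integral_pushforward _ _ Cn Cn R (@radial R n) (@measurable_radial R n) (mrestr lam
  (@measurable_unit_ball R n)) setT h measurableT mh (fun x _ => h0 x).
rewrite preimage_setT => <-.
rewrite -(@ge0_integral_mscale _ _ _ _ setT measurableT (NngNum c0) h)//.
  exact: measurable_radial.
move=> mr; apply: eq_measure_integral => A mA _.
transitivity ((fine (lam (@unit_ball R n)))^-1%:E * lam (@radial R n @^-1` A `&` @unit_ball R
  n))%E => //.
by rewrite ball_area.
Qed.

(** At z / |z| the function is |z^a|^2 / |z|^(2|a|), so [ball_radial] is divided by the volume of
    the ball, and the powers of [kappa] cancel. *)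
Lemma integral_sphere_mono a :
  (\int[sigma]_x (normc (monomial a x) ^+ 2)%:E =
   ((\prod_i (a i)`!)%:R * n'`!%:R / (mdeg a + n')`!%:R)%:E)%E.
Proof.
rewrite ge0_integral_sphere; last 2 first.
- apply/measurable_EFinP; under eq_fun do rewrite -mono_sqrE.
  exact: measurable_mono_sqr.
- by move=> x; rewrite lee_fin sqr_ge0.
have -> : (\int[lam]_x ((normc (monomial a (radial x)) ^+ 2)%:E * (\1_(@unit_ball R n) x)%:E) =
  \int[lam]_z (mono_sqr a z * (enorm z ^+ 2 ^+ mdeg a)^-1 * (enorm z ^+ 2 < 1)%R%:R)%:E)%E.
  apply: eq_integral => z _; rewrite -EFinM; congr EFin; congr (_ * _).
    have -> : radial z = tscale ((enorm z)^-1)%:C z by [].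
    rewrite monomial_tscale normcM exprMn -mono_sqrE mulrC; congr (_ * _).
    by rewrite normcX normc_real ger0_norm ?invr_ge0 ?enorm_ge0// exprAC exprVn exprVn.
  rewrite indicE expr_lt1 ?enorm_ge0//; congr (nat_of_bool _)%:R.
  by apply/idP/idP; rewrite inE.
rewrite ball_radial -EFinM; congr EFin; rewrite /= factS natrM.
have k0 := disc_area_gt0 R.
field; rewrite !pnatr_eq0 -?lt0n !fact_gt0 /= expf_neq0 ?gt_eqF//.
Qed.

Lemma sphere_prob : sigma setT = 1%E.
Proof.
have k0 := disc_area_gt0 R.
rewrite /sphere_measure preimage_setT setTI ball_area /= -EFinM mulVf//.
by rewrite gt_eqF// divr_gt0 ?exprn_gt0// ltr0n fact_gt0.
Qed.

(** [radial z] has norm 1 except at z = 0, where it is 0 because 0^-1 = 0; the origin is a Lebesgue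
    null set. *)
Lemma sphere_concentrated : sigma [set x | enorm x != 1] = 0%E.
Proof.
have [c [c0 V]] := ball_int zero_idx.
have N0 : lam [set x | enorm x ^+ 2 <= 0] = 0%E.
  apply: (@null_of_integral _ _ lam (fun x => enorm x ^+ 2) c n') => // t t0.
  have := V t t0; rewrite mdeg0 add0n => <-; apply: eq_integral => z _; congr EFin.
  by rewrite /mono_sqr big1 ?mul1r// => i _; rewrite ffunE expr0.
rewrite /sphere_measure.
rewrite (@subset_measure0 _ _ _ lam (@radial R n @^-1` [set x | enorm x != 1] `&` @unit_ball R n)
  [set x | (enorm x ^+ 2 <= 0)%R])//.
- by rewrite mule0.
- apply: measurableI; last exact: measurable_unit_ball.
  rewrite -[X in measurable X]setTI; apply: measurable_radial => //.
  rewrite (_ : [set x | enorm x != 1] = ~` (setT `&` @enorm R n @^-1` [set 1])).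
    by apply: measurableC; apply: measurable_enorm => //; exact: measurable_set1.
  by rewrite setTI; apply/seteqP; split=> x /= /eqP.
- by rewrite -[X in measurable X]setTI; exact: (mN measurableT (measurable_itv `]-oo, 0])).
- move=> x /= [h _]; apply/negPn/negP; rewrite -ltNge => x0.
  case/negP: h; have -> : radial x = tscale ((enorm x)^-1)%:C x by [].
  rewrite enorm_tscale normc_real ger0_norm ?invr_ge0 ?enorm_ge0// mulVf//.
  by apply/negP => /eqP e; rewrite e expr0n ltxx in x0.
Qed.

(** Rotating one coordinate commutes with [radial] and preserves the ball, so invariance descends
    from Lebesgue measure to the cone measure. *)
Lemma sphere_rotation (i0 : 'I_n) (w : C) A : normc w = 1 -> w != -1 -> measurable A ->
  sigma (tmap (fun i x => if i == i0 then w * x else x) @^-1` A) = sigma A.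
Proof.
move=> w1 wN1 mA.
set rot := tmap _.
have sc : scales lam rot 1.
  have := @scales_tmap R n (fun i x => if i == i0 then w * x else x) (fun=> 1).
  rewrite prodr_const expr1n; apply => i.
  by case: (i == i0); [exact: scales_rotation|exact: scales_idC].
have nrot z : enorm (rot z) = enorm z.
  rewrite /enorm; congr Num.sqrt; apply: eq_bigr => i _.
  by rewrite tnth_mktuple; case: (i == i0); rewrite ?normcM ?w1 ?mul1r.
have rrot z : radial (rot z) = rot (radial z).
  apply: eq_from_tnth => i; rewrite !tnth_mktuple nrot.
  by case: (i == i0); rewrite // mulrCA.
rewrite /sphere_measure; congr (_ * _)%E.
rewrite -[RHS]mul1e -(scales_measure sc).
  congr (lam _); apply/seteqP; split=> z /=; rewrite /unit_ball/= nrot rrot//.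
apply: measurableI; last exact: measurable_unit_ball.
by rewrite -[X in measurable X]setTI; exact: measurable_radial.
Qed.

End sphere_monomials.

Lemma ip_sumr d (T : measurableType d) (R : realType) (mu : {measure set T -> \bar R})
    I (r : seq I) (F : I -> T -> R[i]) (g : T -> R[i]) :
  (forall i, L2 mu (F i)) -> L2 mu g ->
  L2inner mu g (fun x => \sum_(i <- r) F i x) = \sum_(i <- r) L2inner mu g (F i).
Proof.
move=> hF hg; rewrite ip_conj//; last exact: L2_sum.
rewrite ip_suml// rmorph_sum/=; apply: eq_bigr => i _.
by rewrite -ip_conj.
Qed.

(** * Multinomial and binomial expansions *)

Section multinomial_theorem.
Variable C : numFieldType.

Let nz k : (k`!%:R : C) != 0.
Proof. by rewrite pnatr_eq0 -lt0n fact_gt0. Qed.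

(* The coefficients of prod_i exp(x_i X) = exp((sum_i x_i) X). *)
Let coef_prod_exp I (r : seq I) (x : I -> C) K k : (k < K)%N ->
  (\prod_(i <- r) \poly_(a < K) (x i ^+ a / a`!%:R))`_k = (\sum_(i <- r) x i) ^+ k / k`!%:R.
Proof.
elim: r k => [|i r IH] k kK.
  rewrite !big_nil coef1; case: k kK => [|k] _; first by rewrite expr0 fact0 divr1.
  by rewrite expr0n mul0r.
rewrite !big_cons coefM [x i + _]addrC exprDn mulr_suml; apply: eq_bigr => j _.
have jk : (j <= k)%N by rewrite -ltnS.
rewrite coef_poly (leq_ltn_trans jk kK) IH ?(leq_ltn_trans (leq_subr _ _) kK)//.
rewrite -mulr_natr.
have e : 'C(k, j)%:R * (j`!%:R * (k - j)`!%:R) = k`!%:R :> C by rewrite -!natrM bin_fact.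
have bn : 'C(k, j)%:R != 0 :> C by rewrite pnatr_eq0 -lt0n bin_gt0.
by rewrite -e; field; rewrite !nz bn.
Qed.

(** Distribute the product of the truncated exponentials over all exponents and compare the
    coefficients of degree k, which truncation beyond k does not affect. *)
Lemma multinomial n k (x : 'I_n -> C) : (\sum_i x i) ^+ k =
  \sum_(b : {ffun 'I_n -> 'I_k.+1} | mdeg (cube_idx b) == k)
    k`!%:R / (\prod_i (cube_idx b i)`!)%:R * \prod_i x i ^+ cube_idx b i.
Proof.
have := @coef_prod_exp _ (index_enum 'I_n) x k.+1 k (ltnSn k).
under eq_bigr do rewrite poly_def.
rewrite bigA_distr_bigA /= coef_sum => /(congr1 (fun y => k`!%:R * y)).
rewrite mulrCA mulfV ?nz// mulr1 => <-.
rewrite mulr_sumr [RHS]big_mkcond/=; apply: eq_bigr => b _.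
have -> : \prod_i ((x i ^+ b i / (b i)`!%:R) *: 'X^(b i)) =
    (\prod_i (x i ^+ b i / (b i)`!%:R)) *: 'X^(mdeg (cube_idx b)) :> {poly C}.
  rewrite scaler_prod; congr (_ *: _); rewrite prodrXr; congr ('X^_).
  by apply: eq_bigr => i _; rewrite ffunE.
rewrite coefZ coefXn [k == _]eq_sym; case: ifP => _; last by rewrite !mulr0.
rewrite mulr1 big_split/= -mulrA; congr (_ * _); rewrite mulrC; congr (_ * _).
  by rewrite natr_prod -prodfV; apply: eq_bigr => i _; rewrite ffunE.
by apply: eq_bigr => i _; rewrite ffunE.
Qed.

End multinomial_theorem.

Section binomial_series.
Variable R : realType.
Local Notation C := R[i].

(** Partial sum of the expansion of (1 - x)^-(n+1), over any semiring so that one recursion serves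
    both real bounds and complex values. *)
Definition binom_sum (F : pzSemiRingType) n N (x : F) : F := \sum_(k < N) 'C(n + k, k)%:R * x ^+ k.

(** Pascal's rule telescopes, up to the term of highest degree. *)
Let binom_sum_rec (F : comPzRingType) n N (x : F) :
  (1 - x) * binom_sum n.+1 N.+1 x = binom_sum n N.+1 x - 'C(n.+1 + N, N)%:R * x ^+ N.+1.
Proof.
rewrite /binom_sum; elim: N => [|N IH].
  by rewrite !big_ord_recl !big_ord0 !bin0 /= expr0 expr1; ring.
rewrite big_ord_recr/= mulrDr IH [in RHS]big_ord_recr/=.
have -> : 'C(n.+1 + N.+1, N.+1)%:R = 'C(n + N.+1, N.+1)%:R + 'C(n.+1 + N, N)%:R :> F.
  by rewrite -natrD addSn binS addnS -addSn.
rewrite [x ^+ N.+2]exprS; ring.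
Qed.

Let binom_sum_le n N (q : R) : 0 <= q < 1 -> binom_sum n N q <= ((1 - q) ^+ n.+1)^-1.
Proof.
move=> /andP[q0 q1]; have d0 : 0 < 1 - q by rewrite subr_gt0.
have mono_ : binom_sum n N q <= binom_sum n N.+1 q.
  by rewrite /binom_sum [leRHS]big_ord_recr/= lerDl mulr_ge0 ?exprn_ge0.
apply: le_trans mono_ _; elim: n => [|n IH].
  rewrite expr1 -[leRHS]mul1r ler_pdivlMr// /binom_sum.
  have -> : \sum_(k < N.+1) 'C(0 + k, k)%:R * q ^+ k = \sum_(k < N.+1) q ^+ k.
    by apply: eq_bigr => k _; rewrite add0n binn mul1r.
  have : (q - 1) * \sum_(k < N.+1) q ^+ k = q ^+ N.+1 - 1 by rewrite -subrX1.
  have := exprn_ge0 N.+1 q0; lra.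
rewrite exprS invfM -ler_pdivrMl ?invr_gt0// invrK binom_sum_rec.
by apply: le_trans IH; rewrite lerBlDr lerDl mulr_ge0 ?exprn_ge0.
Qed.

(** Induction on n: multiplying by 1 - x turns the error for n + 1 into the error for n plus the
    last term of [binom_sum_rec], and both are small uniformly on |x| <= q. *)
Lemma binom_series n (q e : R) : 0 <= q < 1 -> 0 < e ->
  exists N0, forall N (x : C), (N0 <= N)%N -> normc x <= q ->
    normc (((1 - x) ^+ n.+1)^-1 - binom_sum n N x) <= e.
Proof.
move=> /andP[q0 q1]; elim: n e => [|n IH] e e0.
  have /cvgrPdist_lt cv : (fun N => (1 - q)^-1 * q ^+ N) @ \oo --> (0 : R).
    by apply: cvg_geometric; rewrite ger0_norm.
  have [N0 _ HN] := cv e e0; exists N0 => N x NN xq.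
  have x1 : 1 - x != 0.
    rewrite subr_eq0; apply/negP => /eqP x1; move: xq; rewrite -x1 normc1; lra.
  have -> : binom_sum 0 N x = \sum_(k < N) x ^+ k.
    by apply: eq_bigr => k _; rewrite add0n binn mul1r.
  have -> : ((1 - x) ^+ 1)^-1 - \sum_(k < N) x ^+ k = (1 - x)^-1 * x ^+ N.
    apply: (mulfI x1); rewrite expr1 mulrBr mulfV// mulrA mulfV// mul1r.
    set S := \sum_(k < N) _; have sx : x ^+ N - 1 = (x - 1) * S by exact: subrX1.
    by have -> : x ^+ N = (x - 1) * S + 1; [rewrite -sx subrK|ring].
  have := HN N NN; rewrite /= sub0r normrN => /ltW; apply: le_trans.
  apply: le_trans (ler_norm _); rewrite normcM normcV normcX.
  have h : 1 - q <= normc (1 - x).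
    by have := ler_normcB 1 x; rewrite normc1; lra.
  apply: ler_pM; rewrite ?invr_ge0 ?exprn_ge0 ?normc_ge0//.
    by rewrite lef_pV2 ?posrE//; lra.
  by rewrite lerXn2r ?nnegrE ?normc_ge0.
have d0 : 0 < 1 - q by rewrite subr_gt0.
have [N1 HN1] := IH ((1 - q) * e / 2) ltac:(by rewrite divr_gt0// mulr_gt0).
(* q' < 1 and q <= q'^2, so one factor q'^N pays for the binomial coefficient through [binom_sum_le]
   while the other tends to 0. *)
pose q' := (1 + q) / 2.
have q'0 : 0 <= q' < 1 by rewrite /q'; apply/andP; split; lra.
have qq' : q <= q' ^+ 2.
  by have := sqr_ge0 (1 - q); rewrite /q'; lra.
pose B := ((1 - q') ^+ n.+2)^-1.
have /cvgrPdist_lt cv : (fun N => B * q' ^+ N) @ \oo --> (0 : R).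
  by apply: cvg_geometric; rewrite ger0_norm; case/andP: q'0.
have [N2 _ HN2] := cv ((1 - q) * e / 2) ltac:(by rewrite divr_gt0// mulr_gt0).
exists (maxn N1 N2).+1 => -[//|N] x; rewrite ltnS geq_max => /andP[N1N N2N] xq.
have x1 : 1 - x != 0.
  by rewrite subr_eq0; apply/negP => /eqP x1; move: xq; rewrite -x1 normc1; lra.
have -> : ((1 - x) ^+ n.+2)^-1 - binom_sum n.+1 N.+1 x =
    (1 - x)^-1 * ((((1 - x) ^+ n.+1)^-1 - binom_sum n N.+1 x) + 'C(n.+1 + N, N)%:R * x ^+ N.+1).
  apply: (mulfI x1); rewrite mulrBr binom_sum_rec mulrA mulfV// mul1r exprS invfM mulrA mulfV//.
  ring.
have h : 1 - q <= normc (1 - x).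
  by have := ler_normcB 1 x; rewrite normc1; lra.
have hx : 0 < normc (1 - x) by lra.
rewrite normcM normcV ler_pdivrMl//.
apply: (@le_trans _ _ ((1 - q) * e)); last by rewrite ler_wpM2r// ltW.
apply: le_trans (le_normcD _ _) _.
have h1 := HN1 N.+1 x (leqW N1N) xq.
have h2 := HN2 N N2N; rewrite /= sub0r normrN in h2.
have h3 : normc ('C(n.+1 + N, N)%:R * x ^+ N.+1) <= `|B * q' ^+ N|.
  apply: le_trans (ler_norm _); rewrite normcM normcX.
  have -> : normc ('C(n.+1 + N, N)%:R : C) = 'C(n.+1 + N, N)%:R.
    by rewrite -(rmorph_nat (real_complex R)) normc_real normr_nat.
  have q'1 : 0 <= q' by case/andP: q'0.
  apply: (@le_trans _ _ ('C(n.+1 + N, N)%:R * q' ^+ N * q' ^+ N)).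
    rewrite -mulrA ler_wpM2l// -exprMn -expr2.
    apply: (@le_trans _ _ (normc x ^+ N)).
      rewrite exprS ler_piMl ?exprn_ge0 ?normc_ge0//; lra.
    by rewrite lerXn2r ?nnegrE ?normc_ge0 ?sqr_ge0// (le_trans xq).
  rewrite ler_wpM2r ?exprn_ge0//.
  apply: le_trans (@binom_sum_le n.+1 N.+1 q' q'0).
  rewrite /binom_sum big_ord_recr/= lerDr sumr_ge0// => i _.
  by rewrite mulr_ge0 ?exprn_ge0.
lra.
Qed.

End binomial_series.

(** * Reproducing property of the kernel on polynomials *)

Section sphere_integrals.
Variables (R : realType) (n' : nat).
Local Notation n := n'.+1.
Local Notation C := R[i].
Local Notation Cn := (n.-tuple C).
Local Notation sigma := (@sphere_measure R n).
Implicit Types (f g : Cn -> C) (w z : Cn).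

Lemma sphere_fin : (sigma setT < +oo)%E.
Proof. by rewrite sphere_prob ltry. Qed.

Lemma measurable_off_sphere : measurable [set x : Cn | enorm x != 1].
Proof.
rewrite (_ : [set x | enorm x != 1] = ~` (setT `&` @enorm R n @^-1` [set 1])).
  by apply: measurableC; apply: measurable_enorm => //; exact: measurable_set1.
by rewrite setTI; apply/seteqP; split=> x /= /eqP.
Qed.

Lemma sphere_ae (P : Cn -> Prop) : (forall x, enorm x = 1 -> P x) -> {ae sigma, forall x, P x}.
Proof.
move=> H; exists [set x | enorm x != 1]; split; first exact: measurable_off_sphere.
  exact: sphere_concentrated.
by move=> x /= nP; apply/eqP => /H.
Qed.

Lemma ge0_integral_sphere_le (g h : Cn -> R) : measurable_fun setT g -> measurable_fun setT h ->
  (forall x, 0 <= g x) -> (forall x, 0 <= h x) ->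
  (forall x, enorm x = 1 -> g x <= h x) ->
  (\int[sigma]_x (g x)%:E <= \int[sigma]_x (h x)%:E)%E.
Proof.
move=> mg mh g0 h0 gh; apply: ae_ge0_le_integral => //.
- by move=> x _; rewrite lee_fin.
- exact/measurable_EFinP.
- by move=> x _; rewrite lee_fin.
- exact/measurable_EFinP.
- by apply: sphere_ae => x x1 _; rewrite lee_fin gh.
Qed.

Lemma integrable_sphere_bounded (g : Cn -> R) (B : R) : measurable_fun setT g ->
  (forall x, 0 <= g x) -> (forall x, enorm x = 1 -> g x <= B) ->
  sigma.-integrable setT (EFin \o g) /\ Rintegral sigma setT g <= B.
Proof.
move=> mg g0 gB.
(* The bound is assumed on the sphere only, which is nonempty because its complement is null and
   sigma has mass 1. *)
have B0 : 0 <= B.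
  rewrite leNgt; apply/negP => Bn.
  have all (x : Cn) : enorm x != 1.
    by apply/negP => /eqP /gB; rewrite leNgt => /negP; apply; exact: lt_le_trans (g0 x).
  have := @sphere_concentrated R n'; have -> : [set x : Cn | enorm x != 1] = setT.
    by apply/seteqP; split => // x _; exact: all.
  by rewrite sphere_prob => /eqP; rewrite eqe oner_eq0.
have le : (\int[sigma]_x (g x)%:E <= B%:E)%E.
  apply: le_trans (ge0_integral_sphere_le mg (measurable_cst B) g0 (fun=> B0) gB) _.
  have -> : (\int[sigma]_x (cst B x)%:E = B%:E * sigma setT)%E.
    transitivity (\int[sigma]_x (cst B%:E x))%E; first exact: eq_integral.
    have := @integral_cst _ _ _ sigma _ measurableT B%:E.
    by move=> ->.
  by rewrite sphere_prob mule1.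
have ge : (0 <= \int[sigma]_x (g x)%:E)%E by apply: integral_ge0 => x _; rewrite lee_fin.
split.
  apply/integrableP; split; first exact/measurable_EFinP.
  apply: le_lt_trans (ltry B); rewrite (eq_integral (fun x => (g x)%:E))//.
  by move=> x _ /=; rewrite ger0_norm.
rewrite /Rintegral -lee_fin fineK// ge0_fin_numE//; exact: le_lt_trans le (ltry _).
Qed.

Lemma L2_sphere_bounded f (B : R) : measurable_fun setT f -> 0 <= B ->
  (forall x, enorm x = 1 -> normc (f x) <= B) -> L2 sigma f /\ nrm sigma f <= B.
Proof.
move=> mf B0 fB.
have [i1 i2] : sigma.-integrable setT (EFin \o (fun x => normc (f x) ^+ 2)) /\
    Rintegral sigma setT (fun x => normc (f x) ^+ 2) <= B ^+ 2.
  apply: integrable_sphere_bounded.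
  - by apply: measurable_funX; exact: mfun_normc.
  - by move=> x; rewrite sqr_ge0.
  - by move=> x /fB h; rewrite lerXn2r ?nnegrE ?normc_ge0.
split; first exact/L2P.
by rewrite -(@ler_pXn2r _ 2) ?nnegrE ?nrm_ge0// sqr_nrm.
Qed.

Lemma measurable_monomial (a : {ffun 'I_n -> nat}) : measurable_fun setT (@monomial R n a).
Proof. by apply: mfun_prod => i; apply: mfunX; exact: measurable_tnth. Qed.

Lemma normc_monomial_le a z : enorm z <= 1 -> normc (monomial a z) <= 1.
Proof.
move=> z1; rewrite normc_prod prodr_ile1// => i _.
rewrite normcX exprn_ge0 ?normc_ge0//= exprn_ile1 ?normc_ge0//.
exact: le_trans (normc_tnth_le _ _) z1.
Qed.

Lemma L2_monomial a : L2 sigma (monomial a).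
Proof.
have [] := @L2_sphere_bounded (monomial a) 1 (measurable_monomial a) ler01; last by [].
by move=> x x1; apply: normc_monomial_le; rewrite x1.
Qed.

Lemma measurable_inner w : measurable_fun setT (fun z => inner z w).
Proof. by apply: mfun_sum => i; apply: mfunM; [exact: measurable_tnth|exact: mfun_cst]. Qed.

Let rot (i0 : 'I_n) (u : C) : Cn -> Cn := tmap (fun i x => if i == i0 then u * x else x).

Let mrot i0 u : measurable_fun setT (rot i0 u).
Proof.
apply: measurable_tmap => i; case: (i == i0); last exact: measurable_id.
exact: measurable_mulC.
Qed.

Let cintegral_rot i0 u f : normc u = 1 -> u != -1 -> cint sigma f ->
  cintegral sigma (fun x => f (rot i0 u x)) = cintegral sigma f.
Proof.
move=> u1 uN1 fi.
have inv (g : Cn -> R) : sigma.-integrable setT (EFin \o g) ->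
    Rintegral sigma setT (fun x => g (rot i0 u x)) = Rintegral sigma setT g.
  move=> gi; rewrite /Rintegral; congr fine.
  have mr := mrot i0 u.
  have eqm (A : set Cn) : measurable A -> A `<=` setT -> pushforward sigma (rot i0 u) A = sigma A.
    by move=> mA _; exact: sphere_rotation.
  have mg : measurable_fun setT (EFin \o g) by case/integrableP: gi.
  have ig : sigma.-integrable (rot i0 u @^-1` setT) ((EFin \o g) \o rot i0 u).
    rewrite preimage_setT; apply/integrableP; split; first exact: measurableT_comp.
    have ma : measurable_fun setT (fun x => `|(EFin \o g) x|)%E by exact: measurableT_comp.
    have := @ge0_integral_pushforward _ _ Cn Cn R (rot i0 u) mr sigma setT _ measurableT ma (fun
      x _ => abse_ge0 _).
    rewrite preimage_setT /comp => <-.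
    rewrite (eq_measure_integral sigma)//.
    by case/integrableP: gi.
  have := @integral_pushforward _ _ Cn Cn R (rot i0 u) mr sigma setT (EFin \o g) mg ig measurableT.
  rewrite preimage_setT /comp => <-.
  exact: eq_measure_integral.
rewrite /cintegral (inv (fun x => complex.Re (f x)) (cint_Re fi)).
by rewrite (inv (fun x => complex.Im (f x)) (cint_Im fi)).
Qed.

(** Rotating by u a coordinate in which the exponents differ multiplies the inner product by u^(a_i)
    conj u^(b_i), which is not 1 for a suitable root of unity u. *)
Lemma monomial_orthogonal a b : a != b -> L2inner sigma (monomial a) (monomial b) = 0.
Proof.
move=> ab.
have [i0 abi] : exists i, a i != b i.
  apply: contrapT => h; case/eqP: ab; apply/ffunP => i.
  by apply/eqP; apply: contrapT => hi; apply: h; exists i; apply/negP.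
(* The order exceeds both exponents, so their powers of u differ, and it exceeds 2, so that u != -1
   as [sphere_rotation] requires. *)
have [u pu] := @prim_root_exists R (a i0 + b i0).+3 isT.
have u1 := prim_root_normc pu.
have uN1 : u != -1.
  apply/negP => /eqP uN1; have : u ^+ 2 == u ^+ 0 by rewrite uN1 sqrrN expr1n expr0.
  by rewrite (eq_prim_root_expr pu) !modn_small.
have monrot c x : monomial c (rot i0 u x) = u ^+ c i0 * monomial c x.
  rewrite /monomial (bigD1 i0)//= [in RHS](bigD1 i0)//= mulrA; congr (_ * _).
    by rewrite tnth_mktuple eqxx exprMn.
  by apply: eq_bigr => i ii; rewrite tnth_mktuple (negbTE ii).
have fi := cint_ip (L2_monomial a) (L2_monomial b).
have := cintegral_rot i0 u1 uN1 fi.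
rewrite (_ : (fun x => _) = (fun x => (u ^+ a i0 * (u ^+ b i0)^*) * (monomial a x * (monomial b
  x)^*))); last first.
  by apply/funext => x; rewrite !monrot rmorphM/=; ring.
rewrite cintegralZ//= -/(L2inner sigma (monomial a) (monomial b)) => /eqP.
rewrite -subr_eq0 -[X in _ - X]mul1r -mulrBl mulf_eq0 subr_eq0 => /orP[/eqP e|/eqP//].
have : u ^+ a i0 == u ^+ b i0.
  have c1 : (u ^+ b i0)^* * u ^+ b i0 = 1.
    by rewrite mulrC mulr_conj normcX u1 !expr1n.
  by rewrite -[u ^+ a i0]mulr1 -c1 mulrA e mul1r.
rewrite (eq_prim_root_expr pu) !modn_small; first by rewrite (negbTE abi).
  by rewrite ltnS (leq_trans (leq_addl (a i0) _))// !leqW.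
by rewrite ltnS (leq_trans (leq_addr (b i0) _))// !leqW.
Qed.

Lemma monomial_norm a : L2inner sigma (monomial a) (monomial a) =
  (\prod_i (a i)`!)%:R * n'`!%:R / (mdeg a + n')`!%:R.
Proof.
rewrite ipxx; have := N2E (L2_monomial a); rewrite integral_sphere_mono => -[<-].
by rewrite rmorphM rmorphM fmorphV !rmorph_nat.
Qed.

(** Only the term of exponent a survives in the multinomial expansion. The remaining factor is the
    inverse of the coefficient of <z, w>^k in the kernel, which is why the kernel reproduces
    values. *)
Lemma monomial_inner_pow a w k : L2inner sigma (monomial a) (fun z => inner z w ^+ k) =
  if mdeg a == k then monomial a w / 'C(n' + k, k)%:R else 0.
Proof.
have nz j : (j`!%:R : C) != 0 by rewrite pnatr_eq0 -lt0n fact_gt0.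
have nzp (b : {ffun 'I_n -> nat}) : ((\prod_i (b i)`!)%:R : C) != 0.
  by rewrite pnatr_eq0 -lt0n prodn_gt0// => i; exact: fact_gt0.
rewrite (_ : (fun z => _) = (fun z => \sum_(b : {ffun 'I_n -> 'I_k.+1})
   (if mdeg (cube_idx b) == k then k`!%:R / (\prod_i (cube_idx b i)`!)%:R * (monomial (cube_idx
     b) w)^* else 0)
     * monomial (cube_idx b) z)); last first.
  apply/funext => z; rewrite /inner multinomial big_mkcond/=; apply: eq_bigr => b _.
  case: ifP => _; last by rewrite mul0r.
  rewrite -[RHS]mulrA (_ : _ * monomial _ _ = \prod_(i < n) (tnth z i * (tnth w i)^*) ^+ cube_idx
    b i)//.
  rewrite /monomial rmorph_prod -big_split/=.
  by apply: eq_bigr => i _; rewrite exprMn rmorphXn mulrC.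
have L2s b : L2 sigma (fun z => (if mdeg (@cube_idx n k.+1 b) == k then k`!%:R / (\prod_i
  (cube_idx b i)`!)%:R * (monomial (cube_idx b) w)^* else 0)
     * monomial (cube_idx b) z) by apply: L2Z; exact: L2_monomial.
rewrite ip_sumr//; last exact: L2_monomial.
under eq_bigr => b _ do rewrite (ipZr _ (L2_monomial (cube_idx b)) (L2_monomial a)).
case: ifPn => [/eqP ak|ak]; last first.
  rewrite big1// => b _; case: ifPn => [/eqP bk|_]; last by rewrite rmorph0 mul0r.
  rewrite monomial_orthogonal ?mulr0//.
  by apply: contra ak => /eqP ->; rewrite bk.
have aN i : (a i < k.+1)%N by rewrite ltnS -ak leq_mdeg.
pose b0 : {ffun 'I_n -> 'I_k.+1} := [ffun i => Ordinal (aN i)].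
have b0a : cube_idx b0 = a by apply/ffunP => i; rewrite !ffunE.
rewrite (bigD1 b0)//= [X in _ + X]big1 ?addr0; last first.
  move=> b bb0; rewrite monomial_orthogonal ?mulr0//.
  by apply: contra bb0 => /eqP e; apply/eqP; apply: (@cube_idx_inj n); rewrite b0a e.
rewrite b0a ak eqxx monomial_norm ak rmorphM rmorphM fmorphV !rmorph_nat/= conjCK.
have -> : (k + n')`! = ('C(n' + k, k) * (k`! * n'`!))%N.
  by rewrite [(k + n')%N]addnC -(@bin_fact (n' + k) k) ?leq_addl// addnK.
rewrite !natrM.
have := bin_gt0 (n' + k) k; rewrite leq_addl => bn.
by field; rewrite !nz nzp pnatr_eq0 -lt0n bn.
Qed.

Lemma kernelE z w : kernel z w = ((1 - inner z w) ^+ n)^-1.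
Proof. by []. Qed.

Lemma measurable_kernel w : measurable_fun setT (fun z => kernel z w).
Proof.
apply: mfunV; apply: mfunX; apply: mfunB; first exact: mfun_cst.
exact: measurable_inner.
Qed.

Lemma normc_inner_sphere z w : enorm z <= 1 -> normc (inner z w) <= enorm w.
Proof.
move=> z1; apply: le_trans (normc_inner_le _ _) _.
by rewrite ler_piMl ?enorm_ge0.
Qed.

Lemma kernel_lower z w : unit_ball w -> enorm z <= 1 -> 1 - enorm w <= normc (1 - inner z w).
Proof.
move=> w1 z1; have := ler_normcB 1 (inner z w); rewrite normc1.
have := normc_inner_sphere w z1; lra.
Qed.

Lemma kernel_bound z w : unit_ball w -> enorm z <= 1 ->
  normc (kernel z w) <= ((1 - enorm w) ^+ n)^-1.
Proof.
move=> w1 z1; have d0 : 0 < 1 - enorm w by rewrite subr_gt0.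
have h := kernel_lower w1 z1.
rewrite kernelE normcV normcX lef_pV2 ?posrE ?exprn_gt0//; last exact: lt_le_trans h.
by rewrite lerXn2r ?nnegrE ?normc_ge0// ltW.
Qed.

Lemma L2_kernel w : unit_ball w -> L2 sigma (fun z => kernel z w).
Proof.
move=> w1; have d0 : 0 < 1 - enorm w by rewrite subr_gt0.
have [] := @L2_sphere_bounded (fun z => kernel z w) ((1 - enorm w) ^+ n)^-1 (measurable_kernel w).
- by rewrite invr_ge0 exprn_ge0// ltW.
- by move=> x x1; apply: kernel_bound; rewrite ?x1.
by [].
Qed.

Definition kernel_poly N w z : C := binom_sum n' N (inner z w).

Lemma is_poly_kernel_poly N w : is_poly (kernel_poly N w).
Proof.
apply: is_poly_sum => k; apply: is_polyM; first exact: is_poly_cst.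
by apply: is_polyX; exact: is_poly_inner.
Qed.

Lemma measurable_poly f : is_poly f -> measurable_fun setT f.
Proof.
move=> /is_polyE[s fE]; rewrite (_ : f = (fun z => \sum_(a <- s) a.2 * monomial a.1 z)).
  by apply: mfun_sum => a; apply: mfunZ; exact: measurable_monomial.
exact/funext.
Qed.

Lemma L2_poly f : is_poly f -> L2 sigma f.
Proof.
move=> /is_polyE[s fE]; rewrite (_ : f = (fun z => \sum_(a <- s) a.2 * monomial a.1 z)).
  by apply: L2_sum => a; apply: L2Z; exact: L2_monomial.
exact/funext.
Qed.

Lemma kernel_poly_approx w (e : R) : unit_ball w -> 0 < e ->
  exists N0, forall N, (N0 <= N)%N -> forall z, enorm z <= 1 ->
    normc (kernel z w - kernel_poly N w z) <= e.
Proof.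
move=> w1 e0; have [|N0 HN] := @binom_series R n' (enorm w) e _ e0.
  by rewrite enorm_ge0.
by exists N0 => N NN z z1; apply: HN => //; exact: normc_inner_sphere.
Qed.

Lemma L2_inner_pow w k : L2 sigma (fun z => inner z w ^+ k).
Proof. by apply: L2_poly; apply: is_polyX; exact: is_poly_inner. Qed.

(** On a monomial, a partial sum of the kernel series reproduces the value exactly once it goes
    beyond the degree; uniform convergence on the sphere then reaches the kernel. *)
Lemma reproducing_poly f w : is_poly f -> unit_ball w ->
  L2inner sigma f (fun z => kernel z w) = f w.
Proof.
move=> /is_polyE[s fE] w1; rewrite (_ : f = (fun z => \sum_(a <- s) a.2 * monomial a.1 z));
  last exact/funext.
rewrite ip_suml; last 2 first.
- by move=> a; apply: L2Z; exact: L2_monomial.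
- exact: L2_kernel.
apply: eq_bigr => -[a c] _ /=.
rewrite ipZl; [congr (_ * _)|exact: L2_monomial|exact: L2_kernel].
have polyE N : (mdeg a < N)%N -> L2inner sigma (monomial a) (kernel_poly N w) = monomial a w.
  move=> aN; rewrite /kernel_poly /binom_sum.
  have L2s k : L2 sigma (fun z => 'C(n' + k, k)%:R * inner z w ^+ k) by apply: L2Z;
    exact: L2_inner_pow.
  rewrite ip_sumr//; last exact: L2_monomial.
  rewrite (bigD1 (Ordinal aN))//= [X in _ + X]big1 ?addr0.
    rewrite ipZr; [|exact: L2_inner_pow|exact: L2_monomial].
    rewrite monomial_inner_pow eqxx rmorph_nat mulrCA mulfV ?mulr1//.
    by rewrite pnatr_eq0 -lt0n bin_gt0 leq_addl.
  move=> k ka; rewrite ipZr; [|exact: L2_inner_pow|exact: L2_monomial].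
  rewrite monomial_inner_pow ifN ?mulr0//.
  by apply: contra ka => /eqP e; apply/eqP; apply: val_inj.
apply/eqP; rewrite -subr_eq0; apply/eqP; apply: normc_le0_eq0.
apply/ler_addgt0Pr => e e0; rewrite add0r.
have [N0 HN] := kernel_poly_approx w1 e0.
pose N := maxn N0 (mdeg a).+1.
rewrite -(polyE N); last by rewrite leq_maxr.
rewrite -ipBr; [|exact: L2_kernel|by apply: L2_poly; exact: is_poly_kernel_poly|exact: L2_monomial].
apply: le_trans (cauchy_schwarz _ _) _.
- exact: L2_monomial.
- by apply: L2B; [exact: L2_kernel|apply: L2_poly; exact: is_poly_kernel_poly].
have sph (x : Cn) : enorm x = 1 -> enorm x <= 1 by move=> ->.
have [_ h1] := @L2_sphere_bounded (monomial a) 1 (measurable_monomial a) ler01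
   (fun x x1 => normc_monomial_le a (sph x x1)).
have [_ h2] := @L2_sphere_bounded (fun z => kernel z w - kernel_poly N w z) e
   (mfunB (measurable_kernel w) (measurable_poly (is_poly_kernel_poly N w))) (ltW e0)
   (fun x x1 => HN N (leq_maxl _ _) x (sph x x1)).
by rewrite -[leRHS]mul1r; apply: ler_pM; rewrite ?nrm_ge0.
Qed.

End sphere_integrals.

Local Opaque kernel.

Lemma half_expr_le (R : realType) (e : R) : 0 < e -> exists k, 2^-1 ^+ k <= e.
Proof.
move=> e0; have /cvgrPdist_lt cv : (fun N => 1 * (2^-1 : R) ^+ N) @ \oo --> (0 : R).
  by apply: cvg_geometric; rewrite ger0_norm ?invr_ge0// invf_lt1// ltr1n.
have [N _ /(_ N (leqnn N))] := cv e e0.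
rewrite /= sub0r normrN mul1r => /ltW h; exists N; exact: le_trans (ler_norm _) h.
Qed.

(** * The Hardy space *)

Section hardy_space.
Variables (R : realType) (n' : nat).
Local Notation n := n'.+1.
Local Notation C := R[i].
Local Notation Cn := (n.-tuple C).
Local Notation sigma := (@sphere_measure R n).
Local Notation ip := (L2inner sigma).
Local Notation nrm := (nrm sigma).
Local Notation K := (fun w z : Cn => kernel z w).
Implicit Types (f g h p q : Cn -> C) (w x y z : Cn).

Lemma H2P f : H2 f <-> L2 sigma f /\ forall e : R, 0 < e ->
  exists2 p, is_poly p & nrm (fun z => f z - p z) <= e.
Proof.
split=> -[f2 hf]; split=> // e e0.
  have [p hp] := hf e e0; exists (polynomial_fun p); first exact: is_poly_fun.
  move: hp; rewrite cLnorm2_nrm ?lte_fin; first exact: ltW.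
  by apply: L2B => //; apply: L2_poly; exact: is_poly_fun.
have [_ [p ->] hp] := hf (e / 2) (divr_gt0 e0 (ltr0Sn _ 1)).
exists p; rewrite cLnorm2_nrm ?lte_fin; last first.
  by apply: L2B => //; apply: L2_poly; exact: is_poly_fun.
by apply: le_lt_trans hp _; lra.
Qed.

Lemma H2_L2 f : H2 f -> L2 sigma f.
Proof. by case. Qed.

Lemma nrm0 : nrm (fun=> 0) = 0.
Proof.
have := @nrmZ _ _ _ sigma (fun=> 0) 0 (L2_0 _); rewrite mul0r normc0 mul0r => <-.
by congr nrm; apply/funext => x; rewrite mul0r.
Qed.

Lemma H2_poly p : is_poly p -> H2 p.
Proof.
move=> pp; apply/H2P; split=> [|e e0]; first exact: L2_poly.
exists p => //; rewrite (_ : (fun z => _) = (fun=> 0)) ?nrm0 ?ltW//.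
by apply/funext => z; rewrite subrr.
Qed.

Lemma H2D f g : H2 f -> H2 g -> H2 (fun z => f z + g z).
Proof.
move=> /H2P[f2 hf] /H2P[g2 hg]; apply/H2P; split=> [|e e0]; first exact: L2D.
have e20 : 0 < e / 2 by rewrite divr_gt0.
have [p pp hp] := hf _ e20; have [q qq hq] := hg _ e20.
exists (fun z => p z + q z); first exact: is_polyD.
rewrite (_ : (fun z => _) = (fun z => (f z - p z) + (g z - q z))).
  apply: le_trans (nrmD _ _) _; [apply: L2B; rewrite //; exact: L2_poly..|].
  lra.
by apply/funext => z; rewrite opprD addrACA.
Qed.

Lemma H2Z f (k : C) : H2 f -> H2 (fun z => k * f z).
Proof.
move=> /H2P[f2 hf]; apply/H2P; split=> [|e e0]; first exact: L2Z.
have k0 := normc_ge0 k.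
have [p pp hp] := hf (e / (normc k + 1)) (divr_gt0 e0 (ltr_wpDl k0 ltr01)).
exists (fun z => k * p z); first by apply: is_polyM => //; exact: is_poly_cst.
rewrite (_ : (fun z => _) = (fun z => k * (f z - p z))).
  rewrite nrmZ; last by apply: L2B => //; exact: L2_poly.
  apply: (@le_trans _ _ ((normc k + 1) * nrm (fun z => f z - p z))).
    by rewrite ler_wpM2r ?nrm_ge0// lerDl.
  by rewrite mulrC -ler_pdivlMr// ltr_wpDl.
by apply/funext => z; rewrite mulrBr.
Qed.

Lemma H2B f g : H2 f -> H2 g -> H2 (fun z => f z - g z).
Proof.
move=> hf /(@H2Z g (-1)) hg; have := H2D hf hg.
by under eq_fun do rewrite mulN1r.
Qed.

Lemma H2_cst (k : C) : @H2 R n (fun=> k).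
Proof. by apply: H2_poly; exact: is_poly_cst. Qed.

Lemma H2_sum I (r : seq I) (F : I -> Cn -> C) :
  (forall i, H2 (F i)) -> H2 (fun x => \sum_(i <- r) F i x).
Proof.
move=> hF; elim: r => [|i r IH].
  by under eq_fun do rewrite big_nil; exact: H2_cst.
by under eq_fun do rewrite big_cons; exact: H2D.
Qed.

Lemma H2_closed f : L2 sigma f ->
  (forall e : R, 0 < e -> exists2 h, H2 h & nrm (fun z => f z - h z) <= e) -> H2 f.
Proof.
move=> f2 hf; apply/H2P; split=> // e e0.
have e20 : 0 < e / 2 by rewrite divr_gt0.
have [h /H2P[h2 hh] fh] := hf _ e20; have [p pp hp] := hh _ e20.
exists p => //; apply: le_trans (nrm_triangle f2 h2 (L2_poly pp)) _; lra.
Qed.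

Lemma H2_kernel w : unit_ball w -> H2 (K w).
Proof.
move=> w1; apply/H2P; split=> [|e e0]; first exact: L2_kernel.
have [N HN] := kernel_poly_approx w1 e0.
exists (kernel_poly N w); first exact: is_poly_kernel_poly.
have [] := @L2_sphere_bounded R n' (fun z => kernel z w - kernel_poly N w z) e
  (mfunB (measurable_kernel w) (measurable_poly (is_poly_kernel_poly N w))) (ltW e0) => //.
by move=> x x1; apply: HN => //; rewrite x1.
Qed.

Lemma H2_orth g : L2 sigma g -> (forall p, is_poly p -> ip p g = 0) ->
  forall f, H2 f -> ip f g = 0.
Proof.
move=> g2 hg f /H2P[f2 hf]; apply: normc_le0_eq0.
apply/ler_addgt0Pr => e e0; rewrite add0r.
have g0 := nrm_ge0 sigma g.
have [p pp hp] := hf (e / (nrm g + 1)) (divr_gt0 e0 (ltr_wpDl g0 ltr01)).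
have p2 := L2_poly pp.
rewrite -[ip f g]subr0 -(hg p pp) -ipBl//.
apply: le_trans (cauchy_schwarz (L2B f2 p2) g2) _.
apply: (@le_trans _ _ (nrm (fun z => f z - p z) * (nrm g + 1))).
  by rewrite ler_wpM2l ?nrm_ge0// lerDl.
by rewrite -ler_pdivlMr// ltr_wpDl.
Qed.

Lemma kernel0 z : kernel z [tuple (0 : C) | i < n] = 1.
Proof.
rewrite kernelE /inner big1 ?subr0 ?expr1n ?invr1// => i _.
by rewrite tnth_mktuple rmorph0 mulr0.
Qed.

Lemma unit_ball0 : unit_ball [tuple (0 : C) | i < n].
Proof.
rewrite /unit_ball /= /enorm big1 ?sqrtr0// => i _.
by rewrite tnth_mktuple normc0 expr0n.
Qed.

Lemma ip_poly_1 p : is_poly p -> ip p (fun=> 1) = p [tuple 0 | i < n].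
Proof.
move=> /reproducing_poly/(_ unit_ball0) <-; congr (ip _ _).
by apply/funext => z; rewrite kernel0.
Qed.

(* Both sides are f(0) g(0) when f and g are polynomials. *)
Lemma cintegral_H2M f g : H2 f -> H2 g ->
  cintegral sigma (fun x => f x * g x) = cintegral sigma f * cintegral sigma g.
Proof.
have ip1 h : cintegral sigma h = ip h (fun=> 1).
  by congr cintegral; apply/funext => x; rewrite rmorph1 mulr1.
have ipM h k : ip h (fun x => (k x)^*) = cintegral sigma (fun x => h x * k x).
  by congr cintegral; apply/funext => x; rewrite conjCK.
have c2 : L2 sigma (fun=> 1 : C) := H2_L2 (H2_cst 1).
have step h (h2 : L2 sigma h) :
    (forall p, is_poly p -> cintegral sigma (fun x => p x * h x) = cintegral sigma p * cintegral
      sigma h) ->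
    forall f, H2 f -> cintegral sigma (fun x => f x * h x) = cintegral sigma f * cintegral sigma h.
  move=> hp u u2.
  (* [ip v k] is the defect of multiplicativity, so [H2_orth] extends its vanishing from polynomials
     v to H^2; by symmetry this is used for each factor in turn. *)
  pose k := fun x : Cn => (h x)^* - (cintegral sigma h)^* * 1.
  have L2h := L2_conj h2.
  have L2c := L2Z (cintegral sigma h)^* c2.
  have kE v : L2 sigma v -> ip v k =
     cintegral sigma (fun x => v x * h x) - cintegral sigma v * cintegral sigma h.
    by move=> v2; rewrite ipBr// ipM ipZr// conjCK [X in _ - X]mulrC -ip1.
  apply/eqP; rewrite -subr_eq0 -kE; last exact: H2_L2.
  apply/eqP; apply: H2_orth u2; first exact: L2B.
  by move=> p pp; rewrite kE ?hp ?subrr//; exact: L2_poly.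
move=> f2 g2; apply: (step) f2 => [|p pp]; first exact: H2_L2.
rewrite mulrC (_ : (fun x => _) = (fun x => g x * p x)); last by apply/funext => x; rewrite mulrC.
apply: (step) g2 => [|q qq]; first exact: L2_poly.
by rewrite !ip1 !ip_poly_1//; exact: is_polyM.
Qed.

Lemma normc_ip_sphere f g (B : R) : L2 sigma f -> measurable_fun setT g -> 0 <= B ->
  (forall x, enorm x = 1 -> normc (g x) <= B) -> normc (ip f g) <= nrm f * B.
Proof.
move=> f2 mg B0 gB; have [g2 hg] := L2_sphere_bounded mg B0 gB.
by apply: le_trans (cauchy_schwarz f2 g2) _; rewrite ler_wpM2l ?nrm_ge0.
Qed.

Lemma measurable_conj_kernelM z y : measurable_fun setT (fun x => (kernel x z)^* * kernel x y).
Proof. by apply: mfunM; [apply: mfun_conj|]; exact: measurable_kernel. Qed.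

Lemma L2_conj_kernelM z y : unit_ball z -> unit_ball y ->
  L2 sigma (fun x => (kernel x z)^* * kernel x y).
Proof.
move=> z1 y1.
have d0 w : unit_ball w -> 0 <= ((1 - enorm w) ^+ n)^-1 by move=> w1;
  rewrite invr_ge0 exprn_ge0// subr_ge0 ltW.
have [] := @L2_sphere_bounded R n' (fun x => (kernel x z)^* * kernel x y)
  (((1 - enorm z) ^+ n)^-1 * ((1 - enorm y) ^+ n)^-1) (measurable_conj_kernelM z y) => //.
  by rewrite mulr_ge0// d0.
by move=> x x1; rewrite normcM normc_conj ler_pM ?normc_ge0 ?kernel_bound// x1.
Qed.

(** The reproducing property at y for the product f K_z. For polynomial f, K_z is replaced by a
    partial sum of its series, so that the product is a polynomial. With z = y it evaluates the
    integral of f |K_y|^2. *)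
Lemma ip_kernelM f z y : H2 f -> unit_ball z -> unit_ball y ->
  ip f (fun x => (kernel x z)^* * kernel x y) = ip f (K y) * kernel y z.
Proof.
move=> f2 z1 y1.
pose g := fun x => (kernel x z)^* * kernel x y - (kernel y z)^* * kernel x y.
have L2g := L2_conj_kernelM z1 y1.
have Ky := L2_kernel y1.
have cKy := L2Z (kernel y z)^* Ky.
have gE v : L2 sigma v -> ip v g = ip v (fun x => (kernel x z)^* * kernel x y) - ip v (K y) *
  kernel y z.
  by move=> v2; rewrite (ipBr L2g cKy v2) (ipZr _ Ky v2) conjCK [X in _ - X]mulrC.
apply/eqP; rewrite -subr_eq0 -gE; last exact: H2_L2.
apply/eqP; apply: H2_orth f2; first exact: L2B L2g cKy.
move=> p pp; have p2 := L2_poly pp.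
apply: normc_le0_eq0; apply/ler_addgt0Pr => e e0; rewrite add0r.
pose D := nrm p * ((1 - enorm y) ^+ n)^-1 + normc (p y).
have B0 : 0 <= ((1 - enorm y) ^+ n)^-1 by rewrite invr_ge0 exprn_ge0// subr_ge0 ltW.
have D0 : 0 <= D by rewrite addr_ge0 ?mulr_ge0 ?nrm_ge0 ?normc_ge0.
have e'0 : 0 < e / (D + 1) by rewrite divr_gt0// ltr_wpDl.
have [N HN] := kernel_poly_approx z1 e'0.
have {}HN := HN N (leqnn _).
pose k := kernel_poly N z; have kp : is_poly k := is_poly_kernel_poly N z.
have pk : ip p (fun x => (k x)^* * kernel x y) = p y * k y.
  rewrite -(reproducing_poly (is_polyM pp kp) y1); congr cintegral; apply/funext => x.
  by rewrite rmorphM/= conjCK mulrA.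
have mk : measurable_fun setT (fun x => (kernel x z - k x)^* * kernel x y).
  apply: mfunM; last exact: measurable_kernel.
  by apply: mfun_conj; apply: mfunB; [exact: measurable_kernel|exact: measurable_poly].
have kb x : enorm x = 1 -> normc ((kernel x z - k x)^* * kernel x y) <= e / (D + 1) * ((1 - enorm
  y) ^+ n)^-1.
  by move=> x1; rewrite normcM normc_conj ler_pM ?normc_ge0 ?kernel_bound ?HN// x1.
have [L2d _] := L2_sphere_bounded mk (mulr_ge0 (ltW e'0) B0) kb.
have L2k : L2 sigma (fun x => (k x)^* * kernel x y).
  rewrite (_ : (fun x => _) = (fun x => (kernel x z)^* * kernel x y - (kernel x z - k x)^* *
    kernel x y)).
    exact: L2B L2g L2d.
  by apply/funext => x; rewrite rmorphB/=; ring.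
have h1 : ip p (fun x => (kernel x z)^* * kernel x y) = ip p (fun x => (kernel x z - k x)^* *
  kernel x y) + p y * k y.
  have -> : (fun x => (kernel x z - k x)^* * kernel x y) = (fun x => (kernel x z)^* * kernel x y
    - (k x)^* * kernel x y).
    by apply/funext => x; rewrite rmorphB mulrBl.
  by rewrite (ipBr L2g L2k p2) pk subrK.
rewrite gE// reproducing_poly// h1.
have -> (u : C) : u + p y * k y - p y * kernel y z = u + p y * (k y - kernel y z) by ring.
apply: le_trans (le_normcD _ _) _.
have := normc_ip_sphere p2 mk (mulr_ge0 (ltW e'0) B0) kb => h2.
rewrite [normc (p y * _)]normcM.
have h3 : normc (k y - kernel y z) <= e / (D + 1) by rewrite normc_distC; apply: HN; exact: ltW.
apply: (@le_trans _ _ (D * (e / (D + 1)))).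
  rewrite /D [leRHS]mulrDl; apply: lerD; last by rewrite ler_wpM2l ?normc_ge0.
  by apply: le_trans h2 _; rewrite mulrCA mulrC.
by rewrite mulrCA ger_pMr// ler_pdivrMr ?ltr_wpDl// mul1r lerDl.
Qed.

Lemma reproducing_kernel w z : unit_ball w -> unit_ball z -> ip (K w) (K z) = kernel z w.
Proof.
move=> w1 z1; have := ip_kernelM (H2_cst 1) w1 z1.
rewrite reproducing_poly//; last exact: is_poly_cst.
rewrite mul1r => <-; congr cintegral; apply/funext => x.
by rewrite rmorphM/= conjCK mul1r.
Qed.

Lemma kernel_diag z : unit_ball z -> kernel z z = (N2 sigma (K z))%:C /\ 0 < N2 sigma (K z).
Proof.
move=> z1; have e : kernel z z = (N2 sigma (K z))%:C by rewrite -ipxx reproducing_kernel.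
split=> //; rewrite lt_def N2_ge0 andbT; apply/eqP => N0.
have : kernel z z != 0.
  rewrite kernelE invr_eq0 expf_neq0// -normc_gt0.
  by apply: lt_le_trans (kernel_lower z1 (ltW z1)); rewrite subr_gt0.
by rewrite e N0 eqxx.
Qed.

(** A linear form on a complex subspace whose real part is bounded below vanishes. *)
Lemma orth_of_ge0 (S : set (Cn -> C)) g (c : R) : L2 sigma g -> S `<=` L2 sigma ->
  (forall f (k : C), S f -> S (fun x => k * f x)) ->
  (forall f, S f -> 0 <= c + complex.Re (ip f g)) -> forall f, S f -> ip f g = 0.
Proof.
move=> g2 SL SZ hS f Sf; have f2 := SL _ Sf.
have hk (k : C) : 0 <= c + complex.Re (k * ip f g) by rewrite -ipZl//; exact/hS/SZ.
have c0 : 0 <= c by have := hk 0; rewrite mul0r addr0.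
have [//|I0] := eqVneq (ip f g) 0.
(* With this multiple the nonnegative quantity becomes -1. *)
have := hk ((- (c + 1))%:C * (ip f g)^-1).
by rewrite -mulrA mulVf// mulr1 => /= h; exfalso; lra.
Qed.

(** The least-norm point of the closure of the coset f - H^2 is orthogonal to H^2, and the coset is
    closed because H^2 is. *)
Lemma H2_projection f : L2 sigma f -> exists2 h, H2 h &
  forall g, H2 g -> ip (fun x => f x - h x) g = 0.
Proof.
move=> f2; pose S := [set (fun x => f x - h x) | h in @H2 R n].
have SL : S `<=` L2 sigma by move=> _ [h /H2_L2 h2 <-]; exact: L2B.
have Sne : S !=set0 by exists (fun x => f x - 0), (fun=> 0) => //; exact: H2_cst.
have Sc : is_convex S.
  move=> _ _ t [h hh <-] [k hk <-] _.
  exists (fun x => (1 - t)%:C * h x + t%:C * k x); first by apply: H2D; exact: H2Z.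
  by apply/funext => x; rewrite rmorphB rmorph1/=; ring.
have [F [g [g2 SF gF hg]]] := min_norm_convex (@sphere_fin R n') Sne SL Sc.
have fg : H2 (fun x => f x - g x).
  apply: H2_closed; first exact: L2B.
  move=> e e0.
  have [N eN] := half_expr_le e0.
  have [h hh Fh] := SF N; exists h => //.
  apply: le_trans eN; apply: le_trans (gF N).
  rewrite -Fh (_ : (fun z => _) = (fun x => f x - h x - g x))//.
  by apply/funext => x; ring.
exists (fun x => f x - g x) => // h hh.
rewrite (_ : (fun x => _) = g); last by apply/funext => x; ring.
rewrite (ip_conj (H2_L2 hh) g2).
suff -> : ip h g = 0 by rewrite rmorph0.
apply: (@orth_of_ge0 (@H2 R n) g 0) hh => //; first exact: H2_L2.
  by move=> k c; exact: H2Z.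
move=> k hk; rewrite add0r.
have := hg (fun x => f x - (f x - g x - k x)).
rewrite (_ : (fun x => _ - g x) = k); first by apply; exists (fun x => f x - g x - k x) => //;
  exact: H2B.
by apply/funext => x; ring.
Qed.

End hardy_space.

(** * Analyticity of the kernel transform *)

Lemma bin_leq_exp2 m k : ('C(m, k) <= 2 ^ m)%N.
Proof.
elim: m k => [|m IH] [|k]; rewrite ?bin0 ?expn_gt0// ?bin0n//.
by rewrite binS expnS mul2n -addnn leq_add.
Qed.

(** One term of a multinomial expansion all of whose terms are nonnegative. *)
Lemma multinomial_term_le (F : numFieldType) n (a : {ffun 'I_n -> nat}) (x : 'I_n -> F) :
  (forall i, 0 <= x i) ->
  (mdeg a)`!%:R / (\prod_i (a i)`!)%:R * \prod_i x i ^+ a i <= (\sum_i x i) ^+ mdeg a.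
Proof.
move=> x0; have aN i : (a i < (mdeg a).+1)%N by rewrite ltnS leq_mdeg.
pose b0 : {ffun 'I_n -> 'I_(mdeg a).+1} := [ffun i => Ordinal (aN i)].
have b0a : cube_idx b0 = a by apply/ffunP => i; rewrite !ffunE.
rewrite multinomial (bigD1 b0)/= ?b0a// lerDl sumr_ge0// => b _.
by rewrite !mulr_ge0 ?invr_ge0 ?prodr_ge0// => i _; rewrite exprn_ge0.
Qed.

Lemma sum_half_le (R : realType) L : \sum_(j < L) (2^-1 : R) ^+ j <= 2.
Proof.
have := subrX1 (2^-1 : R) L.
have : 0 <= (2^-1 : R) ^+ L by rewrite exprn_ge0 ?invr_ge0.
by set S := \sum_(j < L) _; lra.
Qed.

(** The sum factors into n geometric sums. *)
Lemma cube_sum_half (R : realType) n L :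
  \sum_(b : {ffun 'I_n -> 'I_L}) (2^-1 : R) ^+ mdeg (cube_idx b) <= 2 ^+ n.
Proof.
have -> : \sum_(b : {ffun 'I_n -> 'I_L}) (2^-1 : R) ^+ mdeg (cube_idx b) =
    \prod_(i < n) \sum_(j < L) (2^-1 : R) ^+ j.
  rewrite bigA_distr_bigA/=; apply: eq_bigr => b _.
  by rewrite prodrXr; congr (_ ^+ _); apply: eq_bigr => i _; rewrite ffunE.
rewrite prodr_const cardT size_enum_ord lerXn2r ?nnegrE ?sum_half_le//.
by rewrite sumr_ge0// => j _; rewrite exprn_ge0 ?invr_ge0.
Qed.

Section analyticity.
Variables (R : realType) (n' : nat).
Local Notation n := n'.+1.
Local Notation C := R[i].
Local Notation Cn := (n.-tuple C).
Local Notation sigma := (@sphere_measure R n).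
Local Notation ip := (L2inner sigma).
Local Notation nrm := (nrm sigma).
Variables (f : Cn -> C) (a : Cn).
Hypotheses (f2 : L2 sigma f) (a1 : unit_ball a).
Implicit Types (al : {ffun 'I_n -> nat}) (h x : Cn).

Let dl : R := 1 - enorm a.

Let dl0 : 0 < dl.
Proof. by rewrite /dl subr_gt0. Qed.

Let den x : C := 1 - inner x a.

Let den_ge x : enorm x = 1 -> dl <= normc (den x).
Proof. by move=> x1; apply: kernel_lower => //; rewrite x1. Qed.

Let den_neq0 x : enorm x = 1 -> den x != 0.
Proof. by move=> x1; rewrite -normc_gt0; apply: lt_le_trans (den_ge x1). Qed.

Let mden : measurable_fun setT den.
Proof. by apply: mfunB; [exact: mfun_cst|exact: measurable_inner]. Qed.

(* Expand (1 - <x, a + h>)^-n first as a binomial series in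
   <x, h> / (1 - <x, a>), then by the multinomial formula. *)
Definition taylor_kernel al x : C :=
  'C(n' + mdeg al, mdeg al)%:R * ((mdeg al)`!%:R / (\prod_i (al i)`!)%:R) *
  monomial al x * (den x ^+ (n + mdeg al))^-1.

Definition taylor_coef al : C := ip f (taylor_kernel al).

Let measurable_taylor_kernel al : measurable_fun setT (taylor_kernel al).
Proof.
apply: mfunM; first by apply: mfunZ; exact: measurable_monomial.
by apply: mfunV; exact: mfunX.
Qed.

Let normc_natr k : normc (k%:R : C) = k%:R.
Proof. by rewrite -(rmorph_nat (real_complex R)) normc_real normr_nat. Qed.

Let taylor_kernel_bound al x : enorm x = 1 -> normc (taylor_kernel al x) <=
  'C(n' + mdeg al, mdeg al)%:R * ((mdeg al)`!%:R / (\prod_i (al i)`!)%:R) * (dl ^+ (n + mdeg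
    al))^-1.
Proof.
move=> x1; rewrite 4!normcM !normcV !normc_natr normcX.
rewrite ler_pM ?mulr_ge0 ?invr_ge0 ?exprn_ge0 ?normc_ge0//.
  rewrite ger_pMr; last first.
    by rewrite mulr_gt0 ?divr_gt0 ?ltr0n ?fact_gt0 ?bin_gt0 ?leq_addl// prodn_gt0// => i;
      exact: fact_gt0.
  by apply: normc_monomial_le; rewrite x1.
have h := den_ge x1.
by rewrite lef_pV2 ?posrE ?exprn_gt0 ?(lt_le_trans dl0 h)// lerXn2r ?nnegrE ?normc_ge0// ltW.
Qed.

Let L2_taylor_kernel al : L2 sigma (taylor_kernel al).
Proof.
have [] := @L2_sphere_bounded R n' (taylor_kernel al) _ (measurable_taylor_kernel al) _
  (@taylor_kernel_bound al) => //.
by rewrite !mulr_ge0 ?invr_ge0 ?exprn_ge0// ltW.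
Qed.

(** With this radius the moduli of the coordinates of h sum to at most dl/8. The binomial
    coefficient costs a factor 2 per degree, so Taylor terms decay like 4^-|al|. *)
Let rad : R := dl / (8 * n%:R).

Let sum_le h : enorm h < rad -> \sum_(i < n) normc (tnth h i) <= dl / 8.
Proof.
move=> hr; apply: (@le_trans _ _ (\sum_(i < n) rad)).
  by apply: ler_sum => i _; apply: le_trans (normc_tnth_le _ _) (ltW hr).
by rewrite sumr_const cardT size_enum_ord -[_ *+ _]mulr_natr /rad invfM mulrA mulfVK ?pnatr_eq0.
Qed.

Let taylor_term_bound al h : enorm h < rad ->
  normc (taylor_coef al * monomial al h) <= nrm f * 2 ^+ n' * (dl ^+ n)^-1 * (4^-1) ^+ mdeg al.
Proof.
move=> hr; set k := mdeg al.
have B0 : 0 <= 'C(n' + k, k)%:R * (k`!%:R / (\prod_i (al i)`!)%:R) * (dl ^+ (n + k))^-1.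
  by rewrite !mulr_ge0 ?invr_ge0 ?exprn_ge0// ltW.
have h1 := normc_ip_sphere f2 (measurable_taylor_kernel al) B0 (@taylor_kernel_bound al).
have h2 : (k`!%:R / (\prod_i (al i)`!)%:R) * normc (monomial al h) <= (dl / 8) ^+ k.
  have h0 i : 0 <= normc (tnth h i) by exact: normc_ge0.
  have := multinomial_term_le al h0; rewrite normc_prod.
  under [X in _ * X <= _ -> _]eq_bigr do rewrite -normcX.
  move=> h3; apply: le_trans h3 _; rewrite lerXn2r ?nnegrE ?sum_le//.
    by rewrite sumr_ge0.
  by rewrite divr_ge0// ltW.
rewrite normcM; apply: le_trans (ler_wpM2r (normc_ge0 _) h1) _.
have D0 : 0 <= (dl ^+ (n + k))^-1 by rewrite invr_ge0 exprn_ge0// ltW.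
have h3 : ('C(n' + k, k)%:R : R) <= 2 ^+ (n' + k) by rewrite -natrX ler_nat bin_leq_exp2.
have -> : nrm f * ('C(n' + k, k)%:R * (k`!%:R / (\prod_i (al i)`!)%:R) / dl ^+ (n + k)) * normc
  (monomial al h) =
  nrm f * ('C(n' + k, k)%:R * (k`!%:R / (\prod_i (al i)`!)%:R * normc (monomial al h) / dl ^+ (n
    + k))) by ring.
apply: (@le_trans _ _ (nrm f * (2 ^+ (n' + k) * ((dl / 8) ^+ k * (dl ^+ (n + k))^-1)))).
  apply: ler_wpM2l; first exact: nrm_ge0.
  apply: ler_pM => //; first by apply: mulr_ge0 => //; rewrite !mulr_ge0 ?invr_ge0 ?normc_ge0.
  exact: ler_wpM2r.
rewrite -!mulrA ler_wpM2l ?nrm_ge0//.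
have d1 : dl != 0 by rewrite gt_eqF.
have -> : (8 : R) = 2 * 4 by ring.
rewrite !exprD expr_div_n exprMn.
rewrite le_eqVlt; apply/orP; left; apply/eqP.
rewrite exprVn; field.
by rewrite !expf_neq0// ?d1//= pnatr_eq0.
Qed.

Let taylor_homog k h : homog_part taylor_coef k h =
  ip f (fun x => 'C(n' + k, k)%:R * (inner x h / den x) ^+ k * (den x ^+ n)^-1).
Proof.
pose F (b : {ffun 'I_n -> 'I_k.+1}) x : C :=
  (if mdeg (cube_idx b) == k then (monomial (cube_idx b) h)^* else 0) * taylor_kernel (cube_idx
    b) x.
have FL2 b : L2 sigma (F b) by apply: L2Z; exact: L2_taylor_kernel.
transitivity (ip f (fun x => \sum_b F b x)).
  rewrite ip_sumr// /homog_part big_mkcond/=; apply: eq_bigr => b _.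
  rewrite ipZr//; case: ifP => _; last by rewrite rmorph0 mul0r.
  by rewrite conjCK mulrC.
congr (ip _ _); apply/funext => x; rewrite /inner expr_div_n multinomial.
rewrite [in RHS]big_mkcond /= mulr_suml mulr_sumr mulr_suml; apply: eq_bigr => b _.
rewrite /F; case: ifPn => [/eqP bk|_]; last by rewrite !mul0r mulr0 mul0r.
rewrite /taylor_kernel bk exprD invfM /monomial rmorph_prod.
have -> : \prod_i (tnth x i * (tnth h i)^*) ^+ cube_idx b i =
   \prod_i tnth x i ^+ cube_idx b i * \prod_i (tnth h i ^+ cube_idx b i)^*.
  by rewrite -big_split/=; apply: eq_bigr => i _; rewrite exprMn rmorphXn.
rewrite /=; ring.
Qed.

Let taylor_partial N h : \sum_(k < N) homog_part taylor_coef k h =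
  ip f (fun x => binom_sum n' N (inner x h / den x) * (den x ^+ n)^-1).
Proof.
under eq_bigr do rewrite taylor_homog.
rewrite -ip_sumr//.
  by congr (ip _ _); apply/funext => x; rewrite -mulr_suml.
move=> k.
have [] := @L2_sphere_bounded R n' (fun x => 'C(n' + k,
  k)%:R * (inner x h / den x) ^+ k * (den x ^+ n)^-1)
   ('C(n' + k, k)%:R * (enorm h / dl) ^+ k * (dl ^+ n)^-1) => //.
- apply: mfunM; last by apply: mfunV; exact: mfunX.
  apply: mfunZ; apply: mfunX; apply: mfunM; first exact: measurable_inner.
  exact: mfunV.
- by rewrite !mulr_ge0 ?invr_ge0 ?exprn_ge0 ?divr_ge0 ?enorm_ge0// ltW.
move=> x x1; have d1 := den_ge x1; have d2 : 0 < normc (den x) := lt_le_trans dl0 d1.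
rewrite 2!normcM normcV !normcX normc_natr normcM normcV.
rewrite ler_pM ?mulr_ge0 ?invr_ge0 ?exprn_ge0 ?mulr_ge0 ?invr_ge0 ?normc_ge0//.
  have dl1 := ltW dl0.
  rewrite ler_wpM2l// lerXn2r ?nnegrE ?mulr_ge0 ?invr_ge0 ?normc_ge0 ?enorm_ge0//.
  rewrite ler_pM ?invr_ge0 ?normc_ge0//; first by apply: normc_inner_sphere; rewrite x1.
  by rewrite lef_pV2 ?posrE.
by rewrite lef_pV2 ?posrE ?exprn_gt0// lerXn2r ?nnegrE ?normc_ge0// ltW.
Qed.

Let inner_small x h : enorm x = 1 -> enorm h < rad -> normc (inner x h / den x) <= 8^-1.
Proof.
move=> x1 hr; have d1 := den_ge x1; have d2 : 0 < normc (den x) := lt_le_trans dl0 d1.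
rewrite normcM normcV ler_pdivrMr//.
have h1 : normc (inner x h) <= enorm h by apply: normc_inner_sphere; rewrite x1.
have h2 : rad <= dl / 8.
  rewrite /rad invfM mulrA ger_pMr ?divr_gt0// invf_le1 ?ler1n ?ltr0n//.
apply: le_trans h1 _; apply: le_trans (ltW hr) _; apply: le_trans h2 _.
by rewrite mulrC ler_wpM2l// invr_ge0.
Qed.

Let kernel_taylor x h : enorm x = 1 ->
  kernel x (tadd a h) = ((1 - inner x h / den x) ^+ n)^-1 * (den x ^+ n)^-1.
Proof.
move=> x1; rewrite kernelE -invfM -exprMn; congr ((_ ^+ _)^-1).
have -> : inner x (tadd a h) = inner x a + inner x h.
  by rewrite -inner_conj innerDl rmorphD/= !inner_conj.
rewrite mulrBl mul1r mulfVK ?den_neq0// /den; ring.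
Qed.

(** The binomial series has ratio at most 1/8 on the sphere; its uniform convergence there passes
    through the inner product with f. *)
Let taylor_conv h (e : R) : enorm h < rad -> 0 < e ->
  exists N0, forall N, (N0 <= N)%N ->
    normc (\sum_(k < N) homog_part taylor_coef k h - ip f (fun x => kernel x (tadd a h))) <= e.
Proof.
move=> hr e0.
have f0 := nrm_ge0 sigma f.
have dn0 : 0 <= (dl ^+ n)^-1 by rewrite invr_ge0 exprn_ge0// ltW.
pose B := nrm f * (dl ^+ n)^-1.
have B0 : 0 <= B by rewrite mulr_ge0.
have q8 : 0 <= (8^-1 : R) < 1 by apply/andP; split; lra.
have e'0 : 0 < e / (B + 1) by rewrite divr_gt0// ltr_wpDl.
have [N0 HN] := @binom_series R n' 8^-1 _ q8 e'0.
exists N0 => N NN; rewrite taylor_partial.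
pose G x := binom_sum n' N (inner x h / den x) * (den x ^+ n)^-1.
have mG : measurable_fun setT G.
  apply: mfunM; last by apply: mfunV; exact: mfunX.
  apply: mfun_sum => k; apply: mfunZ; apply: mfunX; apply: mfunM; first exact: measurable_inner.
  exact: mfunV.
have mk : measurable_fun setT (fun x => kernel x (tadd a h)) by exact: measurable_kernel.
have bd x : enorm x = 1 -> normc (kernel x (tadd a h) - G x) <= e / (B + 1) * (dl ^+ n)^-1.
  move=> x1; have d1 := den_ge x1.
  rewrite kernel_taylor// /G -mulrBl normcM normcV normcX ler_pM ?normc_ge0//.
  - by rewrite invr_ge0 exprn_ge0 ?normc_ge0.
  - by apply: HN => //; exact: inner_small.
  by rewrite lef_pV2 ?posrE ?exprn_gt0 ?(lt_le_trans dl0 d1)// lerXn2r ?nnegrE ?normc_ge0// ltW.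
have e''0 : 0 <= e / (B + 1) * (dl ^+ n)^-1 by rewrite mulr_ge0// ltW.
have mD := mfunB mk mG.
have [L2d _] := L2_sphere_bounded mD e''0 bd.
have L2G : L2 sigma G.
  have [] := @L2_sphere_bounded R n' G ((\sum_(k < N) 'C(n' + k,
    k)%:R * 8^-1 ^+ k) * (dl ^+ n)^-1) mG => //.
    by rewrite mulr_ge0// sumr_ge0// => k _; rewrite mulr_ge0 ?exprn_ge0 ?invr_ge0.
  move=> x x1; have d1 := den_ge x1;
    rewrite normcM normcV normcX ler_pM ?normc_ge0 ?invr_ge0 ?exprn_ge0 ?normc_ge0//.
    apply: le_trans (normc_sum _ _ _) _; apply: ler_sum => k _.
    rewrite normcM normcX normc_natr ler_wpM2l// lerXn2r ?nnegrE ?normc_ge0 ?invr_ge0//.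
    exact: inner_small.
  by rewrite lef_pV2 ?posrE ?exprn_gt0 ?(lt_le_trans dl0 d1)// lerXn2r ?nnegrE ?normc_ge0// ltW.
have L2k : L2 sigma (fun x => kernel x (tadd a h)).
  rewrite (_ : (fun x => _) = (fun x => (kernel x (tadd a h) - G x) + G x));
    first exact: L2D L2d L2G.
  by apply/funext => x; rewrite subrK.
rewrite normc_distC -(ipBr L2k L2G f2).
apply: le_trans (normc_ip_sphere f2 mD e''0 bd) _.
rewrite mulrCA -/B mulrAC -mulrA ger_pMr// ler_pdivrMr ?ltr_wpDl//.
by rewrite mul1r lerDl.
Qed.

(** [taylor_conv] handles the sums by degree; the cubes of [analytic_at] add only terms of degree at
    least N, whose total is of order 2^-N. *)
Lemma analytic_ip_kernel : analytic_at (fun w => ip f (fun x => kernel x w)) a.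
Proof.
exists rad, taylor_coef; split; first by rewrite divr_gt0// mulr_gt0// ltr0n.
move=> h hr; pose A := nrm f * 2 ^+ n' * (dl ^+ n)^-1.
have A0 : 0 <= A by rewrite !mulr_ge0 ?nrm_ge0 ?invr_ge0 ?exprn_ge0// ltW.
have term (al : {ffun 'I_n -> nat}) N : (N <= mdeg al)%N ->
    normc (taylor_coef al * monomial al h) <= A * 2^-1 ^+ N * 2^-1 ^+ mdeg al.
  move=> Nal; apply: le_trans (taylor_term_bound al hr) _.
  rewrite -/A -[leRHS]mulrA ler_wpM2l//.
  (* One half per degree pays for the smallness of the tail, the other for summability over the
     exponents. *)
  have -> : (4^-1 : R) = 2^-1 * 2^-1 by field.
  rewrite exprMn ler_wpM2r ?exprn_ge0 ?invr_ge0//.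
  by rewrite ler_wiXn2l ?invr_ge0// invf_le1 ?ler1n.
split.
  apply: (@esum_le_cube_sum R n _ (A * 2 ^+ n)) => [al|L]; first exact: normc_ge0.
  apply: (@le_trans _ _ (\sum_(b : {ffun 'I_n -> 'I_L}) A * 2^-1 ^+ mdeg (cube_idx b))).
    apply: ler_sum => b _; have := term (cube_idx b) 0%N (leq0n _).
    by rewrite expr0 mulr1.
  by rewrite -mulr_sumr ler_wpM2l// cube_sum_half.
apply/cvgrPdist_le => e e0.
have e20 : 0 < e / 2 by rewrite divr_gt0.
have [N1 HN1] := taylor_conv hr e20.
have /cvgrPdist_lt cv : (fun N => (A * 2 ^+ n) * (2^-1 : R) ^+ N) @ \oo --> (0 : R).
  by apply: cvg_geometric; rewrite ger0_norm ?invr_ge0// invf_lt1// ltr1n.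
have [N2 _ HN2] := cv _ e20.
exists (maxn N1 N2) => // N /=; rewrite geq_max => /andP[NN1 NN2].
rewrite sub0r normrN ger0_norm ?normc_ge0//.
have -> : \sum_(beta : {ffun 'I_n -> 'I_N})
   taylor_coef [ffun i => beta i : nat] * monomial [ffun i => beta i : nat] h =
   \sum_(b : {ffun 'I_n -> 'I_N}) taylor_coef (cube_idx b) * monomial (cube_idx b) h by [].
rewrite (cube_sum_split _ _ (leqnn N)) addrAC.
apply: le_trans (le_normcD _ _) _.
have h1 := HN1 N NN1; have /ltW h2 := HN2 N NN2.
rewrite sub0r normrN in h2; have {}h2 := le_trans (ler_norm _) h2.
suff h3 : normc (\sum_(b : {ffun 'I_n -> 'I_N} | (N <= mdeg (cube_idx b))%N)
    taylor_coef (cube_idx b) * monomial (cube_idx b) h) <= A * 2 ^+ n * 2^-1 ^+ N.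
  rewrite /tadd in h1; lra.
apply: le_trans (normc_sum _ _ _) _.
apply: (@le_trans _ _ (\sum_(b : {ffun 'I_n -> 'I_N}) A * 2^-1 ^+ N * 2^-1 ^+ mdeg (cube_idx b))).
  rewrite big_mkcond/=; apply: ler_sum => b _; case: ifP => [Nb|_]; first exact: term.
  by apply: mulr_ge0; [apply: mulr_ge0|]; rewrite ?exprn_ge0 ?invr_ge0.
rewrite -mulr_sumr -[leRHS]mulrA [X in _ <= _ * X]mulrC mulrA ler_wpM2l ?cube_sum_half//.
by apply: mulr_ge0; rewrite ?exprn_ge0 ?invr_ge0.
Qed.

End analyticity.

(** * The interpolation functional *)

Section interpolation.
Variables (R : realType) (n' m : nat).
Local Notation n := n'.+1.
Local Notation C := R[i].
Local Notation Cn := (n.-tuple C).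
Local Notation sigma := (@sphere_measure R n).
Local Notation ip := (L2inner sigma).
Local Notation nrm := (nrm sigma).
Local Notation I1 f := (Rintegral sigma setT (fun x : Cn => normc (f x))).
Local Notation K := (fun w z : Cn => kernel z w).
Variable z : 'I_m -> Cn.
Hypothesis z_ball : forall i, unit_ball (z i).
Implicit Types (f g h q : Cn -> C) (w : 'I_m -> C) (a : 'I_m -> C).

Definition kernel_sum a (x : Cn) : C := \sum_(j < m) a j * kernel x (z j).

Lemma H2_kernel_sum a : H2 (kernel_sum a).
Proof. by apply: H2_sum => j; apply: H2Z; exact: H2_kernel. Qed.

Lemma ip_kernel_sumr f a : L2 sigma f ->
  ip f (kernel_sum a) = \sum_j (a j)^* * ip f (K (z j)).
Proof.
move=> f2; rewrite ip_sumr//; last by move=> j; apply: L2Z; exact: L2_kernel.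
by apply: eq_bigr => j _; exact: ipZr (L2_kernel (z_ball j)) f2.
Qed.

Lemma kernel_sum_eval a y : unit_ball y -> ip (kernel_sum a) (K y) = kernel_sum a y.
Proof.
move=> y1; rewrite ip_suml; last exact: L2_kernel; last first.
  by move=> j; apply: L2Z; exact: L2_kernel.
apply: eq_bigr => j _.
by rewrite (ipZl _ (L2_kernel (z_ball j)) (L2_kernel y1)) reproducing_kernel.
Qed.

Hypothesis z_inj : injective z.

(** Vanishing at the nodes gives norm zero, by pairing the sum with itself; hence p |-> sum of
    conj(a_j) p(z_j) kills every polynomial, in particular one that singles out z_k. *)
Lemma kernel_sum_eq0 a : (forall i, kernel_sum a (z i) = 0) -> forall k, a k = 0.
Proof.
move=> a0 k; have h2 := H2_L2 (H2_kernel_sum a).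
have n0 : nrm (kernel_sum a) = 0.
  apply/eqP; rewrite -sqrf_eq0 sqr_nrm; apply/eqP.
  have : ip (kernel_sum a) (kernel_sum a) = 0.
    by rewrite ip_kernel_sumr// big1// => j _; rewrite kernel_sum_eval// a0 mulr0.
  by rewrite ipxx => /(congr1 (@complex.Re R)).
have ev p : is_poly p -> \sum_j (a j)^* * p (z j) = 0.
  move=> pp; have := cauchy_schwarz (L2_poly pp) h2; rewrite n0 mulr0 => /normc_le0_eq0.
  rewrite ip_kernel_sumr; last exact: L2_poly.
  by move=> e; rewrite -[RHS]e; apply: eq_bigr => j _; rewrite reproducing_poly.
have exc j : exists i, j != k -> tnth (z k) i != tnth (z j) i.
  have [->|jk] := eqVneq j k; first by exists ord0.
  apply: contrapT => hn; case/eqP: jk; apply: z_inj; apply: eq_from_tnth => i.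
  by apply/eqP; apply: contrapT => hi; apply: hn; exists i => _; rewrite eq_sym; apply/negP.
have [c hc] := choice exc.
(* Vanishes at every node but z_k, each factor using a coordinate that separates z_k from z_j. *)
pose p (x : Cn) := \prod_(j | j != k) (tnth x (c j) - tnth (z j) (c j)).
have pp : is_poly p.
  by apply: is_poly_prod => j; apply: is_polyB; [exact: is_poly_coord|exact: is_poly_cst].
have pk : p (z k) != 0 by apply/prodf_neq0 => j jk; rewrite subr_eq0 hc.
have := ev p pp; rewrite (bigD1 k)//= big1 ?addr0.
  by move/eqP; rewrite mulf_eq0 (negbTE pk) orbF conjc_eq0 => /eqP.
by move=> j jk; rewrite [p _](bigD1 j)//= subrr mul0r mulr0.
Qed.

Lemma gram_unit : \matrix_(i < m, j < m) kernel (z i) (z j) \in unitmx.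
Proof.
rewrite -unitmx_tr -row_free_unit -kermx_eq0; apply/rowV0P => v /sub_kermxP v0.
apply/rowP => k; rewrite mxE; apply: (@kernel_sum_eq0 (fun j => v ord0 j)) => i.
have := congr1 (fun M : 'rV_m => M ord0 i) v0; rewrite mxE [RHS]mxE => <-.
by apply: eq_bigr => j _; rewrite !mxE.
Qed.

Lemma psiE w : psi z w = kernel_sum (fun j => coeffs z w j ord0).
Proof. by []. Qed.

Lemma H2_psi w : H2 (psi z w).
Proof. by rewrite psiE; exact: H2_kernel_sum. Qed.

Lemma psi_val w i : psi z w (z i) = w i.
Proof.
have := mulKVmx gram_unit (\col_(i < m) w i).
rewrite -/(coeffs z w) => /(congr1 (fun M : 'cV_m => M i ord0)).
rewrite mxE [RHS]mxE => <-; rewrite /psi.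
by apply: eq_bigr => j _; rewrite [X in _ = X * _]mxE mulrC.
Qed.

Lemma psi_eval w i : ip (psi z w) (K (z i)) = w i.
Proof. by rewrite psiE kernel_sum_eval// -psiE psi_val. Qed.

Lemma QspaceP q : Qspace z q <-> exists a, q = kernel_sum a.
Proof. by split=> [[a _ <-]|[a ->]]; [exists a|exists a]. Qed.

Lemma MspaceP f : Mspace f <-> [/\ L2 sigma f, forall h, @H2 R n h -> ip f h = 0 &
  forall h, @H2 R n h -> ip f (fun x => (h x)^*) = 0].
Proof.
split=> [[f2 hf]|[f2 h1 h2]]; split=> //.
- move=> h hh; apply: hf; exists h => //; exists (fun=> 0).
    by exists (fun=> 0); [exact: H2_cst|apply/funext => x; rewrite rmorph0].
  by apply/funext => x; rewrite addr0.
- move=> h hh; apply: hf; exists (fun=> 0); first exact: H2_cst.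
  by exists (fun x => (h x)^*); [exists h|apply/funext => x; rewrite add0r].
- move=> _ [h hh [_ [k hk <-] <-]].
  rewrite (ipDr (H2_L2 hh) (L2_conj (H2_L2 hk)) f2) h1// h2// addr0//.
Qed.

Lemma H20P f : H20 f <-> H2 f /\ cintegral sigma f = 0.
Proof.
have e : ip f (cst 1) = cintegral sigma f.
  by congr cintegral; apply/funext => x; rewrite rmorph1 mulr1.
by split=> -[hf f0]; split=> //; [rewrite -e f0|move=> _ ->; rewrite e].
Qed.

Lemma MQ_L2 f : MQ z f -> L2 sigma f.
Proof.
move=> [_ [_ [a _ <-] <-]] [_ [g /MspaceP[g2 _ _] [h /H20P[/H2_L2 h2 _] <-]] <-].
apply: L2D; last exact: L2D.
by apply: L2_conj; exact: H2_L2 (H2_kernel_sum a).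
Qed.

Lemma MQZ f (k : C) : MQ z f -> MQ z (fun x => k * f x).
Proof.
move=> [_ [_ [a _ <-] <-]] [_ [g /MspaceP[g2 g3 g4] [h /H20P[hh h0] <-]] <-].
exists (fun x => (kernel_sum (fun j => k^* * a j) x)^*).
  by exists (kernel_sum (fun j => k^* * a j)) => //; apply/QspaceP; exists (fun j => k^* * a j).
exists (fun x => k * g x + k * h x).
  exists (fun x => k * g x).
    apply/MspaceP; split=> [|u hu|u hu]; first exact: L2Z.
      by rewrite (ipZl _ g2 (H2_L2 hu)) g3// mulr0.
    by rewrite (ipZl _ g2 (L2_conj (H2_L2 hu))) g4// mulr0.
  exists (fun x => k * h x) => //; apply/H20P; split; first exact: H2Z.
  by rewrite cintegralZ ?h0 ?mulr0//; exact: (L2_cint (@sphere_fin R n') (H2_L2 hh)).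
apply/funext => x; rewrite -mulrDr [RHS]mulrDr; congr (_ + _).
rewrite /kernel_sum !rmorph_sum/= mulr_sumr; apply: eq_bigr => j _.
by rewrite -mulrA rmorphM/= conjCK.
Qed.

Lemma MQ_conj_kernel_sum a : MQ z (fun x => (kernel_sum a x)^*).
Proof.
have ip0 h : ip (fun=> 0) h = 0.
  transitivity (cintegral sigma (fun=> 0)); last exact: cintegral0.
  by congr cintegral; apply/funext => x; rewrite mul0r.
exists (fun x => (kernel_sum a x)^*).
  by exists (kernel_sum a) => //; apply/QspaceP; exists a.
exists (fun=> 0); last by apply/funext => x; rewrite addr0.
exists (fun=> 0); first by apply/MspaceP; split=> //; exact: L2_0.
exists (fun=> 0); last by apply/funext => x; rewrite addr0.
by apply/H20P; split; [exact: H2_cst|exact: cintegral0].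
Qed.

Lemma cLnorm1E f : L2 sigma f -> cLnorm sigma 1%:E f = (I1 f)%:E.
Proof.
move=> f2; rewrite /cLnorm Lnorm1 /Rintegral fineK.
  by apply: eq_integral => x _; rewrite /= ger0_norm ?normc_ge0.
have [_ fi] := L2_cint (@sphere_fin R n') f2.
exact: (integrable_fin_num measurableT fi).
Qed.

(* psi - p is a polynomial plus a kernel sum, hence in H2, and f is orthogonal to
   conj H2 except for its component in conj Q, which only sees values at the z_j. *)
Lemma Pi_interpolation_le w (phi : Cn -> C) (M : R) (t : C) f :
  (forall y, unit_ball y -> analytic_at phi y) ->
  (forall y, unit_ball y -> normc (phi y) <= M) ->
  (forall i, phi (z i) = t * w i) -> MQ z f -> I1 f <= 1 ->
  normc (t * Pi z w f) <= M.
Proof.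
move=> phia phib phiw Mf f1; have f2 := MQ_L2 Mf.
case: Mf => [_ [_ [a _ <-] <-]] [_ [g /MspaceP[g2 _ g3] [h /H20P[hh h0] <-]] fE].
have h2 := H2_L2 hh.
pose S := \sum_j normc (a j).
have S0 : 0 <= S by apply: sumr_ge0 => j _; exact: normc_ge0.
apply/ler_addgt0Pr => e e0.
(* The approximation error enters once through the bound on p and S times through the values at the
   nodes, for a total of e. *)
have e'0 : 0 < e / (S + 1) by rewrite divr_gt0// ltr_wpDl.
have [p [pp pb pz]] := bounded_analytic_poly_approx phia phib z_ball e'0.
have p2 := L2_poly pp.
pose d x := p x - t * psi z w x.
have hd : H2 d by apply: H2B; [exact: H2_poly|apply: H2Z; exact: H2_psi].
have d2 := H2_L2 hd.
have q2 := H2_L2 (H2_kernel_sum a).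
(* The component g drops out because it is orthogonal to conj d, and h because the mean of d h is
   the product of the means and h has mean 0. *)
have dE : cintegral sigma (fun x => d x * f x) = \sum_j (a j)^* * (p (z j) - t * w j).
  have -> : (fun x => d x * f x) = (fun x => d x * (kernel_sum a x)^* + (d x * g x + d x * h x)).
    by apply/funext => x; rewrite -fE /kernel_sum -!mulrDr.
  have c1 := cint_ip d2 q2; have c2 := cint_mulL2 d2 g2; have c3 := cint_mulL2 d2 h2.
  rewrite (cintegralD c1 (cintD c2 c3)) (cintegralD c2 c3).
  have -> : cintegral sigma (fun x => d x * g x) = 0.
    rewrite -(g3 _ hd); congr cintegral; apply/funext => x; by rewrite conjCK mulrC.
  rewrite (cintegral_H2M hd hh) h0 mulr0 !addr0 -/(ip d (kernel_sum a)) ip_kernel_sumr//.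
  apply: eq_bigr => j _; congr (_ * _).
  rewrite (ipBl p2 (L2Z t (H2_L2 (H2_psi w))) (L2_kernel (z_ball j))).
  by rewrite (ipZl _ (H2_L2 (H2_psi w)) (L2_kernel (z_ball j))) reproducing_poly// psi_eval.
have E : t * Pi z w f = cintegral sigma (fun x => p x * f x) - cintegral sigma (fun x => d x * f x).
  rewrite /Pi -cintegralZ; last exact: cint_mulL2 (H2_L2 (H2_psi w)) f2.
  rewrite -(cintegralB (cint_mulL2 p2 f2) (cint_mulL2 d2 f2)); congr cintegral.
  by apply/funext => x; rewrite /d; ring.
have b1 : normc (cintegral sigma (fun x => d x * f x)) <= e / (S + 1) * S.
  rewrite dE; apply: le_trans (normc_sum _ _ _) _; rewrite mulr_sumr; apply: ler_sum => j _.
  by rewrite normcM normc_conj mulrC ler_wpM2r ?normc_ge0// -phiw.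
have M0 : 0 <= M.
  apply: le_trans (phib _ (unit_ball0 R n')); exact: normc_ge0.
have b2 : normc (cintegral sigma (fun x => p x * f x)) <= M + e / (S + 1).
  have c := cint_mulL2 p2 f2; apply: le_trans (normc_cintegral_le c) _.
  have [mf fi] := L2_cint (@sphere_fin R n') f2; have [mpf pfi] := c.
  have B0 : 0 <= M + e / (S + 1) by rewrite addr_ge0// ltW.
  apply: (@le_trans _ _ ((M + e / (S + 1)) * I1 f)); last by rewrite -[leRHS]mulr1 ler_wpM2l.
  rewrite -RintegralZl// -lee_fin /Rintegral !fineK.
  - apply: ge0_integral_sphere_le.
    + exact: mfun_normc.
    + by apply: measurable_funM => //; exact: mfun_normc.
    + by move=> x; exact: normc_ge0.
    + by move=> x; rewrite mulr_ge0 ?normc_ge0.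
    + by move=> x x1; rewrite normcM ler_wpM2r ?normc_ge0// pb.
  - exact: (integrable_fin_num measurableT (integrable_EFinZ _ fi)).
  - exact: (integrable_fin_num measurableT pfi).
rewrite E; apply: le_trans (normcB _ _) _; apply: le_trans (lerD b2 b1) _.
rewrite -addrA lerD2l -[X in X + _]mulr1 -mulrDr [1 + S]addrC mulfVK// gt_eqF// ltr_wpDl//.
Qed.

Section finite_norm.
Variable w : 'I_m -> C.
Local Notation N := (fine (Pi_norm z w)).
Hypothesis Nfin : (Pi_norm z w < +oo)%E.

Lemma Pi_norm_ub f : MQ z f -> I1 f <= 1 -> ((normc (Pi z w f))%:E <= Pi_norm z w)%E.
Proof.
move=> Mf f1; apply: ereal_sup_ubound; exists f => //; split=> //.
by rewrite cLnorm1E ?lee_fin//; exact: MQ_L2.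
Qed.

Lemma Pi_norm_fineK : Pi_norm z w = N%:E /\ 0 <= N.
Proof.
have h : (0 <= Pi_norm z w)%E.
  apply: le_trans (Pi_norm_ub (MQ_conj_kernel_sum (fun=> 0)) _); first by rewrite lee_fin normc_ge0.
  rewrite /Rintegral integral0_eq//= => x _.
  by rewrite /kernel_sum big1 ?rmorph0 ?normc0// => j _; rewrite mul0r.
by split; [rewrite fineK// ge0_fin_numE|rewrite fine_ge0].
Qed.

Lemma Pi_le f : MQ z f -> normc (Pi z w f) <= N * I1 f.
Proof.
move=> Mf; have f2 := MQ_L2 Mf; have [NE N0] := Pi_norm_fineK.
have [_ fi] := L2_cint (@sphere_fin R n') f2.
have I0 : 0 <= I1 f by apply: Rintegral_ge0 => x _; exact: normc_ge0.
apply/ler_addgt0Pr => e e0.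
(* Normalizing by slightly more than the L^1 norm avoids dividing by zero. *)
pose s := I1 f + e / (N + 1).
have s0 : 0 < s by rewrite ltr_wpDl// divr_gt0// ltr_wpDl.
have := @Pi_norm_ub (fun x => (s^-1)%:C * f x) (MQZ _ Mf).
have -> : Pi z w (fun x => (s^-1)%:C * f x) = (s^-1)%:C * Pi z w f.
  rewrite /Pi -cintegralZ; last exact: cint_mulL2 (H2_L2 (H2_psi w)) f2.
  by congr cintegral; apply/funext => x; rewrite mulrCA.
have -> : I1 (fun x => (s^-1)%:C * f x) = s^-1 * I1 f.
  rewrite -RintegralZl//; congr Rintegral; apply/funext => x.
  by rewrite normcM normc_real gtr0_norm ?invr_gt0.
have l1 : s^-1 * I1 f <= 1.
  by rewrite mulrC ler_pdivrMr// mul1r lerDl divr_ge0 ?addr_ge0// ltW.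
move=> /(_ l1); rewrite NE lee_fin normcM normc_real gtr0_norm ?invr_gt0// ler_pdivrMl// => h.
apply: le_trans h _; rewrite mulrC mulrDr lerD2l mulrCA ger_pMr// ler_pdivrMr ?ltr_wpDl//.
by rewrite mul1r lerDl.
Qed.

End finite_norm.
End interpolation.

(** * The extremal function *)

Section extremal_function.
Variables (R : realType) (n' m : nat).
Local Notation n := n'.+1.
Local Notation C := R[i].
Local Notation Cn := (n.-tuple C).
Local Notation sigma := (@sphere_measure R n).
Local Notation ip := (L2inner sigma).
Local Notation nrm := (nrm sigma).
Local Notation N2 := (N2 sigma).
Local Notation I1 f := (Rintegral sigma setT (fun x : Cn => normc (f x))).
Local Notation K := (fun w z : Cn => kernel z w).
Variable z : 'I_m -> Cn.
Hypotheses (z_ball : forall i, unit_ball (z i)) (z_inj : injective z).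
Variable w : 'I_m -> C.
Local Notation N := (fine (Pi_norm z w)).
Hypothesis Nfin : (Pi_norm z w < +oo)%E.
Implicit Types (f g h u G : Cn -> C).

Let N0 : 0 <= N.
Proof. by have [] := Pi_norm_fineK z_ball Nfin. Qed.

Definition vanishing : set (Cn -> C) :=
  [set h | H2 h /\ forall i, ip h (K (z i)) = 0].

Definition interpolating : set (Cn -> C) :=
  [set h | H2 h /\ forall i, ip h (K (z i)) = w i].

(** Representatives bounded at every point, so that products with them need no exceptional null
    set. *)
Definition bounded_by_norm : set (Cn -> C) :=
  [set G | measurable_fun setT G /\ forall x, normc (G x) <= N].

Lemma ip_psi g v : L2 sigma g ->
  ip g (psi z v) = \sum_j (coeffs z v j ord0)^* * ip g (K (z j)).
Proof. exact: ip_kernel_sumr. Qed.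

(** Let q be the element of Q with the same pairings as u against the K_(z_i). Then r = u - q is
    orthogonal to H^2, and conj r splits into its H^2 projection h, of mean 0, and a part in
    M(S^n). *)
Lemma MQ_conj_orth u : L2 sigma u -> (forall h, vanishing h -> ip h u = 0) ->
  MQ z (fun x => (u x)^*).
Proof.
move=> u2 hu; have Kz i := L2_kernel (z_ball i).
pose q := psi z (fun i => ip u (K (z i))).
have qH : H2 q := H2_psi z_ball _; have q2 := H2_L2 qH.
pose r x := u x - q x; have r2 : L2 sigma r := L2B u2 q2.
have rK i : ip r (K (z i)) = 0 by rewrite (ipBl u2 q2 (Kz i)) psi_eval// subrr.
(* g is an element p of Q plus a function vanishing at the nodes: the latter is orthogonal to u by
   hypothesis and to q because q is in Q; p is orthogonal to r by the choice of q. *)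
have rH g : H2 g -> ip g r = 0.
  move=> gH; have g2 := H2_L2 gH.
  pose p := psi z (fun i => ip g (K (z i))).
  have pH : H2 p := H2_psi z_ball _; have p2 := H2_L2 pH.
  pose d x := g x - p x; have d2 : L2 sigma d := L2B g2 p2.
  have v : vanishing d.
    by split; [exact: H2B|move=> i; rewrite (ipBl g2 p2 (Kz i)) psi_eval// subrr].
  have e1 : ip d r = 0.
    rewrite (ipBr u2 q2 d2) (hu _ v) (ip_psi _ d2).
    by rewrite big1 ?subr0// => j _; case: v => _ ->; rewrite mulr0.
  have e2 : ip p r = 0.
    rewrite (ip_conj r2 p2) (ip_psi _ r2) big1 ?rmorph0// => j _.
    by rewrite rK mulr0.
  by move: e1; rewrite (ipBl g2 p2 r2) e2 subr0.
have rc2 := L2_conj r2.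
have [h hH hr] := H2_projection rc2; have h2 := H2_L2 hH.
exists (fun x => (q x)^*).
  by exists q => //; apply/QspaceP; exists (fun j => coeffs z (fun i => ip u (K (z i))) j ord0).
(* The projection keeps the mean, and the mean of conj r is <1, r> = 0. *)
have h0 : cintegral sigma h = 0.
  have := hr _ (H2_cst n' 1); rewrite (ipBl rc2 h2 (H2_L2 (H2_cst n' 1))).
  have -> : ip (fun x => (r x)^*) (fun=> 1) = ip (fun=> 1) r.
    by congr cintegral; apply/funext => x; rewrite rmorph1 mulr1 mul1r.
  rewrite rH ?sub0r; last exact: H2_cst.
  have -> : ip h (fun=> 1) = cintegral sigma h.
    by congr cintegral; apply/funext => x; rewrite rmorph1 mulr1.
  by move/eqP; rewrite oppr_eq0 => /eqP.
exists (fun x => ((r x)^* - h x) + h x).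
  exists (fun x => (r x)^* - h x); last by exists h => //; apply/H20P.
  apply/MspaceP; split=> [|//|g gH]; first exact: L2B.
  have g2 := H2_L2 gH.
  rewrite (ipBl rc2 h2 (L2_conj g2)).
  have -> : ip (fun x => (r x)^*) (fun x => (g x)^*) = ip g r.
    by congr cintegral; apply/funext => x; rewrite conjCK mulrC.
  have -> : ip h (fun x => (g x)^*) = cintegral sigma (fun x => h x * g x).
    by congr cintegral; apply/funext => x; rewrite conjCK.
  by rewrite rH// (cintegral_H2M hH gH) h0 mul0r subr0.
by apply/funext => x; rewrite subrK /r rmorphB/= addrC subrK.
Qed.

Lemma L2_bounded_by_norm G : bounded_by_norm G -> L2 sigma G /\ nrm G <= N.
Proof. by move=> [mG GN]; apply: L2_sphere_bounded => // x _; exact: GN. Qed.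

Lemma bounded_by_norm_convex : is_convex bounded_by_norm.
Proof.
move=> F G t [mF FN] [mG GN] /andP[t0 t1].
split=> [|x]; first by apply: mfunD; exact: mfunZ.
apply: le_trans (le_normcD _ _) _; rewrite !normcM !normc_real ger0_norm ?subr_ge0// ger0_norm//.
have s0 : 0 <= 1 - t by rewrite subr_ge0.
have := ler_wpM2l s0 (FN x); have := ler_wpM2l t0 (GN x); lra.
Qed.

Lemma interpolating_convex : is_convex interpolating.
Proof.
move=> f g t [fH fw] [gH gw] _; split=> [|i]; first by apply: H2D; exact: H2Z.
have f2 := H2_L2 fH; have g2 := H2_L2 gH; have Kz := L2_kernel (z_ball i).
rewrite (ipDl (L2Z _ f2) (L2Z _ g2) Kz) (ipZl _ f2 Kz) (ipZl _ g2 Kz) fw gw rmorphB rmorph1/=; ring.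
Qed.

(* The point u of least norm in the closure of A - B is orthogonal to the
   functions of H^2 vanishing at the z_i, so conj u lies in M_Q; comparing u with
   psi - N u / |u| then yields |u|^2 <= Re Pi(conj u) - N |u|_1 <= 0. *)
Lemma interpolating_bounded_dist (e : R) : 0 < e ->
  exists a G, [/\ interpolating a, bounded_by_norm G & nrm (fun x => a x - G x) <= e].
Proof.
move=> e0.
pose S := [set f | exists a G, [/\ interpolating a, bounded_by_norm G & f = (fun x => a x - G x)]].
have AL2 a : interpolating a -> L2 sigma a by case=> /H2_L2.
have BL2 G : bounded_by_norm G -> L2 sigma G by move=> /L2_bounded_by_norm[].
have SL : S `<=` L2 sigma by move=> _ [a [G [/AL2 a2 /BL2 G2 ->]]]; exact: L2B.
have psiA : interpolating (psi z w) by split=> [|i]; [exact: H2_psi|exact: psi_eval].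
have p2 := AL2 _ psiA.
have B0 : bounded_by_norm (fun=> 0) by split=> [|x]; rewrite ?normc0//; exact: mfun_cst.
have Sne : S !=set0 by exists (fun x => psi z w x - 0), (psi z w), (fun=> 0).
have Sc : is_convex S.
  move=> _ _ t [a [G [aA GB ->]]] [b [H [bA HB ->]]] t01.
  exists (fun x => (1 - t)%:C * a x + t%:C * b x), (fun x => (1 - t)%:C * G x + t%:C * H x).
  split; [exact: interpolating_convex|exact: bounded_by_norm_convex|].
  by apply/funext => x; ring.
have [F [u [u2 SF uF hu]]] := min_norm_convex (@sphere_fin R n') Sne SL Sc.
(* Adding such an h to psi stays among the interpolants, so minimality bounds Re <h, u> below on a
   complex subspace. *)
have uV h : vanishing h -> ip h u = 0.
  apply: (@orth_of_ge0 R n' vanishing u (complex.Re (ip (fun x => psi z w x - u x) u))) => //.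
  - by move=> f [/H2_L2].
  - move=> f k [fH f0]; split=> [|i]; first exact: H2Z.
    by rewrite (ipZl _ (H2_L2 fH) (L2_kernel (z_ball i))) f0 mulr0.
  move=> f [fH f0]; have f2 := H2_L2 fH.
  have := hu (fun x => (psi z w x + f x) - 0).
  have -> : (fun x => psi z w x + f x - 0 - u x) = (fun x => (psi z w x - u x) + f x).
    by apply/funext => x; ring.
  rewrite (ipDl (L2B p2 u2) f2 u2) ReD; apply.
  exists (fun x => psi z w x + f x), (fun=> 0); split=> //.
  case: psiA => pH pw; split=> [|i]; first exact: H2D.
  by rewrite (ipDl p2 f2 (L2_kernel (z_ball i))) pw f0 addr0.
have Pu := Pi_le z_ball Nfin (MQ_conj_orth u2 uV).
have u0 : nrm u = 0.
  pose G x := (N * (normc (u x))^-1)%:C * u x.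
  have mu := L2_m u2.
  have GB : bounded_by_norm G.
    split=> [|x].
      apply: mfunM => //; rewrite (_ : (fun x => _) = (fun x => N%:C * ((normc (u x))%:C)^-1)).
        by apply: mfunZ; apply: mfunV; apply: mfun_real; exact: mfun_normc.
      by apply/funext => x; rewrite rmorphM/= fmorphV.
    rewrite normcM normc_real normrM (ger0_norm N0) normfV ger0_norm ?normc_ge0//.
    have [->|ux] := eqVneq (normc (u x)) 0; first by rewrite mulr0.
    by rewrite mulfVK.
  have G2 := BL2 _ GB.
  have := hu (fun x => psi z w x - G x) (ex_intro _ _ (ex_intro _ _ (And3 psiA GB erefl))).
  have pG := L2B p2 G2.
  rewrite (ipBl pG u2 u2) (ipBl p2 G2 u2) !ReD !ReN ipxx (_ : complex.Re (N2 u)%:C = N2 u)//.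
  have -> : complex.Re (ip G u) = N * I1 u.
    rewrite Re_cintegral -RintegralZl//; last by case: (L2_cint (@sphere_fin R n') u2).
    congr Rintegral; apply/funext => x.
    rewrite /G -mulrA mulr_conj -rmorphM/= expr2 mulrA.
    have [->|ux] := eqVneq (normc (u x)) 0; first by rewrite !mulr0.
    by rewrite mulfVK.
  have h1 : complex.Re (ip (psi z w) u) <= N * I1 u.
    apply: le_trans (ler_norm _) _; apply: le_trans (normr_Re_le _) _.
    apply: le_trans Pu _; rewrite le_eqVlt; apply/orP; left; apply/eqP; congr (_ * _).
    by congr Rintegral; apply/funext => x; rewrite normc_conj.
  move=> h2; apply/eqP; rewrite -sqrf_eq0 sqr_nrm eq_le N2_ge0 andbT; lra.
have [k hk] := half_expr_le e0; have [a [G [aA GB Fk]]] := SF k.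
exists a, G; split=> //; apply: le_trans hk; apply: le_trans (uF k).
have F2 : L2 sigma (F k) by exact: SL.
have := nrmD (L2B F2 u2) u2; rewrite u0 addr0 -Fk; apply: le_trans.
by rewrite le_eqVlt; apply/orP; left; apply/eqP; congr nrm; apply/funext => x; rewrite subrK.
Qed.

(** That interpolants and bounded functions come arbitrarily close does not by itself make any
    sequence converge; the nested convex sets S k do. The limit interpolates because H^2 is closed
    and pairing with K_(z_i) is continuous. *)
Lemma extremal_exists : exists f, interpolating f /\ forall e : R, 0 < e ->
  exists2 G, bounded_by_norm G & nrm (fun x => f x - G x) <= e.
Proof.
pose S k := [set G | bounded_by_norm G /\ exists2 a, interpolating a &
  nrm (fun x => a x - G x) <= 2^-1 ^+ k].
have AL2 a : interpolating a -> L2 sigma a by case=> /H2_L2.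
have BL2 G : bounded_by_norm G -> L2 sigma G by move=> /L2_bounded_by_norm[].
have SL k : S k `<=` L2 sigma by move=> G [/BL2].
have Sc k : is_convex (S k).
  move=> F G t [FB [a aA aF]] [GB [b bA bG]] t01; split; first exact: bounded_by_norm_convex.
  exists (fun x => (1 - t)%:C * a x + t%:C * b x); first exact: interpolating_convex.
  have d1 := L2B (AL2 _ aA) (BL2 _ FB); have d2 := L2B (AL2 _ bA) (BL2 _ GB).
  have := nrmD (L2Z (1 - t)%:C d1) (L2Z t%:C d2).
  rewrite !nrmZ// !normc_real; case/andP: t01 => t0 t1.
  rewrite ger0_norm ?subr_ge0// ger0_norm// => h.
  apply: (@le_trans _ _ ((1 - t) * 2^-1 ^+ k + t * 2^-1 ^+ k)); last by rewrite -mulrDl subrK mul1r.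
  apply: le_trans (lerD (ler_wpM2l _ aF) (ler_wpM2l t0 bG)); last by rewrite subr_ge0.
  apply: le_trans h; rewrite le_eqVlt; apply/orP; left; apply/eqP.
  by congr nrm; apply/funext => x; ring.
have Sd i j : (i <= j)%N -> S j `<=` S i.
  move=> ij G [GB [a aA aG]]; split=> //; exists a => //; apply: le_trans aG _.
  by rewrite ler_wiXn2l ?invr_ge0// invf_le1// ler1n.
have Sne k : exists G, S k G /\ N2 G <= N ^+ 2.
  have [|a [G [aA GB aG]]] := @interpolating_bounded_dist (2^-1 ^+ k).
    by rewrite exprn_gt0 ?invr_gt0.
  exists G; split; first by split=> //; exists a.
  have [_ h] := L2_bounded_by_norm GB.
  by rewrite -sqr_nrm lerXn2r ?nnegrE ?nrm_ge0.
have [F [D [f [f2 SF fF _]]]] := nested_convex (@sphere_fin R n') SL Sc Sd Sne.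
have near (e : R) : 0 < e -> exists2 a, interpolating a & nrm (fun x => f x - a x) <= e.
  move=> e0; have [|k hk] := @half_expr_le R (e / 2); first by rewrite divr_gt0.
  have [[FB [a aA aF]] _] := SF k; exists a => //.
  have := nrm_triangle f2 (BL2 _ FB) (AL2 _ aA).
  rewrite nrm_distC [X in _ <= _ + X]nrm_distC => h; apply: le_trans h _.
  have := fF k; rewrite nrm_distC => h3; lra.
exists f; split.
  split=> [|i].
    by apply: H2_closed => // e /near[a [aH _] h]; exists a.
  have Kz := L2_kernel (z_ball i).
  apply/eqP; rewrite -subr_eq0; apply/eqP; apply: normc_le0_eq0.
  apply/ler_addgt0Pr => e e0; rewrite add0r.
  have k0 := nrm_ge0 sigma (K (z i)).
  have [|a aA h] := near (e / (nrm (K (z i)) + 1)); first by rewrite divr_gt0// ltr_wpDl.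
  have a2 := AL2 _ aA; case: aA => _ /(_ i) <-; rewrite -(ipBl f2 a2 Kz).
  apply: le_trans (cauchy_schwarz (L2B f2 a2) Kz) _.
  apply: le_trans (ler_wpM2r k0 h) _; rewrite mulrAC -mulrA ger_pMr// ler_pdivrMr ?ltr_wpDl//.
  by rewrite mul1r lerDl.
move=> e e0; have [k hk] := half_expr_le e0.
have [[FB _] _] := SF k; exists (F k) => //.
by rewrite nrm_distC; apply: le_trans (fF k) hk.
Qed.

Lemma mul_bounded_by_norm G g : bounded_by_norm G -> L2 sigma g ->
  L2 sigma (fun x => G x * g x) /\ N2 (fun x => G x * g x) <= N ^+ 2 * N2 g.
Proof.
move=> [mG GN] g2; have gi := integrable_EFinZ (N ^+ 2) (L2_int g2).
have le x : normc (G x * g x) ^+ 2 <= N ^+ 2 * normc (g x) ^+ 2.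
  by rewrite normcM exprMn ler_wpM2r ?sqr_ge0// lerXn2r ?nnegrE ?normc_ge0.
have Gg : L2 sigma (fun x => G x * g x) by apply: (L2_le _ gi le); exact: mfunM mG (L2_m g2).
split=> //; rewrite -RintegralZl//; last exact: L2_int.
by apply: le_Rintegral => //; exact: L2_int.
Qed.

Section bound.
Variable f : Cn -> C.
Hypothesis fA : interpolating f.
Hypothesis fB : forall e : R, 0 < e ->
  exists2 G, bounded_by_norm G & nrm (fun x => f x - G x) <= e.

Let f2 : L2 sigma f.
Proof. by case: fA => /H2_L2. Qed.

Let ip_kernel_sqr G y : ip G (fun x => (kernel x y)^* * kernel x y) =
  ip (fun x => G x * kernel x y) (K y).
Proof.
by congr cintegral; apply/funext => x; rewrite rmorphM/= conjCK mulrA.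
Qed.

Let ip_f_sqr y : unit_ball y ->
  ip f (fun x => (kernel x y)^* * kernel x y) = ip f (K y) * (N2 (K y))%:C.
Proof.
move=> y1; rewrite (ip_kernelM _ y1 y1); last by case: fA.
by have [->] := kernel_diag y1.
Qed.

(** Only G is bounded pointwise, so f is first replaced by G at a cost proportional to the distance;
    for G the bound is Cauchy-Schwarz on <G K_y, K_y>. *)
Lemma extremal_le y : unit_ball y -> normc (ip f (K y)) <= N.
Proof.
move=> y1; have [_ k0] := kernel_diag y1; have Ky := L2_kernel y1.
have L2kk := L2_conj_kernelM y1 y1.
rewrite -(ler_pM2r k0); apply/ler_addgt0Pr => e e0.
pose D := nrm (fun x => (kernel x y)^* * kernel x y).
have D0 : 0 <= D by exact: nrm_ge0.
have [|G GB fG] := fB (e := e / (D + 1)); first by rewrite divr_gt0// ltr_wpDl.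
have [G2 _] := L2_bounded_by_norm GB.
have -> : normc (ip f (K y)) * N2 (K y) = normc (ip f (fun x => (kernel x y)^* * kernel x y)).
  by rewrite ip_f_sqr// normcM normc_real ger0_norm// ltW.
have -> : ip f (fun x => (kernel x y)^* * kernel x y) =
    ip (fun x => G x * kernel x y) (K y) + ip (fun x => f x - G x) (fun x => (kernel x y)^* *
      kernel x y).
  by rewrite (ipBl f2 G2 L2kk) -ip_kernel_sqr addrC subrK.
apply: le_trans (le_normcD _ _) _; apply: lerD.
  have [L2Gk hGk] := mul_bounded_by_norm GB Ky.
  apply: le_trans (cauchy_schwarz L2Gk Ky) _.
  rewrite -sqr_nrm expr2 mulrA ler_wpM2r ?nrm_ge0//.
  by rewrite -(@ler_pXn2r _ 2) ?nnegrE ?mulr_ge0 ?nrm_ge0// exprMn !sqr_nrm.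
apply: le_trans (cauchy_schwarz (L2B f2 G2) L2kk) _.
apply: le_trans (ler_wpM2r D0 fG) _; rewrite mulrAC -mulrA ger_pMr// ler_pdivrMr ?ltr_wpDl//.
by rewrite mul1r lerDl.
Qed.

Let sph1 (x : Cn) : enorm x = 1 -> enorm x <= 1.
Proof. by move=> ->. Qed.

(** |1 - <x, y>| <= 2. A lower bound for the weight |K_y|^2 on the sphere lets weighted L^2
    estimates be unweighted. *)
Let kernel_ge (x y : Cn) : enorm x = 1 -> unit_ball y -> 1 <= 2 ^+ n * normc (kernel x y).
Proof.
move=> x1 y1; have h : normc (1 - inner x y) <= 2.
  apply: le_trans (normcB _ _) _; rewrite normc1.
  have := normc_inner_sphere y (sph1 x1); move: y1; rewrite /unit_ball/=; lra.
have h0 : 0 < normc (1 - inner x y).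
  by apply: lt_le_trans (kernel_lower y1 (sph1 x1)); rewrite subr_gt0.
rewrite kernelE normcV normcX ler_pdivlMr ?exprn_gt0// mul1r.
by rewrite lerXn2r ?nnegrE ?normc_ge0.
Qed.

(* Equality makes the averages of |G - c|^2 against |K_y|^2 tend to 0. *)
Lemma extremal_eq_cst y : unit_ball y -> normc (ip f (K y)) = N ->
  forall x, unit_ball x -> ip f (K x) = ip f (K y).
Proof.
move=> y1 cN; set c := ip f (K y); have [_ k0] := kernel_diag y1; have Ky := L2_kernel y1.
have L2kk := L2_conj_kernelM y1 y1.
have c2 : L2 sigma (fun=> c) := H2_L2 (H2_cst n' c).
pose D := nrm (fun x => (kernel x y)^* * kernel x y).
have D0 : 0 <= D by exact: nrm_ge0.
(* The first factor removes the weight by [kernel_ge]; the second comes from the cross term in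
   [h1]. *)
pose E : R := (2 ^+ n) ^+ 2 * (2 * N * D).
have E0 : 0 <= E by rewrite mulr_ge0 ?sqr_ge0// !mulr_ge0.
have key (e : R) : 0 < e -> e <= 1 -> N2 (fun x => f x - c) <= (2 + 2 * E) * e.
  move=> e0 e1; have [G GB fG] := fB e0; have [G2 _] := L2_bounded_by_norm GB.
  have [L2Gk hGk] := mul_bounded_by_norm GB Ky.
  have L2ck := L2Z c Ky.
  (* Expanding the square, the two squared norms contribute at most 2 N^2 |K_y|^2 and the cross term
     is - 2 N^2 |K_y|^2 up to the error from replacing f by G, because |c| = N. *)
  have h1 : N2 (fun x => G x * kernel x y - c * kernel x y) <= 2 * N * D * e.
    rewrite (N2B L2Gk L2ck) (N2Z _ Ky) cN (ipZr _ Ky L2Gk) -ip_kernel_sqr.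
    have -> : ip G (fun x => (kernel x y)^* * kernel x y) = c * (N2 (K y))%:C -
        ip (fun x => f x - G x) (fun x => (kernel x y)^* * kernel x y).
      by rewrite (ipBl f2 G2 L2kk) ip_f_sqr// -/c; ring.
    set err := ip (fun x => f x - G x) _.
    have her : normc err <= e * D.
      by apply: le_trans (cauchy_schwarz (L2B f2 G2) L2kk) _; exact: ler_wpM2r.
    have -> : c^* * (c * (N2 (K y))%:C - err) = (N ^+ 2 * N2 (K y))%:C - c^* * err.
      by rewrite mulrBr mulrA [c^* * c]mulrC mulr_conj cN -rmorphM.
    rewrite ReD ReN (_ : complex.Re (N ^+ 2 * N2 (K y))%:C = N ^+ 2 * N2 (K y))//.
    have := normr_Re_le (c^* * err); rewrite normcM normc_conj cN => h.
    have h' := le_trans (ler_norm _) h; have := ler_wpM2l N0 her; lra.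
  have L2d := L2B G2 c2.
  have L2dk : L2 sigma (fun x => G x * kernel x y - c * kernel x y) := L2B L2Gk L2ck.
  have h2 : N2 (fun x => G x - c) <= E * e.
    apply: (@le_trans _ _ ((2 ^+ n) ^+ 2 * N2 (fun x => G x * kernel x y - c * kernel x y))).
      have i2 := L2_int L2dk; rewrite -RintegralZl// -lee_fin /Rintegral !fineK.
      - apply: ge0_integral_sphere_le.
        + by apply: measurable_funX; exact: mfun_normc (L2_m L2d).
        + by apply: measurable_funM => //; apply: measurable_funX; exact: mfun_normc (L2_m L2dk).
        + by move=> x; exact: sqr_ge0.
        + by move=> x; rewrite mulr_ge0 ?sqr_ge0.
        + move=> x x1; rewrite -mulrBl normcM -exprMn lerXn2r ?nnegrE ?mulr_ge0 ?normc_ge0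
          ?exprn_ge0//.
          by rewrite mulrCA ler_peMr ?normc_ge0// kernel_ge.
      - exact: (integrable_fin_num measurableT (integrable_EFinZ _ i2)).
      - exact: (integrable_fin_num measurableT (L2_int L2d)).
    by rewrite /E -[leRHS]mulrA ler_wpM2l ?sqr_ge0.
  have fG2 : N2 (fun x => f x - G x) <= e.
    rewrite -sqr_nrm; apply: (@le_trans _ _ (e ^+ 2)).
      by rewrite lerXn2r ?nnegrE ?nrm_ge0// ltW.
    by rewrite expr2 ger_pMr.
  (* Gives |f - c|^2 <= 2 |f - G|^2 + 2 |G - c|^2 for the L^2 norms. *)
  have := parallelogram (L2B f2 G2) L2d.
  have -> : (fun x => f x - G x + (G x - c)) = (fun x => f x - c) by apply/funext => x; ring.
  have := N2_ge0 sigma (fun x => f x - G x - (G x - c)); lra.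
have z0 : nrm (fun x => f x - c) = 0.
  apply/eqP; rewrite -sqrf_eq0 sqr_nrm eq_le N2_ge0 andbT.
  apply/ler_addgt0Pr => e e0; rewrite add0r.
  have B0 : 0 < 2 + 2 * E by lra.
  pose d := Num.min 1 (e / (2 + 2 * E)).
  apply: le_trans (key d _ _) _; first by rewrite lt_min ltr01 divr_gt0.
    by rewrite ge_min lexx.
  by rewrite -ler_pdivlMl// mulrC ge_min lexx orbT.
move=> x x1; have Kx := L2_kernel x1.
have := cauchy_schwarz (L2B f2 c2) Kx; rewrite z0 mul0r => /normc_le0_eq0.
rewrite (ipBl f2 c2 Kx) (reproducing_poly (@is_poly_cst R n c) x1).
by move/eqP; rewrite subr_eq0 => /eqP.
Qed.

End bound.
End extremal_function.

Section norm_bounds.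
Variables (R : realType) (n' m : nat).
Local Notation n := n'.+1.
Local Notation C := R[i].
Local Notation Cn := (n.-tuple C).
Local Notation sigma := (@sphere_measure R n).
Local Notation I1 f := (Rintegral sigma setT (fun x : Cn => normc (f x))).
Variables (z : 'I_m -> Cn) (w : 'I_m -> C).
Hypotheses (z_ball : forall i, unit_ball (z i)) (z_inj : injective z).

Lemma sup_norm_fineK (phi : Cn -> C) : (sup_norm phi < +oo)%E ->
  sup_norm phi = (fine (sup_norm phi))%:E /\
  forall y, unit_ball y -> normc (phi y) <= fine (sup_norm phi).
Proof.
move=> pf; have ub y : unit_ball y -> ((normc (phi y))%:E <= sup_norm phi)%E.
  by move=> y1; apply: ereal_sup_ubound; exists y.
have e : sup_norm phi = (fine (sup_norm phi))%:E.
  rewrite fineK// ge0_fin_numE//; apply: le_trans (ub _ (unit_ball0 R n')).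
  by rewrite lee_fin normc_ge0.
by split=> // y /ub; rewrite [in X in (_ <= X)%E]e lee_fin.
Qed.

(** The scale t = 1 serves the given interpolant. For data divided by N, t = 1/N yields N <= N M, so
    a competitor cannot have norm below 1. *)
Lemma Pi_norm_le (phi : Cn -> C) (M t : R) :
  (forall y, unit_ball y -> analytic_at phi y) ->
  (forall y, unit_ball y -> normc (phi y) <= M) -> 0 < t ->
  (forall i, phi (z i) = t%:C * w i) -> (Pi_norm z w <= (t^-1 * M)%:E)%E.
Proof.
move=> phia phib t0 phiw; apply: ge_ereal_sup => _ [f [Mf f1] <-].
have I1f : I1 f <= 1 by move: f1; rewrite (cLnorm1E (MQ_L2 z_ball Mf)) lee_fin.
have := Pi_interpolation_le z_ball z_inj phia phib phiw Mf I1f.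
by rewrite normcM normc_real gtr0_norm// lee_fin ler_pdivlMl.
Qed.

(** Testing the functional on the conjugate of K_(z_i) returns w_i. *)
Lemma Pi_norm_gt0 i : (Pi_norm z w < +oo)%E -> w i <> 0 -> 0 < fine (Pi_norm z w).
Proof.
move=> Nfin wi; have [_ N0] := Pi_norm_fineK z_ball Nfin.
rewrite lt_def N0 andbT; apply/eqP => N00; apply: wi.
pose a j : C := (j == i)%:R.
have := Pi_le z_ball Nfin (MQ_conj_kernel_sum z a); rewrite N00 mul0r => /normc_le0_eq0.
have -> : Pi z w (fun x => (kernel_sum z a x)^*) = L2inner sigma (psi z w) (kernel_sum z a) by [].
rewrite (ip_kernel_sumr z_ball)//; last exact: H2_L2 (H2_psi z_ball w).
rewrite (bigD1 i)//= big1 ?addr0; last by move=> j ji; rewrite /a (negbTE ji) rmorph0 mul0r.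
by rewrite /a eqxx rmorph1 mul1r psi_eval.
Qed.

End norm_bounds.

Theorem theorem9 (R : realType) (n m : nat) (hn : (1 <= n)%N) (hm : (1 < m)%N)
    (z : 'I_m -> n.-tuple R[i]) (w : 'I_m -> R[i])
    (z_ball : forall i, unit_ball (z i)) (z_inj : injective z)
    (w_disc : forall i, normc (w i) < 1)
    (w_nonconst : exists i j, w i <> w j)
    (solvable : exists phi, schur_class phi /\ forall i, phi (z i) = w i) :
  (0 < Pi_norm z w < +oo)%E /\
  let what := fun j => ((fine (Pi_norm z w))^-1)%:C * w j in
  (forall j, normc (what j) < 1) /\ solves_extremal z what.
Proof.
case: n hn z z_ball z_inj solvable => [//|n'] _ z z_ball z_inj [phi [[[phia phif] phi1] phiw]].
have [phiE phib] := sup_norm_fineK phif.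
have Nfin : (Pi_norm z w < +oo)%E.
  apply: le_lt_trans (Pi_norm_le z_ball z_inj phia phib ltr01 _) (ltry _).
  by move=> i; rewrite rmorph1 mul1r.
have [i [j wij]] := w_nonconst.
(* Data that are not all equal contain a nonzero value, which keeps the norm from vanishing. *)
have [k wk] : exists k, w k <> 0.
  apply: contrapT => h; apply: wij.
  have w0 l : w l = 0 by apply: contrapT => hl; apply: h; exists l.
  by rewrite !w0.
have Np := Pi_norm_gt0 z_ball z_inj Nfin wk.
have [NE _] := Pi_norm_fineK z_ball Nfin.
split; first by rewrite NE lte_fin Np ltry.
set N := fine (Pi_norm z w) in Np NE *; move=> what.
have [f [fA fB]] := extremal_exists z_ball z_inj Nfin.
have f2 : L2 (@sphere_measure R n'.+1) f by case: fA => /H2_L2.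
have fle := extremal_le z_ball Nfin fA fB.
have fz l : L2inner (@sphere_measure R n'.+1) f (fun x => kernel x (z l)) = w l by case: fA.
split=> [l|].
  rewrite normcM normc_real gtr0_norm ?invr_gt0// mulrC ltr_pdivrMr// mul1r lt_neqAle.
  rewrite -fz fle// andbT; apply/eqP => e; apply: wij.
  have cst_eq := extremal_eq_cst z_ball Nfin fA fB (z_ball l) e.
  by rewrite -(fz i) -(fz j) (cst_eq _ (z_ball i)) (cst_eq _ (z_ball j)).
split=> [|psi' [[psia psif] psi1] psiw].
  (* Dividing by N inside the pairing makes analyticity immediate, since [analytic_ip_kernel]
     accepts any L^2 function. *)
  pose g x := (N^-1)%:C * f x; have g2 : L2 (@sphere_measure R n'.+1) g by exact: L2Z.
  have gE y : unit_ball y -> L2inner (@sphere_measure R n'.+1) g (fun x => kernel x y) =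
      (N^-1)%:C * L2inner (@sphere_measure R n'.+1) f (fun x => kernel x y).
    by move=> y1; exact: ipZl f2 (L2_kernel y1).
  exists (fun y => L2inner (@sphere_measure R n'.+1) g (fun x => kernel x y)).
  have s1 : (sup_norm (fun y => L2inner (@sphere_measure R n'.+1) g (fun x => kernel x y)) <= 1)%E.
    apply: ge_ereal_sup => _ [y y1 <-]; rewrite lee_fin gE// normcM normc_real.
    by rewrite gtr0_norm ?invr_gt0// ler_pdivrMl// mulr1 fle.
  split; last by move=> l; rewrite gE// fz.
  split=> //; split; last exact: le_lt_trans s1 (ltry 1).
  by move=> y y1; exact: analytic_ip_kernel.
have [psiE psib] := sup_norm_fineK psif.
have N10 : 0 < N^-1 by rewrite invr_gt0.
have := Pi_norm_le z_ball z_inj psia psib N10 psiw.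
rewrite NE invrK lee_fin ler_pMr// => le1.
by apply/eqP; rewrite eq_le psi1/= psiE lee_fin.
Qed.
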